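(* Let $\lambda$ be a $\mathbb{Q}$-linearly independent frequency, $(G,\beta)$ a $\lambda$-Dirichlet group, and $X$ a Banach space. Then for every $1\le p<\infty$ and all $f\in H_p^\lambda(G,X)$ we have $$\Big\|\sup_N\big\|\sum_{n=1}^N\widehat f(h_{\lambda_n})h_{\lambda_n}\big\|_X\Big\|_{L_p(G)}\le 2\|f\|_p.$$ In particular, almost everywhere on $G$ we have $$f=\sum_{n=1}^\infty\widehat f(h_{\lambda_n})h_{\lambda_n}.$$
   Context: Banach spaces are complex. A frequency is a strictly increasing sequence $\lambda=(\lambda_n)_{n\ge 1}$ of non-negative real numbers with $\lambda_n\to\infty$. A $\lambda$-Dirichlet group is a pair $(G,\beta)$ where $G$ is a compact abelian group and $\beta:\mathbb{R}\to G$ is a continuous homomorphism with dense range such that for every $n$ there is a (necessarily unique) character $h_{\lambda_n}\in\widehat G$ with $h_{\lambda_n}(\beta(t))=e^{-i\lambda_n t}$ for all $t\in\mathbb{R}$. With $m$ the normalized Haar measure and $\widehat f(\gamma)=\int_G f\,\overline{\gamma}\,dm$, $H_p^\lambda(G,X)$ is the space of all $f\in L_p(G,X)$ (Bochner space) with $\widehat f(\gamma)=0$ unless $\gamma=h_{\lambda_n}$ for some $n$. *)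

(* Defs.v *)
From HB Require Import structures.
From mathcomp Require Import all_boot all_order all_algebra.
From mathcomp Require Import complex.
From mathcomp Require Import all_classical all_reals all_analysis.

Set Implicit Arguments.
Unset Strict Implicit.
Unset Printing Implicit Defensive.

Import Order.TTheory GRing.Theory Num.Theory.
Import numFieldNormedType.Exports.

Local Open Scope classical_set_scope.
Local Open Scope ring_scope.

(* In a normed module over R[i] the norm takes its values in R[i] (with
   imaginary part 0); this is the same norm, read in R. *)
Definition rnorm (R : realType) (V : normedModType R[i]) (x : V) : R :=
  complex.Re `|x|.

Section Bochner.
Context d (T : measurableType d) (R : realType) (P : probability T R).
Variable X : completeNormedModType R[i].
Implicit Types (s f : T -> X) (v : X) (p : R).

Definition simple_fun s : Prop :=
  finite_set (range s) /\ forall v, measurable (s @^-1` [set v]).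

Definition simple_integral s : X :=
  \sum_(v \in range s) (fine (P (s @^-1` [set v])))%:C%C *: v.

Definition strongly_measurable f : Prop :=
  exists s_ : nat -> T -> X, (forall n, simple_fun (s_ n)) /\
    {ae P, forall x, s_ n x @[n --> \oo] --> f x}.

Definition is_bochner_integral f v : Prop :=
  strongly_measurable f /\
  exists s_ : nat -> T -> X,
    [/\ forall n, simple_fun (s_ n),
        (\int[P]_x (rnorm (f x - s_ n x))%:E)%E @[n --> \oo] --> 0%E &
        simple_integral (s_ n) @[n --> \oo] --> v].

(* The value is 0 when f is not Bochner integrable. *)
Definition bochner_integral f : X := xget 0 (is_bochner_integral f).

Definition bochner_norm p f : \bar R := Lnorm P p%:E (fun x => (rnorm (f x))%:E).

(* Elements of L_p(P, X) are represented by functions, not by classes. *)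
Definition bochner_Lp p f : Prop :=
  strongly_measurable f /\ (bochner_norm p f < +oo)%E.

End Bochner.

Definition borel (G : topologicalZmodType) : Type := G.

Section BorelInstance.
Variable G : topologicalZmodType.

HB.instance Definition _ := Choice.copy (borel G) G.
HB.instance Definition _ := isPointed.Build (borel G) (0 : G).
HB.instance Definition _ :=
  @isMeasurable.Build (sigma_display (@open G)) (borel G)
    <<s (@open G : set (set (borel G))) >>
    (@sigma_algebra0 _ setT (@open G))
    (@sigma_algebraC (borel G) (@open G))
    (@sigma_algebra_bigcup _ setT (@open G)).

End BorelInstance.

(* For G compact Hausdorff: the normalised Haar measure, i.e. the translation
   invariant regular Borel probability measure. *)
Record haar_measure (R : realType) (G : topologicalZmodType)
    (m : probability (borel G) R) : Prop := HaarMeasure {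
  haar_invariant : forall (a : G) (A : set (borel G)), measurable A ->
    m ((fun x : G => a + x) @^-1` A) = m A ;
  haar_outer_regular : forall A : set (borel G), measurable A ->
    m A = ereal_inf [set m U | U in [set U : set G | open U /\ A `<=` U]] ;
  haar_inner_regular : forall U : set G, open U ->
    m U = ereal_sup [set m K | K in [set K : set G | compact K /\ K `<=` U]]
}.

Record character (R : realType) (G : topologicalZmodType) (h : G -> R[i]) :
    Prop := Character {
  char_continuous : continuous (h : G -> R[i]^o) ;
  char_norm1 : forall x, `|h x| = 1 ;
  charD : forall x y, h (x + y) = h x * h y
}.

(* Sequences are indexed from 0: lambda n stands for the (n+1)-st frequency. *)

Record frequency (R : realType) (lambda : nat -> R) : Prop := Frequency {
  frequency_ge0 : forall n, 0 <= lambda n ;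
  frequency_mono : forall n k, (n < k)%N -> lambda n < lambda k ;
  frequency_cvg : lambda n @[n --> \oo] --> +oo
}.

Definition Q_linearly_independent (R : realType) (lambda : nat -> R) : Prop :=
  forall (N : nat) (c : 'I_N -> rat),
    \sum_(n < N) ratr (c n) * lambda n = 0 -> forall n, c n = 0.

(* exp (- i t) = cos t - i sin t *)
Definition expNi (R : realType) (t : R) : R[i] := (cos t -i* sin t)%C.

Record dirichlet_group (R : realType) (lambda : nat -> R)
    (G : topologicalZmodType) (beta : R -> G) : Prop := DirichletGroup {
  dirichlet_compact : compact [set: G] ;
  dirichlet_hausdorff : hausdorff_space G ;
  dirichlet_continuous : continuous beta ;
  dirichletD : forall s t, beta (s + t) = beta s + beta t ;
  dirichlet_dense : dense (range beta) ;
  dirichlet_char_ex : forall n, exists h : G -> R[i],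
    character h /\ forall t, h (beta t) = expNi (lambda n * t)
}.

(* The character h_a with h_a (beta t) = exp (- i a t), when there is one; it is
   unique as soon as beta has dense range. *)
Definition dirichlet_char (R : realType) (G : topologicalZmodType)
    (beta : R -> G) (a : R) : G -> R[i] :=
  xget (fun=> 1) [set h : G -> R[i] |
    character h /\ forall t, h (beta t) = expNi (a * t)].

Section Hardy.
Context (R : realType) (G : topologicalZmodType) (m : probability (borel G) R).
Context (X : completeNormedModType R[i]).
Variables (lambda : nat -> R) (beta : R -> G).

Definition fourier_coef (f : G -> X) (gamma : G -> R[i]) : X :=
  bochner_integral m (fun x => (gamma x)^* *: f x).

Definition hardy_space (p : R) (f : G -> X) : Prop :=
  bochner_Lp m p f /\
  forall gamma : G -> R[i], character gamma ->
    (forall n, gamma <> dirichlet_char beta (lambda n)) ->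
    fourier_coef f gamma = 0.

Definition fourier_sum (f : G -> X) (N : nat) (x : G) : X :=
  \sum_(n < N) dirichlet_char beta (lambda n) x *:
    fourier_coef f (dirichlet_char beta (lambda n)).

End Hardy.

(* Main.v *)
(* Linear independence of the frequencies gives, by Kronecker's theorem, points
   a_n of G at which h_k = 1 for k < n and h_k = -1 for k >= n.  Hence
   f + f(. + a_n) = 2 S_n f, while S_j f (j <= n) is invariant under a_n: the
   partial sums behave like those of a symmetric random series, and Lévy's
   reflection argument gives m(sup_n |S_n f| > t) <= 2 m(|f| > t) for every t.
   Integrating in t yields the maximal inequality, with constant 2^(1/p), and
   the tail bound applied to f - S_n f yields a.e. convergence as soon as
   S_n f -> f in L_1 for some n.

   This, and the identity for f + f(. + a_n), rest on the L_1-density of the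
   polynomials in the h_k, i.e. on the Peter-Weyl theorem for G.  It is proved
   in the algebra of even real continuous functions under convolution: the power
   method produces the spectral projection for the top eigenvalue of a
   convolution operator; this is a convolution idempotent, a minimal idempotent
   below it is proportional to a solution c of d'Alembert's equation
   c(x + y) + c(x - y) = 2 c(x) c(y), and such a c is the real part of a
   character. *)
Require Import Defs.
From HB Require Import structures.
From mathcomp Require Import all_boot all_order all_algebra.
From mathcomp Require Import finmap complex.
From mathcomp Require Import all_classical all_reals all_analysis.
From mathcomp Require Import measurable_realfun.
From mathcomp Require Import ring lra.
Set Implicit Arguments.
Unset Strict Implicit.
Unset Printing Implicit Defensive.
Import Order.TTheory GRing.Theory Num.Theory.
Import numFieldNormedType.Exports.
Local Open Scope classical_set_scope.
Local Open Scope ring_scope.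

(** * Haar integral of continuous functions *)

(** Two obstacles shape the proof. G is not assumed metrizable, so product sigma-algebras are
    avoided: finite covers of G by translates of a neighbourhood of 0 give finite-valued
    approximations of the identity map of G, hence Riemann sums, Fubini for continuous kernels, and
    simple approximations of continuous vector-valued functions. Also m is not assumed complete, so
    f, an a.e. limit of simple functions, may fail to be measurable; it is exchanged for an
    everywhere limit g, and integrals involving f are compared with those of g as suprema over
    simple functions. The spectral theory stays elementary because convolution operators by even
    real functions commute and are symmetric: the value of [u ** v] at 0 is an L_2 inner product,
    and Cauchy-Schwarz turns estimates of values at 0 into uniform ones, so that limits remain
    continuous functions. Independence of the frequencies enters only through the points a_n.
    Approximate ones come from averaging against a Riesz product, exact ones from compactness of
    G. *)

Section ContinuousFunctions.
Context {R : realType} {G : topologicalZmodType}.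
Hypothesis cptG : compact [set: G].
Implicit Types u v : G -> R.

(** Tube lemma: by the near-covering form of compactness, statements valid locally in x for small t
    hold on one neighbourhood of 0 for all x. *)
Lemma near_uniform (P : G -> G -> Prop) :
  (forall x : G, \forall x' \near x & t \near (0 : G), P t x') ->
  \forall t \near (0 : G), forall x, P t x.
Proof.
move=> h; have H0 := (@compact_near_coveringP G setT).1 cptG G (nbhs (0 : G)) P
  (nbhs_filter _)  (fun x _ => h x).
by apply: (filterS _ H0) => t H x; apply: H.
Qed.

Lemma continuous_uniform u : continuous u ->
  forall e, 0 < e -> \forall t \near (0 : G), forall x, `|u (x + t) - u x| < e.
Proof.
move=> cu e e0; apply: near_uniform => x.
have c2 : (fun z : G * G => u (z.1 + z.2) - u z.1) @ (x, 0) --> u (x + 0) - u x.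
  apply: cvgB.
    apply: (@cvg_comp _ _ _ (fun z : G * G => z.1 + z.2) u _ (nbhs (x + 0))).
      exact: (@add_continuous G (x, 0)).
    exact: cu.
  apply: (@cvg_comp _ _ _ (fun z : G * G => z.1) u _ (nbhs x)); last exact: cu.
  exact: cvg_fst.
move/cvgrPdist_lt : c2 => /(_ e e0).
apply: filterS => -[x' t] /=.
by rewrite addr0 subrr sub0r normrN.
Qed.

Lemma continuous_translate (T : topologicalType) (u : G -> T) (a : G) :
  continuous u -> continuous (fun x => u (x + a)).
Proof.
move=> cu x; apply: (@cvg_comp _ _ _ (fun x => x + a) u _ (nbhs (x + a))).
  apply: (@cvg_comp _ _ _ (fun x => (x, a)) (fun z : G * G => z.1 + z.2)
    _ (nbhs (x, a))).
    by apply: cvg_pair; [exact: cvg_id|exact: cvg_cst].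
  exact: (@add_continuous G (x, a)).
exact: cu.
Qed.

Lemma continuous_reflect (T : topologicalType) (u : G -> T) a :
  continuous u -> continuous (fun x => u (a - x)).
Proof.
move=> cu x; apply: (@cvg_comp _ _ _ (fun x => a - x) u _ (nbhs (a - x))).
  apply: (@cvg_comp _ _ _ (fun x => (a, x)) (fun z : G * G => z.1 - z.2)
    _ (nbhs (a, x))).
    by apply: cvg_pair; [exact: cvg_cst|exact: cvg_id].
  exact: (@sub_continuous G (a, x)).
exact: cu.
Qed.

Lemma continuous_bounded u : continuous u -> exists2 M : R, 0 < M & forall x, `|u x| <= M.
Proof.
move=> cu.
have /compact_bounded[M [_ HM]] : compact (u @` setT).
  by apply: continuous_compact => //; apply: continuous_subspaceT.
exists (`|M| + 1); first by rewrite ltr_pwDr.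
move=> x; apply: (HM (`|M| + 1)) => //.
by rewrite (le_lt_trans (ler_norm _)) // ltrDl.
Qed.

Lemma uniform_continuous u :
  (forall e, 0 < e -> \forall t \near (0 : G), forall x, `|u (x + t) - u x| <= e) ->
  continuous u.
Proof.
move=> H x; apply/cvgrPdist_le => e /H He.
have : (fun y : G => y - x) @ x --> (0 : G).
  have := @continuous_translate _ id (- x) (fun x => cvg_id); move/(_ x).
  by rewrite /continuous_at subrr.
move=> /(_ _ He) K; apply: (@filterS _ (nbhs x) _ _ _ _ K) => y /(_ x).
by rewrite distrC /= addrCA subrr addr0.
Qed.

End ContinuousFunctions.

Section Haar.
Context {R : realType} {G : topologicalZmodType} {m : probability (borel G) R}.
Hypothesis cptG : compact [set: G].
Hypothesis haarm : haar_measure m.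
Implicit Types u v : G -> R.

Lemma open_borel (A : set G) : open A -> measurable (A : set (borel G)).
Proof. by move=> oA; apply: sub_sigma_algebra. Qed.

Lemma continuous_measurable u : continuous u -> measurable_fun setT (u : borel G -> R).
Proof.
move=> cu; apply: (measurability _ (measurable_realfun.RGenOpens.measurableE R)).
move=> _ [_ [a [b ->] <-]]; rewrite setTI.
apply: open_borel; move: cu => /continuousP; apply; exact: interval_open.
Qed.

Lemma bounded_integrable (u : borel G -> R) M : measurable_fun setT u ->
  (forall x, `|u x| <= M) -> m.-integrable setT (EFin \o u).
Proof.
move=> mu bu; apply: measurable_bounded_integrable => //.
  by rewrite (le_lt_trans (@probability_le1 _ _ _ m _ _)) // ltry.
by exists M; split; [exact: num_real|move=> x Mx y _; exact: le_trans (bu y) (ltW Mx)].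
Qed.

Lemma continuous_integrable u : continuous u -> m.-integrable setT (EFin \o (u : borel G -> R)).
Proof.
move=> cu; have [M _ HM] := continuous_bounded cptG cu.
by apply: (bounded_integrable (M := M)) => //; apply: continuous_measurable.
Qed.

Definition haar_int u : R := (\int[m]_x (u : borel G -> R) x).
Local Notation I := haar_int.

Local Notation tr a := ((fun x : G => a + x) : borel G -> borel G).

Lemma translate_measurable a : measurable_fun setT (tr a).
Proof.
apply: (@measurability _ _ (borel G) (borel G) setT _ (@open G)) => //.
move=> _ [A oA <-]; rewrite setTI; apply: open_borel.
have : continuous (fun x : G => a + x).
  move=> x; have := @continuous_translate G G id a (fun x => cvg_id) x.
  by rewrite /continuous_at addrC; under eq_fun do rewrite addrC.
by move/continuousP; apply.
Qed.

Lemma ge0_integral_translate (u : borel G -> \bar R) (a : G) :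
  measurable_fun [set: borel G] u ->
  (forall x, (0 <= u x)%E) -> (\int[m]_x u ((x : G) + a)%R = \int[m]_x u x)%E.
Proof.
move=> mu u0.
transitivity (\int[pushforward m (tr a)]_x u x)%E.
  rewrite ge0_integral_pushforward //=; last exact: translate_measurable.
  by apply: eq_integral => x _ /=; rewrite addrC.
apply: eq_measure_integral => [|mt A mA _]; first exact: translate_measurable.
exact: (haar_invariant haarm).
Qed.

Lemma haar_int_translate u a : continuous u -> I (fun x => u (x + a)) = I u.
Proof.
move=> cu; rewrite /I /Rintegral; congr fine.
transitivity (\int[pushforward m (tr a)]_x (u x)%:E)%E.
  rewrite integral_pushforward //=.
  - by apply: eq_integral => x _ /=; rewrite addrC.
  - exact: translate_measurable.
  - by apply/measurable_EFinP; exact: continuous_measurable.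
  - rewrite preimage_setT.
    have := continuous_integrable (@continuous_translate G R u a cu).
    apply: eq_integrable => //.
    by move=> x _ /=; rewrite addrC.
apply: eq_measure_integral => [|mt A mA _]; first exact: translate_measurable.
exact: (haar_invariant haarm).
Qed.

End Haar.

(** * Functions of finite range and their integrals *)

Section FiniteRange.
Context {d} {T : measurableType d} {R : realType} {P : probability T R}.

Lemma Rintegral_cst1 a : \int[P]_x a = a.
Proof. by rewrite Rintegral_cst //= probability_setT mulr1. Qed.

(** For values in X this unfolds to [simple_fun]. The codomain is arbitrary so that simple functions
    can be factored through points of G, booleans or pairs. *)
Definition finite_range (Y : Type) (r : T -> Y) : Prop :=
  finite_set (range r) /\ forall y, measurable (r @^-1` [set y]).

Lemma finite_range_measurable (Y : choiceType) (r : T -> Y) (B : set Y) :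
  finite_range r -> measurable (r @^-1` B).
Proof.
move=> [fr mr].
rewrite [X in measurable X](_ : _ = \bigcup_(y in range r `&` B) (r @^-1` [set y])).
  apply: fin_bigcup_measurable => //.
  by apply: sub_finite_set fr => y [].
rewrite eqEsubset; split=> [x Bx|x [y [_ By] /= ->]] //.
by exists (r x) => //; split => //; exists x.
Qed.

Lemma finite_range_comp (Y : choiceType) (Z : Type) (g : Y -> Z) (r : T -> Y) :
  finite_range r -> finite_range (g \o r).
Proof.
move=> fr; split.
  by rewrite -(image_comp r g); apply: finite_image; exact: fr.1.
move=> z; rewrite comp_preimage; exact: finite_range_measurable.
Qed.

Lemma finite_range_pair (Y Z : choiceType) (r : T -> Y) (s : T -> Z) :
  finite_range r -> finite_range s -> finite_range (fun x => (r x, s x)).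
Proof.
move=> [fr mr] [fs ms]; split.
  apply: (@sub_finite_set _ _ (range r `*` range s)); last exact: (finite_setX fr fs).
  by move=> _ [x _ <-]; split; exists x.
move=> [y z].
rewrite [X in measurable X](_ : _ = r @^-1` [set y] `&` s @^-1` [set z]).
  exact: measurableI.
by rewrite eqEsubset; split => x /=; [case=> -> ->|case=> -> ->].
Qed.

Lemma finite_range_cst (Y : Type) (y : Y) : finite_range (fun _ : T => y).
Proof.
split.
  apply: (@sub_finite_set _ _ [set y]); last exact: (finite_set1 y).
  by move=> _ [x _ <-].
by move=> z; rewrite preimage_cst; case: ifP.
Qed.

Lemma finite_range_indic (A : set T) : measurable A ->
  finite_range (fun x => x \in A).
Proof.
move=> mA; split; first exact: finite_finset.
case.
  rewrite [X in measurable X](_ : _ = A) //.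
  by rewrite eqEsubset; split=> x /=; [exact: set_mem|exact: mem_set].
rewrite [X in measurable X](_ : _ = ~` A); first exact: measurableC.
rewrite eqEsubset; split=> x /=; first by move/negbT; rewrite notin_setE.
by move=> Ax; apply/negbTE; rewrite notin_setE.
Qed.

Lemma finite_range_measurable_fun d' (Z : measurableType d') (Y : choiceType)
  (g : Y -> Z) (r : T -> Y) : finite_range r -> measurable_fun setT (g \o r).
Proof.
by move=> fr _ B mB; rewrite setTI comp_preimage; exact: finite_range_measurable.
Qed.

Lemma Rintegral_sum_indic (Y : Type) (l : seq Y) (c : Y -> R) (A : Y -> set T) :
  (forall y, measurable (A y)) ->
  P.-integrable setT (EFin \o (fun x => \sum_(y <- l) c y * \1_(A y) x)) /\
  \int[P]_x (\sum_(y <- l) c y * \1_(A y) x) = \sum_(y <- l) c y * fine (P (A y)).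
Proof.
move=> mA; elim: l => [|y l [IH1 IH2]].
  split.
    rewrite (_ : _ \o _ = cst 0%E); first exact: integrable0.
    by apply/funext => x /=; rewrite big_nil.
  rewrite big_nil; under eq_Rintegral do rewrite big_nil.
  by rewrite Rintegral_cst // mul0r.
have i1 : P.-integrable setT (EFin \o (fun x => c y * \1_(A y) x)).
  have -> : EFin \o (fun x => c y * \1_(A y) x) =
      (fun x => (c y)%:E * (EFin \o \1_(A y)) x)%E.
    by apply/funext => x /=.
  by apply: integrableZl => //; exact: integrable_indic.
split.
  have := integrableD measurableT i1 IH1.
  by apply: eq_integrable => // x _ /=; rewrite big_cons EFinD.
rewrite big_cons -IH2.
under eq_Rintegral do rewrite big_cons.
rewrite RintegralD //; congr +%R.
rewrite RintegralZl //; last exact: integrable_indic.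
by rewrite /Rintegral integral_indic // setIT.
Qed.

Lemma finite_range_Rintegral (Y : choiceType) (g : Y -> R) (r : T -> Y) :
  finite_range r ->
  P.-integrable setT (EFin \o (g \o r)) /\
  \int[P]_x g (r x) =
    \sum_(y <- fset_set (range r)) g y * fine (P (r @^-1` [set y])).
Proof.
move=> [fr mr].
have [H1 H2] := Rintegral_sum_indic (fset_set (range r)) g mr.
have E x : \sum_(y <- fset_set (range r)) g y * \1_(r @^-1` [set y]) x = g (r x).
  rewrite (bigD1_seq (r x)) /=; last 2 first.
  - by rewrite in_fset_set // mem_set //; exists x.
  - exact: fset_uniq.
  rewrite indicE mem_set // mulr1 big1 ?addr0 // => y /eqP yx.
  by rewrite indicE memNset ?mulr0 // => /= H; apply: yx.
split; last by rewrite -H2; apply: eq_Rintegral => x _; rewrite E.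
rewrite (_ : _ \o _ = EFin \o (fun x => \sum_(y <- fset_set (range r)) g y * \1_(r @^-1` [set y]) x)) //.
by apply/funext => x /=; rewrite E.
Qed.

Context {X : completeNormedModType R[i]}.

(** The sum may be indexed by the values of r even when g identifies some of them. Two simple
    functions can thus be summed over the common refinement given by their pair, which yields
    additivity. *)
Lemma simple_integral_comp (Y : choiceType) (g : Y -> X) (r : T -> Y) :
  finite_range r ->
  simple_integral P (g \o r) =
    \sum_(y <- fset_set (range r)) (fine (P (r @^-1` [set y])))%:C%C *: g y.
Proof.
move=> fr; have [fr1 mr] := fr.
have frg : finite_set (range (g \o r)) by case: (finite_range_comp g fr).
rewrite /simple_integral fsbig_finite //=.
transitivity (\sum_(v <- fset_set (range (g \o r)))
   \sum_(y <- fset_set (range r))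
     (if g y == v then (fine (P (r @^-1` [set y])))%:C%C *: g y else 0)).
  apply: eq_bigr => v _.
  have [_ H] := finite_range_Rintegral (fun y => (g y == v)%:R) fr.
  have -> : fine (P ((g \o r) @^-1` [set v])) =
      \sum_(y <- fset_set (range r)) (g y == v)%:R * fine (P (r @^-1` [set y])).
    rewrite -H /Rintegral; congr fine.
    have mv : measurable ((g \o r) @^-1` [set v]) by exact: (finite_range_comp g fr).2.
    transitivity (\int[P]_x (\1_((g \o r) @^-1` [set v]) x)%:E)%E.
      by rewrite integral_indic // setIT.
    apply: eq_integral => x _; rewrite indicE; congr ((nat_of_bool _)%:R%:E).
    by apply/idP/eqP => [/set_mem|E]; rewrite ?mem_setE //; apply: mem_set.
  rewrite rmorph_sum /= scaler_suml; apply: eq_bigr => y _.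
  by case: eqP => [->|_]; rewrite ?mul1r // mul0r scale0r.
rewrite exchange_big /=; apply: eq_big_seq => y.
rewrite in_fset_set // inE => -[x _ <-].
rewrite (bigD1_seq (g (r x))) /=; last 2 first.
- by rewrite in_fset_set // mem_set //; exists x.
- exact: fset_uniq.
rewrite eqxx big1 ?addr0 // => v; rewrite eq_sym => /negPf -> //.
Qed.

End FiniteRange.

(** * Riemann sums, Fubini and inversion invariance for the Haar integral *)

Section HaarFunctional.
Context {R : realType} {G : topologicalZmodType} {m : probability (borel G) R}.
Hypothesis cptG : compact [set: G].
Hypothesis haarm : haar_measure m.
Implicit Types u v : G -> R.
Local Notation I := (haar_int (m := m)).
Local Notation cintegrable := (continuous_integrable (m := m) cptG).

Lemma haar_int_le u v : continuous u -> continuous v -> (forall x, u x <= v x) -> I u <= I v.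
Proof. by move=> cu cv uv; apply: le_Rintegral => //; exact: cintegrable. Qed.

Lemma haar_intD u v : continuous u -> continuous v -> I (fun x => u x + v x) = I u + I v.
Proof. by move=> cu cv; apply: RintegralD => //; exact: cintegrable. Qed.

Lemma haar_intZ a u : continuous u -> I (fun x => a * u x) = a * I u.
Proof. by move=> cu; apply: RintegralZl => //; exact: cintegrable. Qed.

Lemma haar_int_cst a : I (fun=> a) = a.
Proof. exact: Rintegral_cst1. Qed.

Lemma haar_int_ge0 u : (forall x, 0 <= u x) -> 0 <= I u.
Proof. by move=> u0; apply: Rintegral_ge0. Qed.

Lemma haar_int_bound u e : continuous u -> (forall x, `|u x| <= e) -> `|I u| <= e.
Proof.
move=> cu ue; rewrite ler_norml; apply/andP; split.
  rewrite -[leLHS]haar_int_cst; apply: haar_int_le => //; first exact: cst_continuous.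
  by move=> x; have := ue x; rewrite ler_norml => /andP[].
rewrite -[leRHS]haar_int_cst; apply: haar_int_le => //; first exact: cst_continuous.
by move=> x; have := ue x; rewrite ler_norml => /andP[].
Qed.

(** Turns a finite cover by translates of V into a Borel partition: each x goes to the first listed
    centre close to it. The default 0 is never reached once the list covers G. *)
Fixpoint select (V : set G) (s : seq G) (x : G) : G :=
  if s is a :: s' then (if `[< V (a - x) >] then a else select V s' x) else 0.

Lemma measurable_prop (Q : Prop) : measurable ([set x | Q] : set (borel G)).
Proof.
have [q|nq] := pselect Q.
  by rewrite [X in measurable X](_ : _ = setT) //; apply/seteqP; split.
by rewrite [X in measurable X](_ : _ = set0) //; apply/seteqP; split.
Qed.

Lemma select_finite_range (V : set G) s : open V ->
  finite_range (select V s : borel G -> G).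
Proof.
move=> oV; split.
  apply: (@sub_finite_set _ _ [set` 0 :: s]); last exact: finite_seq.
  move=> _ [x _ <-] /=; elim: s => [|a s IH] /=; first by rewrite inE.
  case: asboolP => _; first by rewrite !inE eqxx orbT.
  by move: IH; rewrite !inE => /orP[->//|->]; rewrite !orbT.
move=> b; elim: s => [|a s IH].
  exact: measurable_prop (0 = b :> G).
have mV : measurable ([set x | V (a - x)] : set (borel G)).
  apply: open_borel; have : continuous (fun x : G => a - x).
    exact: (@continuous_reflect G G id a (fun x => cvg_id)).
  by move/continuousP; apply.
rewrite [X in measurable X](_ : _ =
   ([set x : borel G | V (a - (x : G))] `&` [set x | a = b]) `|`
   (~` [set x : borel G | V (a - (x : G))] `&` (select V s @^-1` [set b]))); last first.
  apply/seteqP; split=> x /=; first by case: asboolP => /= h1 h2; [left|right].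
  by case: asboolP => h [[]|[]].
apply: measurableU; apply: measurableI => //; last exact: measurableC.
exact: measurable_prop.
Qed.

Lemma finite_cover (V : set G) : open V -> V 0 ->
  exists s : seq G, forall x, exists2 a, a \in s & V (a - x).
Proof.
move=> oV V0.
(* The filter of lists containing any prescribed finite list; near-covering compactness along it
   yields one list that serves every x. *)
pose F : set_system (seq G) := filter_from setT (fun s0 : seq G => [set s : seq G | {subset s0 <= s}]).
have FF : Filter F.
  apply: filter_from_filter; first by exists [::].
  move=> s t _ _; exists (s ++ t) => // r /= H.
  by split=> x xs; apply: H; rewrite mem_cat xs ?orbT.
have := (@compact_near_coveringP G setT).1 cptG _ F
  (fun s x => exists2 a, a \in s & V (a - x)) FF.
case.
  move=> x _; exists ([set x' : G | V (x - x')], [set s : seq G | x \in s]) => /=.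
    split; last by exists [:: x] => // s /= /(_ x); rewrite inE eqxx; exact.
    have : continuous (fun x' : G => x - x').
      exact: (@continuous_reflect G G id x (fun x => cvg_id)).
    by move=> /(_ x); apply; rewrite subrr; apply: open_nbhs_nbhs.
  by move=> [x' s] /= [Vx xs]; exists x.
by move=> s _ /(_ s) H; exists s => x; apply: H.
Qed.

Lemma finite_range_approx (U : set G) : nbhs (0 : G) U ->
  exists2 r : borel G -> G, finite_range r & forall x, U (r x - x).
Proof.
rewrite nbhsE => -[V [oV V0] VU].
have [s Hs] := finite_cover oV V0.
exists (select V s); first exact: select_finite_range.
move=> x; apply: VU; have [a] := Hs x.
elim: s {Hs} => //= b s IH; case: asboolP => // nV.
by rewrite inE => /orP[/eqP ->//|/IH].
Qed.

(** Nodes and weights depend on U only, not on u. This uniformity lets one sum replace all the inner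
    integrals at once in [haar_Fubini]. *)
Lemma Riemann_sum (U : set G) : nbhs (0 : G) U ->
  exists (l : seq G) (w : G -> R), [/\ forall a, 0 <= w a, \sum_(a <- l) w a = 1 &
   forall u e, continuous u -> (forall t x, U t -> `|u (x + t) - u x| <= e) ->
     `|I u - \sum_(a <- l) u a * w a| <= e].
Proof.
move=> /finite_range_approx[r fr Ur].
exists (fset_set (range r)), (fun a => fine (m (r @^-1` [set a]))); split.
- by move=> a; apply: fine_ge0.
- have [_] := finite_range_Rintegral (P := m) (fun=> 1) fr.
  rewrite Rintegral_cst1 => ->.
  by under [RHS]eq_bigr do rewrite mul1r.
move=> u e cu H.
have [i1 <-] := finite_range_Rintegral (P := m) u fr.
rewrite /haar_int -RintegralB //; last exact: cintegrable.
have i2 : m.-integrable setT (EFin \o (fun x : borel G => u x - u (r x))).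
  have := integrableB measurableT (cintegrable cu) i1.
  by apply: eq_integrable.
rewrite (le_trans (le_normr_Rintegral _ _)) //.
rewrite (@le_trans _ _ (\int[m]_x (cst e x))) //; last first.
  by rewrite Rintegral_cst1.
apply: le_Rintegral => //.
- by have := integrable_norm i2; apply: eq_integrable.
- exact: (bounded_integrable (M := `|e|)).
by move=> x _ /=; rewrite distrC; have := H _ x (Ur x); rewrite addrCA subrr addr0.
Qed.

(** Abstracts one of the two integrals in Fubini, so that it can be the Haar integral or integration
    against an integrable, possibly discontinuous weight ([weighted_functional]). *)
Definition bounded_functional (J : (G -> R) -> R) :=
  (forall u v a, continuous u -> continuous v ->
     J (fun x => u x + a * v x) = J u + a * J v) /\
  exists2 B : R, 0 <= B & forall u e, continuous u -> (forall x, `|u x| <= e) -> `|J u| <= B * e.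

Lemma haar_int_functional : bounded_functional I.
Proof.
split.
  move=> u v a cu cv; rewrite haar_intD ?haar_intZ //.
  by move=> x; apply: cvgM; [exact: cvg_cst|exact: cv].
by exists 1 => // u e cu ue; rewrite mul1r; exact: haar_int_bound.
Qed.

Lemma functional_sub J u v : bounded_functional J -> continuous u -> continuous v ->
  J u - J v = J (fun x => u x - v x).
Proof.
move=> [JL _] cu cv; rewrite -mulN1r -JL //; congr J.
by apply/funext => x; rewrite mulN1r.
Qed.

Lemma functional_sum J (T : Type) (l : seq T) (w : T -> R) (F : T -> G -> R) :
  bounded_functional J -> (forall a, continuous (F a)) ->
  continuous (fun y => \sum_(a <- l) F a y * w a) /\
  J (fun y => \sum_(a <- l) F a y * w a) = \sum_(a <- l) J (F a) * w a.
Proof.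
move=> [JL _] cF; elim: l => [|a l [IH1 IH2]].
  split.
    under eq_fun do rewrite big_nil; exact: cst_continuous.
  rewrite big_nil; have c0 : continuous (fun _ : G => 0 : R) by exact: cst_continuous.
  transitivity (J (fun _ : G => 0 + -1 * 0)).
    by congr J; apply/funext => y; rewrite big_nil mulr0 addr0.
  by rewrite (JL _ _ _ c0 c0) mulN1r subrr.
split.
  under eq_fun do rewrite big_cons.
  by move=> y; apply: cvgD; [apply: cvgM; [exact: cF|exact: cvg_cst]|exact: IH1].
rewrite big_cons -IH2 mulrC addrC -JL //; congr J.
by apply/funext => y; rewrite big_cons addrC mulrC.
Qed.

(** Uniform equicontinuity in the first variable: the neighbourhood of 0 serves all x and all y. *)
Definition translation_modulus (F : G -> G -> R) :=
  forall e, 0 < e -> \forall t \near (0 : G), forall x y, `|F (x + t) y - F x y| <= e.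

Lemma haar_int_param_continuous J F : bounded_functional J -> translation_modulus F ->
  (forall x, continuous (F x)) -> continuous (fun x => J (F x)).
Proof.
move=> bJ mF cF; apply: uniform_continuous => e e0.
have [JL [B B0 HB]] := bJ.
have : 0 < e / (B + 1) by rewrite divr_gt0 // ltr_wpDl.
move/mF; apply: filterS => t Ht x.
rewrite functional_sub //.
rewrite (le_trans (HB _ (e / (B + 1)) _ _)) //.
  by move=> y; apply: cvgB; exact: cF.
by rewrite mulrA ler_pdivrMr ?ltr_wpDl // mulrC ler_pM2l // lerDl.
Qed.

(* Fubini without product measures, whose sigma-algebra is too small when G is
   not metrizable: the inner integral is replaced by Riemann sums. *)
Lemma haar_Fubini J F : bounded_functional J ->
  translation_modulus F -> translation_modulus (fun y x => F x y) ->
  J (fun y => I (fun x => F x y)) = I (fun x => J (F x)).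
Proof.
move=> bJ mF mF'.
have cF x : continuous (F x).
  by apply: uniform_continuous => e /mF'; apply: filterS => t H y; exact: H.
have cF' y : continuous (F^~ y).
  by apply: uniform_continuous => e /mF; apply: filterS => t H x; exact: H.
have cI : continuous (fun y => I (fun x => F x y)).
  exact: (haar_int_param_continuous haar_int_functional (F := fun y x => F x y)).
have cJ := haar_int_param_continuous bJ mF cF.
have [JL [B B0 HB]] := bJ.
apply/eqP; rewrite -subr_eq0 -normr_le0; apply/ler_addgt0Pl => e e0; rewrite addr0.
(* Each side differs from the same Riemann sum by at most B times this number; B + 1 keeps the
   denominator positive when B = 0. *)
have d0 : 0 < e / (2 * (B + 1)) by rewrite divr_gt0 // mulr_gt0 // ltr_wpDl.
have [l [w [w0 w1 H]]] := Riemann_sum (mF _ d0).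
have [c2 E2] := functional_sum l w bJ cF.
have e1 : `|J (fun y => I (fun x => F x y)) - \sum_(a <- l) J (F a) * w a| <= B * (e / (2 * (B + 1))).
  rewrite -E2 functional_sub //; apply: HB.
    by move=> y; apply: cvgB; [exact: cI|exact: c2].
  by move=> y; apply: H => // t x /=; exact.
have e2 : `|I (fun x => J (F x)) - \sum_(a <- l) J (F a) * w a| <= B * (e / (2 * (B + 1))).
  apply: H => // t x Ht; rewrite functional_sub //; apply: HB => [y|y]; last exact: Ht.
  by apply: cvgB; exact: cF.
rewrite (le_trans (ler_distD (\sum_(a <- l) J (F a) * w a) _ _)) //.
rewrite [X in _ + X]distrC (le_trans (lerD e1 e2)) //.
have B1 : 0 < B + 1 by rewrite ltr_wpDl.
have -> : B * (e / (2 * (B + 1))) + B * (e / (2 * (B + 1))) = B / (B + 1) * e.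
  by field; rewrite gt_eqF.
by rewrite ler_piMl ?ltW // ltr_pdivrMr // mul1r ltrDl.
Qed.

Lemma modulus_mul F F' M M' : translation_modulus F -> translation_modulus F' ->
  (forall x y, `|F x y| <= M) -> (forall x y, `|F' x y| <= M') ->
  translation_modulus (fun x y => F x y * F' x y).
Proof.
move=> mF mF' bF bF' e e0.
have p0 : 0 < `|M| + `|M'| + 1 by rewrite ltr_wpDl // addr_ge0.
have d0 : 0 < e / (`|M| + `|M'| + 1) by rewrite divr_gt0.
move: (mF _ d0) (mF' _ d0); apply: filterS2 => t H H' x y.
rewrite (_ : _ - _ = F (x + t) y * (F' (x + t) y - F' x y) + (F (x + t) y - F x y) * F' x y); last by ring.
rewrite (le_trans (ler_normD _ _)) // !normrM.
have h1 : `|F (x + t) y| * `|F' (x + t) y - F' x y| <= `|M| * (e / (`|M| + `|M'| + 1)).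
  by apply: ler_pM => //; rewrite (le_trans (bF _ _)) // ler_norm.
have h2 : `|F (x + t) y - F x y| * `|F' x y| <= (e / (`|M| + `|M'| + 1)) * `|M'|.
  by apply: ler_pM => //; rewrite (le_trans (bF' _ _)) // ler_norm.
rewrite (le_trans (lerD h1 h2)) // mulrC -mulrDr mulrAC ler_pdivrMr // ler_pM2l //.
by rewrite lerDl.
Qed.

Lemma modulus_addr u (z : G -> G) : continuous u -> translation_modulus (fun x y => u (x + z y)).
Proof.
move=> cu e e0; apply: filterS (continuous_uniform cptG cu e0) => t H x y.
by rewrite addrAC ltW.
Qed.

Lemma modulus_subr u (z : G -> G) : continuous u -> translation_modulus (fun x y => u (z y - x)).
Proof.
move=> cu e e0; apply: filterS (continuous_uniform cptG cu e0) => t H x y.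
by have := H (z y - (x + t)); rewrite opprD addrA subrK distrC => /ltW.
Qed.

Lemma modulus_cst u : translation_modulus (fun x y => u y).
Proof. by move=> e e0; apply: nearW => t x y; rewrite subrr normr0 ltW. Qed.

(** Integrate u (x - y) twice: translation invariance in x leaves the integral of u, translation
    invariance in y leaves that of the reflected function, and Fubini equates the two. *)
Lemma haar_int_opp u : continuous u -> I (fun x => u (- x)) = I u.
Proof.
move=> cu.
have := haar_Fubini haar_int_functional (F := fun x y => u (x - y)).
move=> /(_ (modulus_addr (fun y => - y) cu) (modulus_subr id cu)).
have -> : (fun y => I (fun x => u (x - y))) = fun=> I u.
  by apply/funext => y; exact: haar_int_translate.
rewrite haar_int_cst => ->.
have -> : (fun x => I (fun y => u (x - y))) = fun=> I (fun y => u (- y)).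
  apply/funext => x; rewrite -(haar_int_translate cptG haarm (u := fun y => u (- y)) (- x)).
    by congr I; apply/funext => y; rewrite opprD opprK addrC.
  move=> y; apply: (continuous_comp (f := -%R)) => //; first exact: opp_continuous.
  exact: cu.
by rewrite haar_int_cst.
Qed.

Lemma haar_int_reflect u a : continuous u -> I (fun x => u (a - x)) = I u.
Proof.
move=> cu; rewrite -[RHS](haar_int_translate cptG haarm a) // -[RHS]haar_int_opp.
  by congr I; apply/funext => x; rewrite addrC.
exact: continuous_translate.
Qed.

Lemma haar_Cauchy_Schwarz u v : continuous u -> continuous v ->
  (I (fun x => u x * v x)) ^+ 2 <= I (fun x => u x ^+ 2) * I (fun x => v x ^+ 2).
Proof.
move=> cu cv.
have cuv (f g : G -> R) : continuous f -> continuous g -> continuous (fun x => f x * g x).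
  by move=> cf cg x; apply: cvgM; [exact: cf|exact: cg].
set A := I (fun x => u x ^+ 2); set B := I (fun x => u x * v x); set C := I (fun x => v x ^+ 2).
have A0 : 0 <= A by apply: haar_int_ge0 => x; exact: sqr_ge0.
have C0 : 0 <= C by apply: haar_int_ge0 => x; exact: sqr_ge0.
have H s t : 0 <= s ^+ 2 * A + 2 * s * t * B + t ^+ 2 * C.
  have : 0 <= I (fun x => (s * u x + t * v x) ^+ 2).
    by apply: haar_int_ge0 => x; exact: sqr_ge0.
  suff -> : I (fun x => (s * u x + t * v x) ^+ 2) = s ^+ 2 * A + 2 * s * t * B + t ^+ 2 * C by [].
  have cu2 : continuous (fun x => u x ^+ 2) by under eq_fun do rewrite expr2; exact: cuv.
  have cv2 : continuous (fun x => v x ^+ 2) by under eq_fun do rewrite expr2; exact: cuv.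
  rewrite /A /B /C -!haar_intZ //; last exact: cuv.
  have cZ a (f : G -> R) : continuous f -> continuous (fun x => a * f x).
    by move=> cf; apply: cuv => //; exact: cst_continuous.
  rewrite -!haar_intD //; first by congr I; apply/funext => x; ring.
  - by move=> x; apply: cvgD; apply: cZ => //; exact: cuv.
  - exact: cZ.
  - exact: cZ.
  - by apply: cZ; exact: cuv.
have [A00|A00] := eqVneq A 0.
  rewrite A00 mul0r.
  have [->|B00] := eqVneq B 0; first by rewrite expr0n.
  (* With A = 0 the form is affine in s, and this s gives it the value -1. *)
  have := H (- (C + 1) / (2 * B)) 1; rewrite A00.
  have -> : (- (C + 1) / (2 * B)) ^+ 2 * 0 + 2 * (- (C + 1) / (2 * B)) * 1 * B + 1 ^+ 2 * C = -1 by field.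
  by rewrite oppr_ge0 ler10.
have Ap : 0 < A by rewrite lt_def A00.
have := H (- B) A.
have -> : (- B) ^+ 2 * A + 2 * - B * A * B + A ^+ 2 * C = A * (A * C - B ^+ 2) by ring.
by rewrite pmulr_rge0 // subr_ge0.
Qed.

End HaarFunctional.

(** * Peter-Weyl approximation by even functions *)

Section EvenFunctions.
Context {R : realType} {G : topologicalZmodType}.

(* For even u, convolution by u is a self-adjoint operator and u ** u takes at 0
   the value [int u^2], so that values at 0 play the role of traces. *)
Record evfun := EvFun {
  evf :> G -> R ;
  evf_cont : continuous evf ;
  evf_even : forall x, evf (- x) = evf x }.

Lemma evfunP (u v : evfun) : (forall x, u x = v x) -> u = v.
Proof.
case: u v => [u cu eu] [v cv ev] /= /funext uv; subst v.
by congr EvFun; exact: Prop_irrelevance.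
Qed.

HB.instance Definition _ := gen_eqMixin evfun.
HB.instance Definition _ := gen_choiceMixin evfun.

Definition evadd_def (u v : evfun) : evfun.
Proof.
apply: (@EvFun (fun x => u x + v x)).
  by move=> x; apply: cvgD; exact: evf_cont.
by move=> x; rewrite !evf_even.
Defined.

Definition evscale_def (a : R) (u : evfun) : evfun.
Proof.
apply: (@EvFun (fun x => a * u x)).
  by move=> x; apply: cvgM; [exact: cvg_cst|exact: evf_cont].
by move=> x; rewrite !evf_even.
Defined.

Definition evcst (a : R) : evfun.
Proof. by apply: (@EvFun (fun=> a)) => //; exact: cst_continuous. Defined.

Lemma evaddA : associative evadd_def.
Proof. by move=> u v w; apply: evfunP => x /=; rewrite addrA. Qed.
Lemma evaddC : commutative evadd_def.
Proof. by move=> u v; apply: evfunP => x /=; rewrite addrC. Qed.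
Lemma evadd0 : left_id (evcst 0) evadd_def.
Proof. by move=> u; apply: evfunP => x /=; rewrite add0r. Qed.
Lemma evaddN : left_inverse (evcst 0) (evscale_def (-1)) evadd_def.
Proof. by move=> u; apply: evfunP => x /=; rewrite mulN1r addNr. Qed.

HB.instance Definition _ := GRing.isZmodule.Build evfun evaddA evaddC evadd0 evaddN.

Lemma evscaleA a b (u : evfun) : evscale_def a (evscale_def b u) = evscale_def (a * b) u.
Proof. by apply: evfunP => x /=; rewrite mulrA. Qed.
Lemma evscale1 : left_id 1 evscale_def.
Proof. by move=> u; apply: evfunP => x /=; rewrite mul1r. Qed.
Lemma evscaleDr : right_distributive evscale_def +%R.
Proof. by move=> a u v; apply: evfunP => x /=; rewrite mulrDr. Qed.
Lemma evscaleDl (u : evfun) : {morph evscale_def^~ u : a b / a + b}.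
Proof. by move=> a b; apply: evfunP => x /=; rewrite mulrDl. Qed.

HB.instance Definition _ := GRing.Zmodule_isLmodule.Build R evfun
  evscaleA evscale1 evscaleDr evscaleDl.

Lemma evD (u v : evfun) x : (u + v) x = u x + v x. Proof. by []. Qed.
Lemma evZ a (u : evfun) x : (a *: u) x = a * u x. Proof. by []. Qed.
Lemma evN (u : evfun) x : (- u) x = - u x. Proof. exact: mulN1r. Qed.
Lemma evB (u v : evfun) x : (u - v) x = u x - v x. Proof. by rewrite evD evN. Qed.
Lemma ev0 x : (0 : evfun) x = 0. Proof. by []. Qed.

End EvenFunctions.
Arguments evfun : clear implicits.
Arguments evf_cont {R G} _.

(** * The convolution algebra of even functions *)

Section Convolution.
Context {R : realType} {G : topologicalZmodType} {m : probability (borel G) R}.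
Hypothesis cptG : compact [set: G].
Hypothesis haarm : haar_measure m.
Local Notation I := (haar_int (m := m)).
Local Notation ev := (evfun R G).
Implicit Types u v w e : ev.

Lemma continuousM (f g : G -> R) : continuous f -> continuous g ->
  continuous (fun x => f x * g x).
Proof. by move=> cf cg x; apply: cvgM; [exact: cf|exact: cg]. Qed.

Lemma evconv_cont u v (x : G) : continuous (fun y => u y * v (x - y)).
Proof. by apply: continuousM; [exact: evf_cont|apply: continuous_reflect; exact: evf_cont]. Qed.
Hint Resolve evconv_cont : core.

Let conv u v (x : G) := I (fun y => u y * v (x - y)).

Let conv_cont u v : continuous (conv u v).
Proof.
have [Mu _ bu] := continuous_bounded cptG (evf_cont u).
have [Mv _ bv] := continuous_bounded cptG (evf_cont v).
have := @haar_int_param_continuous R G (haar_int (m := m)) (fun x y => u y * v (x - y))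
  (haar_int_functional cptG).
apply => //.
apply: (modulus_mul (M := Mu) (M' := Mv)) => //; first exact: modulus_cst.
exact: (modulus_addr cptG (fun y => - y) (evf_cont v)).
Qed.

Let conv_even u v x : conv u v (- x) = conv u v x.
Proof.
rewrite /conv -(haar_int_opp cptG haarm) //.
by congr (haar_int _); apply/funext => y; rewrite evf_even -opprD evf_even.
Qed.

Definition evconv u v : ev := EvFun (@conv_cont u v) (@conv_even u v).

Local Notation "u ** v" := (evconv u v) (at level 40, left associativity).

Lemma evconvE u v x : (u ** v) x = I (fun y => u y * v (x - y)). Proof. by []. Qed.

Lemma evconvC u v : u ** v = v ** u.
Proof.
apply: evfunP => x; rewrite !evconvE -(haar_int_reflect cptG haarm x) //.
by congr (haar_int _); apply/funext => y; rewrite opprB addrCA subrr addr0 mulrC.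
Qed.

Lemma evconvDl u v w : (u + v) ** w = u ** w + v ** w.
Proof.
apply: evfunP => x; rewrite evD !evconvE -haar_intD //.
by congr (haar_int _); apply/funext => y; rewrite evD mulrDl.
Qed.

Lemma evconvZl a u w : (a *: u) ** w = a *: (u ** w).
Proof.
apply: evfunP => x; rewrite evZ !evconvE -haar_intZ //.
by congr (haar_int _); apply/funext => y; rewrite evZ mulrA.
Qed.

Lemma evconvNl u w : (- u) ** w = - (u ** w).
Proof. by rewrite -scaleN1r evconvZl scaleN1r. Qed.

Lemma evconvBl u v w : (u - v) ** w = u ** w - v ** w.
Proof. by rewrite evconvDl evconvNl. Qed.

Lemma evconv0l w : 0 ** w = 0.
Proof. by have := evconvZl 0 0 w; rewrite !scale0r. Qed.

Lemma evconvDr u v w : w ** (u + v) = w ** u + w ** v.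
Proof. by rewrite evconvC evconvDl !(evconvC _ w). Qed.
Lemma evconvZr a u w : w ** (a *: u) = a *: (w ** u).
Proof. by rewrite evconvC evconvZl (evconvC _ w). Qed.
Lemma evconvBr u v w : w ** (u - v) = w ** u - w ** v.
Proof. by rewrite evconvC evconvBl !(evconvC _ w). Qed.
Lemma evconvA u v w : u ** (v ** w) = u ** v ** w.
Proof.
apply: evfunP => x; rewrite !evconvE.
have [Mu _ bu] := continuous_bounded cptG (evf_cont u).
have [Mv _ bv] := continuous_bounded cptG (evf_cont v).
have [Mw _ bw] := continuous_bounded cptG (evf_cont w).
have buv y z : `|u z * v (y - z)| <= Mu * Mv by rewrite normrM; apply: ler_pM.
have H := haar_Fubini cptG (haar_int_functional cptG (m := m))
  (F := fun y z => (u z * v (y - z)) * w (x - y)).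
transitivity (I (fun z => I (fun y => u z * v (y - z) * w (x - y)))).
  congr (haar_int _); apply/funext => z.
  rewrite evconvE -haar_intZ // -(haar_int_translate cptG haarm (- z)); last first.
    by apply: continuousM; [exact: cst_continuous|exact: evconv_cont].
  by congr (haar_int _); apply/funext => y /=; rewrite opprB addrA subrK mulrA.
rewrite H; last 2 first.
- apply: (modulus_mul (M := Mu * Mv) (M' := Mw)) => //; last exact: (modulus_subr cptG (fun=> x) (evf_cont w)).
  apply: (modulus_mul (M := Mu) (M' := Mv)) => //; first exact: modulus_cst.
  exact: (modulus_addr cptG (fun y => - y) (evf_cont v)).
- apply: (modulus_mul (M := Mu * Mv) (M' := Mw)) => //; last exact: (modulus_cst (fun y => w (x - y))).
  apply: (modulus_mul (M := Mu) (M' := Mv)) => //; last exact: (modulus_subr cptG id (evf_cont v)).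
  have := modulus_addr cptG (fun=> 0) (evf_cont u).
  by under eq_fun do under eq_fun do rewrite addr0.
congr (haar_int _); apply/funext => y; rewrite evconvE mulrC -haar_intZ //.
by congr (haar_int _); apply/funext => z; rewrite mulrC.
Qed.

Lemma evconv_at0 u v : (u ** v) 0 = I (fun y => u y * v y).
Proof. by rewrite evconvE; congr (haar_int _); apply/funext => y; rewrite sub0r evf_even. Qed.

Lemma evsqr_at0 u : (u ** u) 0 = I (fun y => u y ^+ 2).
Proof. by rewrite evconv_at0; congr (haar_int _); apply/funext => y; rewrite expr2. Qed.

Lemma evsqr_ge0 u : 0 <= (u ** u) 0.
Proof. by rewrite evsqr_at0; apply: haar_int_ge0 => x; exact: sqr_ge0. Qed.

(** Cauchy-Schwarz at each point x, the reflected translate of v having the same L_2 norm as v. The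
    right-hand side is independent of x, so L_2 control of the factors gives uniform control of the
    product. *)
Lemma evconv_CS u v x : (u ** v) x ^+ 2 <= (u ** u) 0 * (v ** v) 0.
Proof.
have H := haar_Cauchy_Schwarz cptG (evf_cont u) (@continuous_reflect G R v x (evf_cont v)) (m := m).
rewrite evconvE (le_trans H) // !evsqr_at0.
rewrite (haar_int_reflect cptG haarm (u := fun y => v y ^+ 2)) // => y.
by under eq_fun do rewrite expr2; apply: cvgM; exact: evf_cont.
Qed.

Lemma evsqr_max u x : `|(u ** u) x| <= (u ** u) 0.
Proof. by rewrite -ler_sqr ?nnegrE ?evsqr_ge0 // real_normK ?num_real // expr2 evconv_CS. Qed.

Lemma evconv_sup u v a b x : (forall y, `|u y| <= a) -> (forall y, `|v y| <= b) ->
  `|(u ** v) x| <= a * b.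
Proof.
move=> ua vb; rewrite evconvE; apply: haar_int_bound => // y.
by rewrite normrM ler_pM ?ua ?vb.
Qed.

Lemma evsqr_eq0 u w : (u ** u) 0 = 0 -> u ** w = 0.
Proof.
move=> u0; apply: evfunP => x; apply/eqP; rewrite -sqrf_eq0 eq_le sqr_ge0 andbT.
by have := evconv_CS u w x; rewrite u0 mul0r.
Qed.

(** Uniform convergence, which convolution by a fixed element preserves and which keeps limits
    continuous and even. *)
Definition ulim (h : nat -> ev) e :=
  forall eps, 0 < eps -> exists N, forall n x, (N <= n)%N -> `|h n x - e x| <= eps.

Lemma ulim_unique h e e' : ulim h e -> ulim h e' -> e = e'.
Proof.
move=> H H'; apply: evfunP => x; apply/eqP; rewrite -subr_eq0 -normr_le0.
apply/ler_addgt0Pl => d d0; rewrite addr0.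
have d2 : 0 < d / 2 by rewrite divr_gt0.
have [N HN] := H _ d2.
have [N' HN'] := H' _ d2.
have h1 := HN (maxn N N') x (leq_maxl _ _).
have h2 := HN' (maxn N N') x (leq_maxr _ _).
rewrite (splitr d) (le_trans (ler_distD (h (maxn N N') x) _ _)) //.
by rewrite lerD // distrC.
Qed.

Lemma ulim_conv u h e : ulim h e -> ulim (fun n => u ** h n) (u ** e).
Proof.
move=> H d d0.
have [Mu Mu0 bu] := continuous_bounded cptG (evf_cont u).
have [N HN] := H _ (divr_gt0 d0 Mu0); exists N => n x Nn.
rewrite -evB -evconvBr (_ : d = Mu * (d / Mu)); last by rewrite mulrC divfK ?gt_eqF.
by apply: evconv_sup => // y; rewrite evB HN.
Qed.

Lemma ulim_shift k h e : ulim h e <-> ulim (fun n => h (k + n)%N) e.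
Proof.
split=> H d /H [N HN].
  by exists N => n x Nn; apply: HN; rewrite (leq_trans Nn) // leq_addl.
exists (k + N)%N => n x Nn; rewrite -(subnKC (leq_trans (leq_addr N k) Nn)).
by apply: HN; rewrite leq_subRL // (leq_trans (leq_addr N k) Nn).
Qed.

Lemma ulim_cst e : ulim (fun=> e) e.
Proof. by move=> d d0; exists 0%N => n x _; rewrite subrr normr0 ltW. Qed.

Lemma ulim_at h e x : ulim h e -> h n x @[n --> \oo] --> e x.
Proof.
move=> H; apply/cvgrPdist_le => d /H [N HN].
by exists N => // n /= Nn; rewrite distrC HN.
Qed.

Lemma ulim_ex (h : nat -> ev) :
  (forall eps, 0 < eps -> exists N, forall i j x, (N <= i)%N -> (N <= j)%N ->
     `|h i x - h j x| <= eps) -> exists e, ulim h e.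
Proof.
move=> H.
have cv x : cvg (h n x @[n --> \oo]).
  apply/cauchy_cvgP/cauchy_exP => d d0.
  have d2 : 0 < d / 2 by rewrite divr_gt0.
  have [N HN] := H _ d2; exists (h N x); exists N => // n /= Nn.
  rewrite /ball /= (@le_lt_trans _ _ (d / 2)) ?HN //.
  by rewrite ltr_pdivrMr // ltr_pMr // ltr1n.
pose f x := lim (h n x @[n --> \oo]).
have Hf d : 0 < d -> exists N, forall n x, (N <= n)%N -> `|h n x - f x| <= d.
  move=> /H [N HN]; exists N => n x Nn.
  have : `|h n x - h k x| @[k --> \oo] --> `|h n x - f x|.
    by apply: cvg_norm; apply: cvgB; [exact: cvg_cst|exact: cv].
  move/cvgr_to_le; apply.
  by exists N => // k /= Nk; exact: HN.
have ef x : f (- x) = f x.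
  by rewrite /f; under eq_fun do rewrite evf_even.
have cf : continuous f.
  apply: uniform_continuous => d d0.
  have d3 : 0 < d / 3 by rewrite divr_gt0.
  have [N /(_ N _ (leqnn N)) HN] := Hf _ d3.
  apply: filterS (continuous_uniform cptG (evf_cont (h N)) d3) => t Ht x.
  rewrite (_ : _ - _ = - (h N (x + t) - f (x + t)) + (h N (x + t) - h N x) + (h N x - f x)); last by ring.
  rewrite (le_trans (ler_normD _ _)) // (le_trans (lerD (ler_normD _ _) (lexx _))) //.
  rewrite normrN (le_trans (lerD (lerD (HN _) (ltW (Ht _))) (HN _))) //.
  by rewrite le_eqVlt; apply/orP; left; apply/eqP; field.
by exists (EvFun cf ef).
Qed.

End Convolution.

(** * Spectral projection by the power method *)

Section PowerMethod.
Context {R : realType} {G : topologicalZmodType} {m : probability (borel G) R}.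
Hypothesis cptG : compact [set: G].
Hypothesis haarm : haar_measure m.
Local Notation I := (haar_int (m := m)).
Local Notation ev := (evfun R G).
Local Notation "u ** v" := (evconv cptG haarm u v) (at level 40, left associativity).
Implicit Types u v w e : ev.

(** The power of exponent n + 1: convolution has in general no unit to start from, whence the
    successor in [evpowD]. *)
Definition evpow u n : ev := iter n (fun v => u ** v) u.

Lemma evpowD u i j : evpow u i ** evpow u j = evpow u (i + j).+1.
Proof. by elim: i => //= i IH; rewrite -evconvA IH. Qed.

Lemma evpow_sqr u n : evpow (u ** u) n = evpow u n ** evpow u n.
Proof.
elim: n => //= n ->; rewrite -!evconvA; congr (_ ** _).
by rewrite !evconvA; congr (_ ** _); rewrite evconvC.
Qed.

Variable phi : ev.
(** In spectral terms, [b n] below is the sum of the powers of exponent 2 (n + 1) of the eigenvalues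
    of phi, counted with multiplicity. *)
Let k n := evpow (phi ** phi) n.
Let b n := k n 0.

Let kE n : k n = evpow phi n ** evpow phi n. Proof. exact: evpow_sqr. Qed.
Let kD i j : k i ** k j = k (i + j).+1. Proof. exact: evpowD. Qed.
Let b_ge0 n : 0 <= b n. Proof. by rewrite /b kE evsqr_ge0. Qed.
Let k_max n x : `|k n x| <= b n. Proof. by rewrite /b kE evsqr_max. Qed.
Let b_mul i j : b (i + j).+1 <= b i * b j.
Proof.
rewrite /b -kD (le_trans (ler_norm _)) //.
by apply: evconv_sup => y; exact: k_max.
Qed.
(** Cauchy-Schwarz for the powers of phi of exponents n + 1 and n + 3, whose squares have the values
    [b n] and [b n.+2] at 0. *)
Let b_logconvex n : b n.+1 ^+ 2 <= b n * b n.+2.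
Proof.
have -> : b n.+1 = (evpow phi n ** evpow phi n.+2) 0.
  by rewrite /b kE !evpowD !addnS addSn.
by rewrite (le_trans (evconv_CS _ _ _ _ _)) // /b !kE.
Qed.

Hypothesis b1_gt0 : 0 < b 1.

Let b_gt0 n : 0 < b n.
Proof.
have b0 : 0 < b 0.
  rewrite lt_def b_ge0 andbT; apply/eqP => b00.
  by have := lt_le_trans b1_gt0 (b_mul 0 0); rewrite b00 mul0r ltxx.
suff : (0 < b n) && (0 < b n.+1) by case/andP.
elim: n => [|n /andP[h1 h2]]; first by rewrite b0 b1_gt0.
rewrite h2 /=; have := lt_le_trans (exprn_gt0 2 h2) (b_logconvex n).
by rewrite pmulr_rgt0.
Qed.

(** Log-convexity makes these ratios increase; their limit [rho] is the top eigenvalue of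
    convolution by [phi ** phi]. *)
Let r n := b n.+1 / b n.
Let r_gt0 n : 0 < r n. Proof. by rewrite divr_gt0. Qed.
Let r_nd : nondecreasing_seq r.
Proof.
apply/nondecreasing_seqP => n; rewrite /r ler_pdivrMr // mulrAC ler_pdivlMr //.
by rewrite -expr2 mulrC b_logconvex.
Qed.
Let r_ub n : r n <= b 0.
Proof. by rewrite /r ler_pdivrMr // (le_trans _ (b_mul 0 n)). Qed.
Let rho := limn r.
Let r_cvg : cvgn r.
Proof.
apply: nondecreasing_is_cvgn => //.
by exists (b 0) => _ [n _ <-]; exact: r_ub.
Qed.
Let r_le n : r n <= rho. Proof. exact: nondecreasing_cvgn_le. Qed.
Let rho_gt0 : 0 < rho. Proof. exact: lt_le_trans (r_gt0 0) (r_le 0). Qed.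

(** Since r increases, b i * r i ^ (n + 1) is at most b (i + n + 1), hence at most b i * b n. Cancel
    b i and let i tend to infinity. This lower bound is what keeps the limit idempotent away from
    0. *)
Let b_ge n : rho ^+ n.+1 <= b n.
Proof.
have H i : r i ^+ n.+1 <= b n.
  have : b i * r i ^+ n.+1 <= b (i + n).+1.
    elim: n => [|n IH]; first by rewrite addn0 expr1 /r mulrC divfK ?gt_eqF.
    rewrite exprSr mulrA (le_trans (ler_wpM2r (ltW (r_gt0 i)) IH)) //.
    rewrite addnS -(_ : b (i + n).+1 * r (i + n).+1 = b (i + n).+2); last first.
      by rewrite /r mulrC divfK ?gt_eqF.
    rewrite ler_wpM2l //; apply: r_nd; exact: leq_trans (leq_addr _ _) (leqnSn _).
  by move=> /le_trans /(_ (b_mul i n)); rewrite ler_pM2l.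
have : r i ^+ n.+1 @[i --> \oo] --> rho ^+ n.+1.
  exact: (continuous_cvg _ (@exprn_continuous R n.+1 rho) r_cvg).
by move/cvgr_to_le; apply; exact: nearW.
Qed.

Let beta n := b n / rho ^+ n.+1.
Let beta_ge1 n : 1 <= beta n.
Proof. by rewrite /beta ler_pdivlMr ?exprn_gt0 // mul1r b_ge. Qed.
Let beta_ni : nonincreasing_seq beta.
Proof.
apply/nonincreasing_seqP => n.
rewrite /beta exprS invfM mulrA ler_wpM2r ?invr_ge0 ?exprn_ge0 ?(ltW rho_gt0) //.
by rewrite ler_pdivrMr // mulrC -ler_pdivrMr //; exact: r_le.
Qed.
Let beta_cvg : cvgn beta.
Proof.
apply: nonincreasing_is_cvgn => //.
by exists 1 => _ [n _ <-]; exact: beta_ge1.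
Qed.

Let g n : ev := (rho ^+ n.+1)^-1 *: k n.
Let gD i j : g i ** g j = g (i + j).+1.
Proof.
rewrite /g evconvZl evconvZr kD scalerA; congr (_ *: _).
by rewrite -invfM -exprD addnS addSn.
Qed.
Let g0 n : g n 0 = beta n. Proof. by rewrite /g evZ mulrC. Qed.

(** Extracting a factor [g 0] lets Cauchy-Schwarz pass from the L_2 distance of g i and g j to a
    uniform one. The squared L_2 distance is beta (2i + 1) - 2 beta (i + j + 1) + beta (2j + 1), and
    beta is decreasing. *)
Let g_cauchy i j x : (i <= j)%N ->
  `|g i.+1 x - g j.+1 x| ^+ 2 <= beta 1 * (beta (i + i).+1 - limn beta).
Proof.
move=> ij.
have -> : g i.+1 x - g j.+1 x = (g 0 ** (g i - g j)) x.
  by rewrite evconvBr evB !gD.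
rewrite real_normK ?num_real // (le_trans (evconv_CS _ _ _ _ _)) //.
rewrite gD g0 ler_wpM2l // ?(le_trans ler01 (beta_ge1 _)) //.
rewrite evconvBl !evconvBr !gD !evB !g0.
have h1 : beta (j + j).+1 <= beta (i + j).+1 by apply: beta_ni; rewrite ltnS leq_add2r.
have h2 : limn beta <= beta (i + j).+1 by apply: nonincreasing_cvgn_ge.
rewrite (addnC j i); lra.
Qed.

(* [g n], the n-th power of phi ** phi divided by that of the top eigenvalue rho,
   is uniformly Cauchy; its limit is the projection on the rho-eigenspace. *)
Lemma dominant_idempotent : exists (rho : R) e, [/\ 0 < rho, e ** e = e, 1 <= e 0,
   phi ** phi ** e = rho *: e &
   (forall w, phi ** w = phi -> e ** w = e) /\
   ((phi ** phi) ** ((phi ** phi) ** (phi ** phi))) 0 <=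
     rho * ((phi ** phi) ** (phi ** phi)) 0].
Proof.
have [e He] : exists e, ulim g e.
  (* The shift by one is the factor [g 0] spent in [g_cauchy]. *)
  have [e He] : exists e, ulim (fun n => g (1 + n)%N) e.
    apply: (ulim_ex cptG) => d d0.
    have : beta 1 * (beta (i + i).+1 - limn beta) @[i --> \oo] --> beta 1 * 0.
      apply: cvgM; first exact: cvg_cst.
      rewrite -(subrr (limn beta)); apply: cvgB; last exact: cvg_cst.
      have : beta i @[i --> \oo] --> limn beta by exact: beta_cvg.
      move/cvgrPdist_lt => H; apply/cvgrPdist_lt => c /H [N _ HN].
      exists N => // n /= Nn; apply: HN => /=.
      by rewrite (leq_trans Nn) // (leq_trans (leq_addr n n)).
    rewrite mulr0 => /cvgrPdist_le /(_ _ (exprn_gt0 2 d0)) [N _ HN].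
    have H i j x : (N <= i)%N -> (i <= j)%N -> `|g i.+1 x - g j.+1 x| <= d.
      move=> Ni ij; rewrite -ler_sqr ?nnegrE ?(ltW d0) //.
      rewrite (le_trans (g_cauchy x ij)) //.
      by have := HN i Ni; rewrite sub0r normrN; apply: le_trans; exact: ler_norm.
    exists N => i j x Ni Nj; case: (leqP i j) => ij; first exact: H.
    by rewrite distrC; apply: H => //; exact: ltnW.
  by exists e; apply: (ulim_shift 1 g e).2 He.
have ge i : g i ** e = e.
  apply: (ulim_unique (ulim_conv cptG haarm (g i) He)).
  have -> : (fun n => g i ** g n) = (fun n => g (i.+1 + n)%N).
    by apply/funext => n; rewrite gD.
  exact: (ulim_shift i.+1 g e).1 He.
exists rho, e; split => //; last split.
- apply: (ulim_unique (ulim_conv cptG haarm e He)).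
  have -> : (fun n => e ** g n) = fun=> e by apply/funext => n; rewrite evconvC.
  exact: ulim_cst.
- have := @ulim_at _ _ g e 0 He; move/cvgr_to_ge; apply; apply: nearW => n.
  by rewrite g0.
- have -> : phi ** phi = rho *: g 0.
    by rewrite /g expr1 scalerA divff ?scale1r // gt_eqF.
  by rewrite evconvZl ge.
- move=> w Hw; rewrite evconvC.
  apply: (ulim_unique (ulim_conv cptG haarm w He)).
  have -> : (fun n => w ** g n) = g; last exact: He.
  apply/funext => n; rewrite /g evconvZr; congr (_ *: _).
  have B : w ** (phi ** phi) = phi ** phi by rewrite evconvA (evconvC _ _ w) Hw.
  by rewrite /k; case: n => [|n] /=; rewrite ?B // evconvA B.
- have := r_le 1; rewrite /r ler_pdivrMr //.
Qed.

End PowerMethod.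

(** * Minimal idempotents and approximation by trigonometric polynomials *)

Section DAlembert.
Context {R : realType} {G : topologicalZmodType} {m : probability (borel G) R}.
Hypothesis cptG : compact [set: G].
Hypothesis haarm : haar_measure m.
Local Notation I := (haar_int (m := m)).
Local Notation ev := (evfun R G).
Local Notation "u ** v" := (evconv cptG haarm u v) (at level 40, left associativity).
Implicit Types u v w e : ev.

Lemma idempotent_max e x : e ** e = e -> `|e x| <= e 0.
Proof. by move=> ee; rewrite -{1}ee -[in leRHS]ee evsqr_max. Qed.

Lemma idempotent_ge0 e : e ** e = e -> 0 <= e 0.
Proof. by move=> ee; rewrite -ee evsqr_ge0. Qed.

Lemma idempotent_eq0 e : e ** e = e -> e 0 = 0 -> e = 0.
Proof.
move=> ee e0; apply: evfunP => x; apply/eqP; rewrite -normr_le0 -e0.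
exact: idempotent_max.
Qed.

(** An idempotent is bounded by e 0, so e 0 = (e ** e) 0 is at most (e 0)^2. In spectral terms e 0
    is the dimension of the range of the projection. *)
Lemma idempotent_ge1 e : e ** e = e -> e != 0 -> 1 <= e 0.
Proof.
move=> ee en0; have e0 : 0 < e 0.
  rewrite lt_def idempotent_ge0 // andbT; apply: contra en0 => /eqP e0.
  by apply/eqP; exact: idempotent_eq0.
rewrite -(ler_pM2l e0) mulr1 -{1}ee (le_trans (ler_norm _)) //.
by apply: evconv_sup => y; exact: idempotent_max.
Qed.

(* [e 0 >= 1] for every nonzero idempotent, so splitting off orthogonal
   idempotents must stop. *)
Lemma minimal_idempotent e : e ** e = e -> e != 0 ->
  exists e1, [/\ e1 ** e1 = e1, e1 != 0, e1 ** e = e1 &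
    forall r, r ** r = r -> r ** e1 = r -> r = 0 \/ r = e1].
Proof.
move=> ee en0.
pose S : set R := [set x | exists e1, [/\ e1 ** e1 = e1, e1 != 0, e1 ** e = e1 & x = e1 0]].
have Sinf : has_inf S.
  split; first by exists (e 0), e.
  by exists 1 => _ [e1 [h1 h2 _ ->]]; exact: idempotent_ge1.
(* The infimum need not be attained: coming within 1 of it suffices, because a proper splitting of
   e1 into r and e1 - r would lower the value at 0 by at least 1. *)
have [_ [e1 [h1 h2 h3 ->]] He] := @inf_adherent _ S 1 ltr01 Sinf.
exists e1; split => // r rr re.
have [->|rn0] := eqVneq r 0; first by left.
right; apply/esym/eqP; rewrite -subr_eq0; apply/negPn/negP => dn0.
have dd : (e1 - r) ** (e1 - r) = e1 - r.
  rewrite evconvBl !evconvBr h1 rr re (evconvC _ _ e1) re.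
  by rewrite subrr subr0.
have := idempotent_ge1 dd dn0; rewrite evB.
have : inf S <= r 0.
  apply: ge_inf; first exact: Sinf.2.
  by exists r; split => //; rewrite -re -evconvA h3.
lra.
Qed.

Definition dalembert (c : G -> R) :=
  [/\ continuous c, c 0 = 1, forall x, `|c x| <= 1 &
    forall x y, c (x + y) + c (x - y) = 2 * c x * c y].

(* The average q of the translates of e by a and -a satisfies [q ** e = q]. By
   minimality the projection attached to q is e itself, so [q ** q = rho *: e] and
   (e + rho^(-1/2) q) / 2 is an idempotent below e: it is 0 or e, hence q is a
   multiple of e. *)
Lemma minimal_idempotent_dalembert e : e ** e = e -> e != 0 ->
  (forall r, r ** r = r -> r ** e = r -> r = 0 \/ r = e) ->
  dalembert (fun x => (e 0)^-1 * e x).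
Proof.
move=> ee en0 emin.
have e0 : 0 < e 0 by exact: lt_le_trans ltr01 (idempotent_ge1 ee en0).
split; first by move=> x; apply: cvgM; [exact: cvg_cst|exact: evf_cont].
- by rewrite mulVf // gt_eqF.
- move=> x; rewrite normrM gtr0_norm ?invr_gt0 // ler_pdivrMl // mulr1.
  exact: idempotent_max.
have ct a : continuous (fun x => e (x + a)) by apply: continuous_translate; exact: evf_cont.
move=> x a.
have cq : continuous (fun x => (e (x + a) + e (x - a)) / 2).
  by move=> y; apply: cvgM; [apply: cvgD; exact: ct|exact: cvg_cst].
have eq y : (e (- y + a) + e (- y - a)) / 2 = (e (y + a) + e (y - a)) / 2.
  by rewrite addrC -[- y - a]opprD evf_even -[- y + a]opprK opprD opprK evf_even.
pose q : ev := EvFun cq eq.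
have qe : q ** e = q.
  have tr c y : I (fun z => e (z + c) * e (y - z)) = e (y + c).
    rewrite -[in RHS]ee evconvE -[RHS](haar_int_translate cptG haarm c); last first.
      by apply: evconv_cont.
    by congr (haar_int _); apply/funext => z; rewrite opprD addrACA subrr addr0.
  have ctr c y : continuous (fun z => e (z + c) * e (y - z)).
    by apply: continuousM; [exact: ct|apply: continuous_reflect; exact: evf_cont].
  apply: evfunP => y /=; rewrite -(tr a) -(tr (- a)) mulrC -haar_intD //.
  rewrite -haar_intZ //; last by move=> z; apply: cvgD; exact: ctr.
  by congr (haar_int _); apply/funext => z; rewrite -mulrDl mulrA [2^-1 * _]mulrC.
have [c Hc] : exists c, q = c *: e.
  (* Degenerate case: an element whose square vanishes at 0 annihilates everything, and e acts on q
     as a unit; so q ** q and then q vanish. *)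
  have [qq0|qq0] := eqVneq ((q ** q) ** (q ** q)) 0.
    have q20 : q ** q = 0.
      have : (q ** q) ** e = q ** q by rewrite -evconvA qe.
      by rewrite evsqr_eq0 // qq0.
    exists 0; rewrite scale0r -qe evsqr_eq0 // q20 //.
  have b1 : 0 < evpow cptG haarm (q ** q) 1 0.
    rewrite lt_def evsqr_ge0 andbT; apply: contra qq0 => /eqP H; apply/eqP.
    exact: evsqr_eq0.
  have [rho [f [rho0 ff f1 kf [fe _]]]] := dominant_idempotent b1.
  have fE : f = e.
    have [f0|//] := emin f ff (fe e qe).
    by move: f1; rewrite f0 ev0 ler10.
  have qqE : q ** q = rho *: e by rewrite fE in kf; rewrite -kf -evconvA qe.
  pose s := Num.sqrt rho.
  have s0 : 0 < s by rewrite sqrtr_gt0.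
  have s2 : s ^+ 2 = rho by rewrite sqr_sqrtr // ltW.
  have eq' : e ** q = q by rewrite evconvC.
  pose t : ev := 2^-1 *: (e + s^-1 *: q).
  have tt : t ** t = t.
    rewrite /t evconvZl evconvZr evconvDl !evconvDr !evconvZl !evconvZr ee qe eq' qqE.
    apply: evfunP => y; rewrite !(evZ, evD) -s2; field.
    by rewrite gt_eqF.
  have te : t ** e = t by rewrite /t evconvZl evconvDl evconvZl ee qe.
  have sq : q = s *: (2 *: t - e).
    apply: evfunP => y; rewrite !(evZ, evB, evD); field; by rewrite gt_eqF.
  have [t0|tE] := emin t tt te; rewrite sq.
    exists (- s); rewrite t0 scaler0 sub0r scalerN scaleNr //.
  exists s; rewrite tE; congr (_ *: _).
  by rewrite scaler_nat mulr2n addrK.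
have Hq y : (e (y + a) + e (y - a)) / 2 = c * e y by have := congr1 (fun u : ev => u y) Hc.
have ca : c = e a / e 0.
  apply: (mulIf (lt0r_neq0 e0)); rewrite divfK ?gt_eqF // -Hq add0r sub0r evf_even.
  by field.
rewrite -mulrDr (_ : e (x + a) + e (x - a) = 2 * ((e (x + a) + e (x - a)) / 2)); last by field.
rewrite Hq ca; field; by rewrite gt_eqF.
Qed.

Inductive trig : ev -> Prop :=
| trig0 : trig 0
| trigD u a (c : ev) : trig u -> dalembert c -> trig (u + a *: c).

Lemma trig_add u v : trig u -> trig v -> trig (u + v).
Proof.
move=> tu; elim=> [|w a c tw IH dc]; first by rewrite addr0.
by rewrite addrA; apply: trigD.
Qed.

(** As u is even, c (x - y) may be replaced by c (x + y) under the integral; adding the two forms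
    and using d'Alembert's equation pulls c x out. Thus c is an eigenvector of every convolution,
    and [trig] is an ideal. *)
Lemma evconv_dalembert u (c : ev) : dalembert c -> u ** c = I (fun y => u y * c y) *: c.
Proof.
move=> [_ _ _ dc]; apply: evfunP => x; rewrite evZ evconvE.
have cu : continuous (fun y => u y * c (x + y)).
  apply: continuousM; first exact: evf_cont.
  under eq_fun do rewrite addrC; apply: continuous_translate; exact: evf_cont.
have E : I (fun y => u y * c (x - y)) = I (fun y => u y * c (x + y)).
  rewrite -(haar_int_opp cptG haarm) //; last exact: evconv_cont.
  by congr (haar_int _); apply/funext => y; rewrite evf_even opprK.
apply: (@mulfI _ 2) => //; rewrite mulr_natl mulr2n {2}E -haar_intD //; last exact: evconv_cont.
transitivity (I (fun y => (2 * c x) * (u y * c y))).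
  congr (haar_int _); apply/funext => y; rewrite -mulrDr addrC dc; ring.
rewrite haar_intZ //; first ring.
by apply: continuousM; exact: evf_cont.
Qed.

Lemma trig_conv u w : trig u -> trig (u ** w).
Proof.
elim=> [|v a c tv IH dc]; first by rewrite evconv0l; exact: trig0.
rewrite evconvDl evconvZl evconvC [c ** w]evconvC (evconv_dalembert w dc) scalerA.
by apply: trigD => //; rewrite evconvC.
Qed.

(* Spectrally |lambda|^6 <= rho * lambda^4, which bounds the sup norm of the sixth
   power by the top eigenvalue rho of u ** u; see the last clause of
   [dominant_idempotent]. *)
Definition evpow6 u := (u ** u) ** ((u ** u) ** (u ** u)).

(** Congruence modulo the ideal [trig] is compatible with products. *)
Lemma trig_pow6 u v : trig (u - v) -> trig (evpow6 u - evpow6 v).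
Proof.
have H a b c d : trig (a - b) -> trig (c - d) -> trig (a ** c - b ** d).
  move=> tab tcd.
  rewrite (_ : _ - _ = (a - b) ** c + (c - d) ** b).
    by apply: trig_add; exact: trig_conv.
  by rewrite !evconvBl (evconvC _ _ c b) (evconvC _ _ d b) addrA subrK.
by move=> t; exact: H _ _ _ _ (H _ _ _ _ t t) (H _ _ _ _ (H _ _ _ _ t t) (H _ _ _ _ t t)).
Qed.

Lemma evpow6E u : evpow6 u = (u ** (u ** u)) ** (u ** (u ** u)).
Proof.
by rewrite /evpow6 !evconvA.
Qed.

(* Subtracting projections from phi lowers [(u ** u) 0] by at least rho each time;
   at a nearly minimal value rho is small. *)
Lemma trig_dense phi (eps : R) : 0 < eps ->
  exists2 t, trig t & forall x, `|evpow6 phi x - t x| <= eps.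
Proof.
move=> eps0.
pose S : set R := [set x | exists u,
   [/\ trig (phi - u), (u ** u) 0 <= (phi ** phi) 0 & x = (u ** u) 0]].
have Sinf : has_inf S.
  split; first by exists ((phi ** phi) 0), phi; split => //; rewrite subrr; exact: trig0.
  by exists 0 => _ [u [_ _ ->]]; exact: evsqr_ge0.
(* C dominates the value at 0 of the fourth power of u, since (u ** u) 0 does not exceed (phi **
   phi) 0. With rho <= eps / C, the sixth power of u is then uniformly at most eps. *)
set C := ((phi ** phi) 0) ^+ 2 + 1.
have C0 : 0 < C by rewrite ltr_wpDl // sqr_ge0.
have d0 : 0 < eps / C by rewrite divr_gt0.
have [_ [u [tu uphi ->]] Hu] := inf_adherent d0 Sinf.
exists (evpow6 phi - evpow6 u); first exact: trig_pow6.
move=> x; rewrite evB opprB addrC subrK.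
have [E|E] := eqVneq (((u ** u) ** (u ** u)) 0) 0.
  by rewrite /evpow6 (evsqr_eq0 _ E) ev0 normr0 ltW.
have b1 : 0 < evpow cptG haarm (u ** u) 1 0 by rewrite lt_def E evsqr_ge0.
have [rho [e [rho0 ee e1 ke [_ Hrho]]]] := dominant_idempotent b1.
have en0 : e != 0 by apply: contraTneq e1 => ->; rewrite ev0 ler10.
have [f [ff fn0 fe fmin]] := minimal_idempotent ee en0.
have df := minimal_idempotent_dalembert ff fn0 fmin.
have f1 := idempotent_ge1 ff fn0.
pose u' := u - u ** f.
have kf : u ** u ** f = rho *: f.
  by rewrite -fe [f ** e]evconvC evconvA ke evconvZl.
have u'E : u' ** u' = u ** u - rho *: f.
  rewrite /u' evconvBl !evconvBr.
  have -> : u ** (u ** f) = rho *: f by rewrite evconvA.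
  have -> : u ** f ** u = rho *: f by rewrite evconvC evconvA.
  have -> : u ** f ** (u ** f) = rho *: f.
    by rewrite evconvA (evconvC _ _ _ u) evconvA -evconvA ff.
  by rewrite subrr subr0.
have rho_le : rho <= eps / C.
  have : inf S <= (u' ** u') 0.
    apply: ge_inf; first exact: Sinf.2.
    exists u'; split => //.
      rewrite /u' opprB addrA addrAC; apply: trig_add => //.
      rewrite evconvC; apply: trig_conv.
      have -> : f = 0 + f 0 *: ((f 0)^-1 *: f).
        by rewrite add0r scalerA divff ?scale1r // gt_eqF // (lt_le_trans ltr01).
      by apply: trigD => //; exact: trig0.
    rewrite u'E evB evZ (le_trans _ uphi) // lerBlDr lerDl mulr_ge0 ?(ltW rho0) //.
    exact: le_trans ler01 f1.
  rewrite u'E evB evZ => H.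
  have : rho <= rho * f 0 by rewrite ler_pMr.
  lra.
rewrite evpow6E (le_trans (evsqr_max _ _ _ _)) // -evpow6E (le_trans Hrho) //.
have h : ((u ** u) ** (u ** u)) 0 <= C.
  rewrite (le_trans (ler_norm _)) // (le_trans (evconv_sup cptG haarm 0 (evsqr_max cptG haarm u) (evsqr_max cptG haarm u))) //.
  rewrite /C -expr2 (le_trans (y := (phi ** phi) 0 ^+ 2)) ?lerDl //.
  by rewrite ler_pXn2r ?nnegrE ?evsqr_ge0.
rewrite (le_trans (ler_wpM2r (evsqr_ge0 _ _ _) rho_le)) //.
by rewrite mulrAC ler_pdivrMr // ler_pM2l.
Qed.

End DAlembert.

(** * Characters and Kronecker's theorem *)

Section ComplexContinuity.
Context {R : realType} {T : topologicalType}.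
Implicit Types h : T -> R[i].

Lemma complex_gt0 (e : R[i]) : 0 < e -> exists2 d : R, 0 < d & e = d%:C%C.
Proof.
case: e => a b; rewrite ltcE /= => /andP[/eqP -> a0].
by exists a.
Qed.

Lemma normc_le_ReIm (z : R[i]) : `|z| <= (`|complex.Re z| + `|complex.Im z|)%:C%C.
Proof.
case: z => a b; rewrite normc_def lecR /=.
rewrite -ler_sqr ?nnegrE ?addr_ge0 ?sqrtr_ge0 // sqr_sqrtr ?addr_ge0 ?sqr_ge0 //.
rewrite sqrrD !real_normK ?num_real // -addrA [_ *+ 2 + _]addrC addrA lerDl.
by rewrite mulrn_wge0 // mulr_ge0.
Qed.

Lemma normc_ge_Im (z : R[i]) : `|complex.Im z|%:C%C <= `|z|.
Proof.
by rewrite normc_def lecR -sqrtr_sqr ler_wsqrtr // lerDr sqr_ge0.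
Qed.

Lemma complex_continuous h : continuous (fun x => complex.Re (h x)) ->
  continuous (fun x => complex.Im (h x)) -> continuous (h : T -> R[i]^o).
Proof.
move=> cr ci x; apply/cvgrPdist_lt => e /complex_gt0[d d0 ->].
have d2 : 0 < d / 2 by rewrite divr_gt0.
move/cvgrPdist_lt: (cr x) => /(_ _ d2); move/cvgrPdist_lt: (ci x) => /(_ _ d2).
apply: filterS2 => y h1 h2.
rewrite (le_lt_trans (normc_le_ReIm _)) // ltcR (splitr d).
by rewrite !raddfB /= ltrD.
Qed.

Lemma Re_continuous h : continuous (h : T -> R[i]^o) -> continuous (fun x => complex.Re (h x)).
Proof.
move=> ch x; apply/cvgrPdist_lt => e e0.
have e0' : 0 < e%:C%C by rewrite ltcR.
move/cvgrPdist_lt: (ch x) => /(_ _ e0'); apply: filterS => y H.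
rewrite -ltcR (le_lt_trans _ H) // -raddfB; exact: normc_ge_Re.
Qed.

Lemma Im_continuous h : continuous (h : T -> R[i]^o) -> continuous (fun x => complex.Im (h x)).
Proof.
move=> ch x; apply/cvgrPdist_lt => e e0.
have e0' : 0 < e%:C%C by rewrite ltcR.
move/cvgrPdist_lt: (ch x) => /(_ _ e0'); apply: filterS => y H.
rewrite -ltcR (le_lt_trans _ H) // -raddfB.
exact: normc_ge_Im.
Qed.

End ComplexContinuity.

Section DAlembertCharacter.
Context {R : realType} {G : topologicalZmodType}.
Variable c : G -> R.
Hypothesis dc : dalembert c.

Let c0 : c 0 = 1. Proof. by case: dc. Qed.
Let cE x y : c (x + y) + c (x - y) = 2 * c x * c y. Proof. by case: dc. Qed.

(** If c takes only the values 1 and -1 it is itself a character. Otherwise a sine is recovered by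
    normalising D at a fixed point y0 with c y0 ^ 2 != 1; this fixes its global sign, that is, it
    chooses between a character and its conjugate. *)
Lemma dalembert_character :
  exists2 chi : G -> R[i], character chi & forall x, complex.Re (chi x) = c x.
Proof.
have [cc _ c1 _] := dc.
have [[y0 Hy0]|nex] := pselect (exists y0, c y0 ^+ 2 != 1); last first.
  have csq x : c x ^+ 2 = 1.
    by apply/eqP/negPn/negP => cx; apply: nex; exists x.
  have cM x y : c (x + y) = c x * c y.
    have h z : c z = 1 \/ c z = -1.
      by have /eqP := csq z; rewrite sqrf_eq1 => /orP[]/eqP; [left|right].
    have := cE x y.
    case: (h x) => ->; case: (h y) => ->; case: (h (x + y)) => ->; case: (h (x - y)) => ->; lra.
  exists (fun x => (c x)%:C%C) => //; split.
  - by apply: complex_continuous => //=; exact: cst_continuous.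
  - move=> x; rewrite normc_def /= expr0n /= addr0 csq sqrtr1 //.
  - by move=> x y; rewrite cM rmorphM.
(* If c is the cosine of an angle theta, then D x y = sin (theta x) sin (theta y). *)
pose D x y := (c (x - y) - c (x + y)) / 2.
have DE x y : D x y = c (x - y) - c x * c y.
  by rewrite /D; have := cE x y; lra.
have prodE p q : c p * c q = (c (p + q) + c (p - q)) / 2 by rewrite cE; field.
(* D has rank one: both sides expand, by the product formula [prodE], into the same combination of
   eight values of c. *)
have D2 x y z w : D x y * D z w = D x z * D y w.
  have P p q r s : (c p - c q) / 2 * ((c r - c s) / 2) =
     (c (p + r) + c (p - r) - c (p + s) - c (p - s) - c (q + r) - c (q - r) + c (q + s) + c (q - s)) / 8.
    transitivity ((c p * c r - c p * c s - c q * c r + c q * c s) / 4); first by field.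
    by rewrite !prodE; field.
  rewrite /D !P.
  have e1 : x - z + (y - w) = x + y - (z + w) by rewrite opprD addrACA.
  have e2 : x - z - (y - w) = x - y - (z - w) by rewrite !opprB addrACA [in RHS]addrACA [- z + _]addrC.
  have e3 : x - z + (y + w) = x + y - (z - w) by rewrite opprD opprK addrACA.
  have e4 : x - z - (y + w) = x - y - (z + w) by rewrite !opprD addrACA.
  have e5 : x + z + (y - w) = x + y + (z - w) by rewrite addrACA.
  have e6 : x + z - (y - w) = x - y + (z + w) by rewrite opprD opprK addrACA.
  have e7 : x + z + (y + w) = x + y + (z + w) by rewrite addrACA.
  have e8 : x + z - (y + w) = x - y + (z - w) by rewrite opprD addrACA.
  by rewrite e1 e2 e3 e4 e5 e6 e7 e8; field.
have Dxx x : D x x = 1 - c x ^+ 2.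
  by rewrite DE subrr c0 expr2.
have s2 : 0 < 1 - c y0 ^+ 2.
  rewrite lt_def subr_eq0 eq_sym Hy0 subr_ge0.
  have := c1 y0; rewrite ler_norml => /andP[h1 h2]; rewrite expr2; nra.
pose s0 := Num.sqrt (1 - c y0 ^+ 2).
have s00 : 0 < s0 by rewrite sqrtr_gt0.
have s0E : s0 ^+ 2 = 1 - c y0 ^+ 2 by rewrite sqr_sqrtr // ltW.
pose s x := D x y0 / s0.
have ss x y : s x * s y = D x y.
  rewrite /s mulrACA -invfM -expr2 s0E -Dxx.
  have -> : D x y0 * D y y0 = D x y * D y0 y0 by rewrite D2.
  by rewrite mulfK // Dxx gt_eqF.
have cD x y : c (x + y) = c x * c y - s x * s y.
  by rewrite ss DE; have := cE x y; lra.
have sD x y : s (x + y) = s x * c y + c x * s y.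
  suff K : D (x + y) y0 = D x y0 * c y + c x * D y y0.
    by rewrite /s K; field; rewrite gt_eqF.
  transitivity ((c (x - y0) * c y - c (x + y0) * c y + c x * c (y - y0) - c x * c (y + y0)) / 2).
    rewrite !prodE.
    have -> : x - y0 + y = x + y - y0 by rewrite addrAC.
    have -> : x - y0 - y = x - (y + y0) by rewrite opprD addrA addrAC.
    have -> : x + y0 + y = x + y + y0 by rewrite addrAC.
    have -> : x + y0 - y = x - (y - y0) by rewrite opprB addrA.
    by rewrite /D !addrA; field.
  by rewrite /D; field.
exists (fun x => (c x +i* s x)%C) => //; split.
- apply: complex_continuous => //=.
  have -> : s = fun x => (c (x - y0) - c x * c y0) / s0.
    by apply/funext => x; rewrite /s DE.
  have cc' : continuous (fun x => c (x - y0)) by exact: continuous_translate.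
  move=> x; apply: cvgM; last exact: cvg_cst.
  by apply: cvgB; [exact: cc'|apply: cvgM; [exact: cc|exact: cvg_cst]].
- move=> x; rewrite normc_def /= -[s x ^+ 2]/(s x * s x) ss Dxx addrC subrK sqrtr1 //.
- by move=> x y; rewrite cD sD; apply/eqP; rewrite eq_complex /= eqxx /= addrC.
Qed.

End DAlembertCharacter.

Section ComplexIntegral.
Context {R : realType} {G : topologicalZmodType} {m : probability (borel G) R}.
Hypothesis cptG : compact [set: G].
Hypothesis haarm : haar_measure m.
Local Notation I := (haar_int (m := m)).
Implicit Types h g : G -> R[i].

Definition cint h : R[i] := (I (fun x => complex.Re (h x)) +i* I (fun x => complex.Im (h x)))%C.

Definition ccont h := continuous (fun x => complex.Re (h x)) /\
  continuous (fun x => complex.Im (h x)).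

Lemma ccontD h g : ccont h -> ccont g -> ccont (fun x => h x + g x).
Proof.
move=> [h1 h2] [g1 g2]; split; under eq_fun do rewrite raddfD.
  by move=> x; apply: cvgD; [exact: h1|exact: g1].
by move=> x; apply: cvgD; [exact: h2|exact: g2].
Qed.

Lemma ccontM h g : ccont h -> ccont g -> ccont (fun x => h x * g x).
Proof.
move=> [h1 h2] [g1 g2]; split.
  have -> : (fun x => complex.Re (h x * g x)) = (fun x => complex.Re (h x) * complex.Re (g x) -
      complex.Im (h x) * complex.Im (g x)).
    by apply/funext => x; case: (h x) => ? ?; case: (g x).
  have c1 := continuousM h1 g1; have c2 := continuousM h2 g2.
  by move=> x; apply: cvgB; [exact: c1|exact: c2].
have -> : (fun x => complex.Im (h x * g x)) = (fun x => complex.Re (h x) * complex.Im (g x) +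
      complex.Im (h x) * complex.Re (g x)).
  by apply/funext => x; case: (h x) => ? ?; case: (g x).
have c1 := continuousM h1 g2; have c2 := continuousM h2 g1.
by move=> x; apply: cvgD; [exact: c1|exact: c2].
Qed.

Lemma ccont_cst z : ccont (fun=> z).
Proof. by split; exact: cst_continuous. Qed.

Lemma ccont_real (u : G -> R) : continuous u -> ccont (fun x => (u x)%:C%C).
Proof. by move=> cu; split => //=; exact: cst_continuous. Qed.

Lemma ccont_conj h : ccont h -> ccont (fun x => (h x)^*).
Proof.
move=> [h1 h2]; split.
  have -> // : (fun x => complex.Re (h x)^*) = (fun x => complex.Re (h x)).
  by apply/funext => x; case: (h x).
have -> : (fun x => complex.Im (h x)^*) = (fun x => - complex.Im (h x)).
  by apply/funext => x; case: (h x).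
by move=> x; apply: cvgN; exact: h2.
Qed.

Lemma character_ccont h : character h -> ccont h.
Proof. by move=> [ch _ _]; split; [exact: Re_continuous|exact: Im_continuous]. Qed.

Lemma cintD h g : ccont h -> ccont g -> cint (fun x => h x + g x) = cint h + cint g.
Proof.
move=> [h1 h2] [g1 g2]; rewrite /cint.
have -> : (fun x => complex.Re (h x + g x)) = (fun x => complex.Re (h x) + complex.Re (g x)).
  by apply/funext => x; rewrite raddfD.
have -> : (fun x => complex.Im (h x + g x)) = (fun x => complex.Im (h x) + complex.Im (g x)).
  by apply/funext => x; rewrite raddfD.
by rewrite !haar_intD.
Qed.

Lemma cintZ z h : ccont h -> cint (fun x => z * h x) = z * cint h.
Proof.
case: z => a b [h1 h2]; rewrite /cint.
have cZ (c : R) (u : G -> R) : continuous u -> continuous (fun x => c * u x).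
  by move=> cu; apply: continuousM => //; exact: cst_continuous.
have -> : (fun x => complex.Re ((a +i* b)%C * h x)) = (fun x => a * complex.Re (h x) + (- b) * complex.Im (h x)).
  by apply/funext => x; case: (h x) => c d /=; rewrite mulNr.
have -> : (fun x => complex.Im ((a +i* b)%C * h x)) = (fun x => a * complex.Im (h x) + b * complex.Re (h x)).
  by apply/funext => x; case: (h x).
rewrite !haar_intD ?haar_intZ //; try exact: cZ.
by apply/eqP; rewrite eq_complex /= mulNr !eqxx.
Qed.

Lemma cint_cst z : cint (fun=> z) = z.
Proof. by rewrite /cint !haar_int_cst; case: z. Qed.

Lemma cint_real (u : G -> R) : cint (fun x => (u x)%:C%C) = (I u)%:C%C.
Proof. by rewrite /cint /= haar_int_cst. Qed.

Lemma cint_sum n (h : 'I_n -> G -> R[i]) : (forall i, ccont (h i)) ->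
  ccont (fun x => \sum_i h i x) /\ cint (fun x => \sum_i h i x) = \sum_i cint (h i).
Proof.
elim: n h => [|n IH] h ch.
  split; under eq_fun do rewrite big_ord0; first exact: ccont_cst.
  by rewrite cint_cst big_ord0.
have [c1 E1] := IH _ (fun i => ch (lift ord0 i)).
split; under eq_fun do rewrite big_ord_recl; first exact: ccontD.
by rewrite cintD // E1 big_ord_recl.
Qed.

Lemma cint_translate h a : ccont h -> cint (fun x => h (x + a)) = cint h.
Proof.
move=> [h1 h2]; rewrite /cint.
rewrite (haar_int_translate cptG haarm a (u := fun x => complex.Re (h x))) //.
by rewrite (haar_int_translate cptG haarm a (u := fun x => complex.Im (h x))).
Qed.

(** Translation by a multiplies the integral by h a and also leaves it unchanged. *)
Lemma cint_character h a : character h -> h a != 1 -> cint h = 0.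
Proof.
move=> ch ha; have cc := character_ccont ch.
have : cint h = h a * cint h.
  rewrite -cintZ // -[LHS](cint_translate a) //; congr cint.
  by apply/funext => x; rewrite charD // mulrC.
move/eqP; rewrite -subr_eq0 -{1}[cint h]mul1r -mulrBl mulf_eq0 subr_eq0 eq_sym.
by rewrite (negPf ha) => /eqP.
Qed.

End ComplexIntegral.

Section Characters.
Context {R : realType} {G : topologicalZmodType}.
Implicit Types h g : G -> R[i].

Lemma ccont_continuous h : ccont h -> continuous (h : G -> R[i]^o).
Proof. by move=> [h1 h2]; exact: complex_continuous. Qed.

Lemma character1 : character (fun _ : G => 1 : R[i]).
Proof.
split; [|by move=> x; rewrite normr1|by move=> x y; rewrite mulr1].
by apply: ccont_continuous; exact: ccont_cst.
Qed.

Lemma characterM h g : character h -> character g -> character (fun x => h x * g x).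
Proof.
move=> ch cg; split.
- by apply: ccont_continuous; apply: ccontM; exact: character_ccont.
- by move=> x; rewrite normrM !char_norm1 // mulr1.
- by move=> x y; rewrite !charD // mulrACA.
Qed.

Lemma character_conj h : character h -> character (fun x => (h x)^*).
Proof.
move=> ch; split.
- by apply: ccont_continuous; apply: ccont_conj; exact: character_ccont.
- by move=> x; rewrite norm_conjC char_norm1.
- by move=> x y; rewrite charD // rmorphM.
Qed.

Lemma characterX h n : character h -> character (fun x => h x ^+ n).
Proof.
move=> ch; elim: n => [|n IH]; first exact: character1.
by under eq_fun do rewrite exprS; exact: characterM.
Qed.

Lemma character0 h : character h -> h 0 = 1.
Proof.
move=> ch; have := charD ch 0 0; rewrite addr0 -{1}[h 0]mulr1.
by move/mulfI => -> //; rewrite -normr_gt0 char_norm1.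
Qed.

Lemma character_mulJ h x : character h -> h x * (h x)^* = 1.
Proof. by move=> ch; rewrite -normCK char_norm1 // expr1n. Qed.

Lemma expNiD (s t : R) : expNi (s + t) = expNi s * expNi t.
Proof.
rewrite /expNi cosD sinD; apply/eqP; rewrite eq_complex /=.
by apply/andP; split; apply/eqP; ring.
Qed.

Lemma expNi0 : expNi (0 : R) = 1.
Proof. by rewrite /expNi cos0 sin0 oppr0. Qed.

Lemma expNiN (s : R) : expNi (- s) = (expNi s)^*.
Proof. by rewrite /expNi cosN sinN. Qed.

Lemma expNipi : expNi (pi : R) = -1.
Proof. by rewrite /expNi cospi sinpi oppr0; apply/eqP; rewrite eq_complex /= oppr0 !eqxx. Qed.

Variable beta : R -> G.

Definition frequency_char h (mu : R) := character h /\ forall t, h (beta t) = expNi (mu * t).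

Lemma frequency_char1 : frequency_char (fun=> 1) 0.
Proof. by split; [exact: character1|move=> t; rewrite mul0r expNi0]. Qed.

Lemma frequency_charM h g mu nu : frequency_char h mu -> frequency_char g nu ->
  frequency_char (fun x => h x * g x) (mu + nu).
Proof.
move=> [ch fh] [cg fg]; split; first exact: characterM.
by move=> t; rewrite fh fg -expNiD mulrDl.
Qed.

Lemma frequency_char_conj h mu : frequency_char h mu ->
  frequency_char (fun x => (h x)^*) (- mu).
Proof.
move=> [ch fh]; split; first exact: character_conj.
by move=> t; rewrite fh -expNiN mulNr.
Qed.

Lemma frequency_charX h mu n : frequency_char h mu ->
  frequency_char (fun x => h x ^+ n) (n%:R * mu).
Proof.
move=> fh; elim: n => [|n IH]; first by rewrite mul0r; exact: frequency_char1.
under eq_fun do rewrite exprS.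
by rewrite -natr1 mulrDl mul1r addrC; exact: frequency_charM.
Qed.

Context {m : probability (borel G) R}.
Hypothesis cptG : compact [set: G].
Hypothesis haarm : haar_measure m.

Lemma cint_frequency_char h mu : frequency_char h mu -> mu != 0 -> cint (m := m) h = 0.
Proof.
(* At this point h takes the value -1. *)
move=> [ch fh] mu0; apply: (cint_character cptG haarm (a := beta (pi / mu))) => //.
rewrite fh mulrC divfK // expNipi eq_sym -subr_eq0 opprK.
by rewrite -[1 + 1]/(2%:R) pnatr_eq0.
Qed.

End Characters.

(** * Kronecker's theorem for prescribed signs *)

Section Kronecker.
Context {R : realType} {lambda : nat -> R} {G : topologicalZmodType} {beta : R -> G}
  {m : probability (borel G) R}.
Hypothesis cptG : compact [set: G].
Hypothesis haarm : haar_measure m.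
Hypothesis indep : Q_linearly_independent lambda.
Variable h : nat -> G -> R[i].
Hypothesis hE : forall n, frequency_char beta (h n) (lambda n).
Local Notation I := (haar_int (m := m)).
Local Notation cint := (cint (m := m)).

Definition Q_span N (mu : R) := exists c : nat -> rat, mu = \sum_(k < N) ratr (c k) * lambda k.

Lemma Q_span0 N : Q_span N 0.
Proof. by exists (fun=> 0); rewrite big1 // => k _; rewrite rmorph0 mul0r. Qed.

Lemma Q_spanD N mu nu : Q_span N mu -> Q_span N nu -> Q_span N (mu + nu).
Proof.
move=> [c ->] [d ->]; exists (fun k => c k + d k); rewrite -big_split /=.
by apply: eq_bigr => k _; rewrite rmorphD mulrDl.
Qed.

Lemma Q_spanZ N (q : rat) mu : Q_span N mu -> Q_span N (ratr q * mu).
Proof.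
move=> [c ->]; exists (fun k => q * c k); rewrite mulr_sumr.
by apply: eq_bigr => k _; rewrite rmorphM mulrA.
Qed.

Lemma Q_spanN N mu : Q_span N mu -> Q_span N (- mu).
Proof. by move=> /(Q_spanZ (-1)); rewrite rmorphN1 mulN1r. Qed.

Lemma Q_span_mem N k : (k < N)%N -> Q_span N (lambda k).
Proof.
move=> kN; exists (fun j => (j == k)%:R).
rewrite (bigD1 (Ordinal kN)) //= eqxx rmorph1 mul1r big1 ?addr0 // => j.
rewrite -val_eqE /= => /negPf ->; by rewrite rmorph0 mul0r.
Qed.

Lemma Q_spanS N mu : Q_span N mu -> Q_span N.+1 mu.
Proof.
move=> [c ->]; exists (fun k => if (k < N)%N then c k else 0).
rewrite big_ord_recr /= ltnn rmorph0 mul0r addr0.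
by apply: eq_bigr => k _; rewrite ltn_ord.
Qed.

Lemma Q_span_fresh N (q : rat) : Q_span N (ratr q * lambda N) -> q = 0.
Proof.
move=> [c E]; have := @indep N.+1 (fun k : 'I_N.+1 => if (k < N)%N then c k else - q).
move=> H; have {}H := fun Z => H Z ord_max; rewrite /= ltnn in H.
apply/eqP; rewrite -oppr_eq0; apply/eqP/H.
rewrite big_ord_recr /= ltnn rmorphN mulNr E; apply/eqP; rewrite subr_eq0; apply/eqP.
by apply: eq_bigr => k _; rewrite ltn_ord.
Qed.

(** The integral is the Fourier coefficient of u at the conjugate of g, of frequency - mu; as
    [Q_span] is symmetric, the conjugate can be left out. *)
Definition spectrum_in N (u : G -> R[i]) := ccont u /\
  forall g mu, frequency_char beta g mu -> ~ Q_span N mu -> cint (fun x => u x * g x) = 0.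

Lemma spectrum_in_mul N u g mu : spectrum_in N u -> frequency_char beta g mu -> Q_span N mu ->
  spectrum_in N (fun x => u x * g x).
Proof.
move=> [cu su] fg sm; split; first by apply: ccontM => //; apply: character_ccont; case: fg.
move=> g' mu' fg' smu'.
under eq_fun do rewrite -mulrA.
apply: (su _ (mu + mu')); first exact: frequency_charM.
move=> sD; apply: smu'; rewrite -(addKr mu mu'); apply: Q_spanD => //; exact: Q_spanN.
Qed.

Lemma spectrum_inS N u : spectrum_in N u -> spectrum_in N.+1 u.
Proof.
move=> [cu su]; split => // g mu fg nmu; apply: (su _ _ fg) => H; apply: nmu.
exact: Q_spanS.
Qed.

Lemma spectrum_inD N u v : spectrum_in N u -> spectrum_in N v -> spectrum_in N (fun x => u x + v x).
Proof.
move=> [cu su] [cv sv]; split; first exact: ccontD.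
move=> g mu fg nmu; under eq_fun do rewrite mulrDl.
have cg : ccont g by apply: character_ccont; case: fg.
rewrite (cintD cptG); [|exact: ccontM|exact: ccontM].
by rewrite (su _ _ fg) // (sv _ _ fg) // addr0.
Qed.

Lemma spectrum_inZ N z u : spectrum_in N u -> spectrum_in N (fun x => z * u x).
Proof.
move=> [cu su]; split; first by apply: ccontM => //; exact: ccont_cst.
move=> g mu fg nmu; under eq_fun do rewrite -mulrA.
have cg : ccont g by apply: character_ccont; case: fg.
by rewrite (cintZ cptG) ?(su _ _ fg) ?mulr0 //; exact: ccontM.
Qed.

Lemma spectrum_in_sum N n (u : 'I_n -> G -> R[i]) : (forall i, spectrum_in N (u i)) ->
  spectrum_in N (fun x => \sum_i u i x).
Proof.
move=> su; split; first by apply: (cint_sum cptG (m := m) _).1 => i; case: (su i).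
move=> g mu fg nmu; have cg : ccont g by apply: character_ccont; case: fg.
under eq_fun do rewrite mulr_suml.
rewrite (cint_sum cptG (h := fun i x => u i x * g x) _).2; last first.
  by move=> i; apply: ccontM => //; case: (su i).
by rewrite big1 // => i _; case: (su i) => _ /(_ _ _ fg nmu).
Qed.

Lemma spectrum_in1 : spectrum_in 0 (fun=> 1).
Proof.
split; first exact: ccont_cst.
move=> g mu fg nmu; under eq_fun do rewrite mul1r.
apply: (cint_frequency_char cptG haarm fg); apply/eqP => mu0; apply: nmu.
by rewrite mu0; exact: Q_span0.
Qed.

Variable eps : nat -> R.
Hypothesis eps2 : forall k, eps k ^+ 2 = 1.

(** Absorbing the sign turns the goal h k = eps k into z k = 1 for every k. *)
Let z k x : R[i] := (eps k)%:C%C * h k x.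

Let z_norm k x : `|z k x| = 1.
Proof.
rewrite /z normrM (char_norm1 (hE k).1) mulr1 normc_def /= expr0n /= addr0.
by rewrite eps2 sqrtr1.
Qed.

Let monomial k i j x : R[i] := z k x ^+ i * (z k x)^* ^+ j.

Let monomialE k i j : exists2 a : R[i], (i = j -> a = 1) &
  exists2 g, frequency_char beta g (ratr ((i%:R : rat) - j%:R) * lambda k) &
    monomial k i j = (fun x => a * g x) /\ (i = j -> g = fun=> 1).
Proof.
exists (((eps k)%:C%C) ^+ i * ((eps k)%:C%C) ^+ j).
  move=> ->; rewrite -exprMn -expr2 -rmorphXn /= eps2 expr1n //.
exists (fun x => h k x ^+ i * (h k x ^+ j)^*).
  rewrite rmorphB /= !ratr_nat mulrBl; apply: frequency_charM; first exact: frequency_charX.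
  by apply: frequency_char_conj; exact: frequency_charX.
split; last by move=> ->; apply/funext => x; exact: (character_mulJ x (characterX j (hE k).1)).
apply/funext => x; rewrite /monomial /z rmorphM /= !exprMn rmorphXn.
have -> : ((eps k)%:C%C)^* = (eps k)%:C%C by rewrite conj_Creal // complex_real.
by rewrite mulrACA.
Qed.

Variable M : nat.

Let P k x := \sum_(i < M.+1) z k x ^+ i.
Let F k x : R := (M.+1%:R)^-1 * ((complex.Re (P k x)) ^+ 2 + (complex.Im (P k x)) ^+ 2).

Let F_ge0 k x : 0 <= F k x.
Proof. by rewrite /F mulr_ge0 // addr_ge0 // sqr_ge0. Qed.

Let FE k x : (F k x)%:C%C = (M.+1%:R)^-1 * \sum_(i < M.+1) \sum_(j < M.+1) monomial k i j x.
Proof.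
rewrite /F rmorphM /= fmorphV rmorph_nat add_Re2_Im2 normCK; congr (_ * _).
rewrite /P rmorph_sum /= mulr_suml; apply: eq_bigr => i _.
by rewrite mulr_sumr; apply: eq_bigr => j _; rewrite rmorphXn.
Qed.

Let spectrum_monomial N k i j u : spectrum_in N u -> Q_span N (lambda k) ->
  spectrum_in N (fun x => u x * monomial k i j x).
Proof.
move=> su sk; have [a _ [g fg [-> _]]] := monomialE k i j.
under eq_fun do rewrite mulrCA.
apply: spectrum_inZ; apply: (spectrum_in_mul su fg); exact: Q_spanZ.
Qed.

Let spectrum_F N k u : spectrum_in N u -> Q_span N (lambda k) ->
  spectrum_in N (fun x => u x * (F k x)%:C%C).
Proof.
move=> su sk; under eq_fun do rewrite FE mulrCA mulr_sumr.
apply: spectrum_inZ; apply: (spectrum_in_sum (u := fun i x => u x * \sum_(j < M.+1) monomial k i j x)) => i.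
under eq_fun do rewrite mulr_sumr.
apply: (spectrum_in_sum (u := fun j x => u x * monomial k i j x)) => j.
exact: spectrum_monomial.
Qed.

(** An off-diagonal monomial has as frequency a nonzero rational multiple of [lambda N], outside the
    span of the earlier ones by independence, so it contributes 0. The M + 1 diagonal terms are
    constant 1 and cancel the normalisation. *)
Let cint_F N u : spectrum_in N u -> cint (fun x => u x * (F N x)%:C%C) = cint u.
Proof.
move=> su; have [cu su'] := su.
have cmon i j : ccont (fun x => u x * monomial N i j x).
  have [a _ [g fg [-> _]]] := monomialE N i j.
  by apply: ccontM => //; apply: ccontM; [exact: ccont_cst|apply: character_ccont; case: fg].
have E i j : cint (fun x => u x * monomial N i j x) = if i == j then cint u else 0.
  have [a a1 [g fg [-> g1]]] := monomialE N i j.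
  case: eqP => [ij|ij].
    by rewrite a1 // g1 //; congr cint; apply/funext => x; rewrite !mulr1.
  under eq_fun do rewrite mulrCA.
  have cg : ccont g by apply: character_ccont; case: fg.
  rewrite (cintZ cptG) ?(su' _ _ fg) ?mulr0 //; last exact: ccontM.
  move=> /Q_span_fresh /eqP; rewrite subr_eq0 eqr_nat => /eqP; exact: ij.
under eq_fun do rewrite FE mulrCA mulr_sumr.
have c1 (i : 'I_M.+1) := cint_sum cptG (m := m) (h := fun (j : 'I_M.+1) x => u x * monomial N i j x) (cmon i).
have c2 := cint_sum cptG (m := m) (h := fun (i : 'I_M.+1) x => \sum_(j < M.+1) u x * monomial N i j x) (fun i => (c1 i).1).
under eq_fun do under eq_bigr do rewrite mulr_sumr.
rewrite (cintZ cptG) //; last exact: c2.1.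
rewrite c2.2 (eq_bigr (fun=> cint u)).
  by rewrite sumr_const card_ord -[cint u *+ _]mulr_natl mulrA mulVf ?mul1r.
move=> i _; rewrite (c1 i).2 (bigD1 i) //= E eqxx big1 ?addr0 // => j.
by rewrite E -val_eqE eq_sym /= => /negPf ->.
Qed.

(** This is |1 - z k x|^2 in a form linear in z and its conjugate, so that its spectrum is
    visible. *)
Let d k x : R := 2 - 2 * eps k * complex.Re (h k x).

Let dE k x : (d k x)%:C%C = `|1 - z k x| ^+ 2.
Proof.
rewrite -add_Re2_Im2; congr (_%:C%C).
have := z_norm k x; rewrite normc_def => /(congr1 (@complex.Re R)) /= E.
have {E} : complex.Re (z k x) ^+ 2 + complex.Im (z k x) ^+ 2 = 1.
  by rewrite -[LHS]sqr_sqrtr ?addr_ge0 ?sqr_ge0 // E expr1n.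
have -> : d k x = 2 - 2 * complex.Re (z k x).
  by rewrite /d /z; case: (h k x) => a b /=; rewrite mul0r subr0 mulrA.
case: (z k x) => a b /= E; rewrite sub0r sqrrN; lra.
Qed.

Let d_ge0 k x : 0 <= d k x.
Proof. by rewrite -lecR dE exprn_ge0. Qed.

Let d_cont k : continuous (d k).
Proof.
have [cr _] := character_ccont (hE k).1.
move=> x; apply: cvgB; first exact: cvg_cst.
by apply: cvgM; [exact: cvg_cst|exact: cr].
Qed.

(* (1 - z)(1 + z + ... + z^M) = 1 - z^(M+1) has modulus at most 2 *)
Let dF_le k x : d k x * F k x <= 4 / M.+1%:R.
Proof.
rewrite -lecR rmorphM /= dE /F rmorphM /= add_Re2_Im2 fmorphV /= rmorphM /= fmorphV !rmorph_nat.
rewrite mulrCA -exprMn -normrM mulrC ler_wpM2r //.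
have -> : (1 - z k x) * P k x = 1 - z k x ^+ M.+1.
  by rewrite -[1 in RHS](expr1n _ M.+1) subrXX; congr (_ * _); apply: eq_bigr => i _; rewrite expr1n mul1r.
have H : `|1 - z k x ^+ M.+1| <= 2.
  by rewrite (le_trans (ler_normB _ _)) // normr1 normrX z_norm expr1n.
by rewrite (le_trans (lerXn2r 2 _ _ H)) ?nnegrE // -natrX.
Qed.

Let spectrum_d N k u : spectrum_in N u -> (k < N)%N ->
  spectrum_in N (fun x => u x * (d k x)%:C%C).
Proof.
move=> su kN; have [a a1 [g fg [Eg g1]]] := monomialE k 1 0.
have [b b1 [g' fg' [Eg' g1']]] := monomialE k 0 1.
have -> : (fun x => u x * (d k x)%:C%C) =
    fun x => 2 * u x + (-1 * (u x * monomial k 1 0 x) + -1 * (u x * monomial k 0 1 x)).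
  apply/funext => x; rewrite /d rmorphB rmorphM /= /monomial !expr0 !expr1 mulr1 mul1r.
  have -> : (2 * eps k)%:C%C * (complex.Re (h k x))%:C%C = z k x + (z k x)^*.
    have -> : z k x + (z k x)^* = (2 * complex.Re (z k x))%:C%C.
      by rewrite mulr_natl rmorphMn /= -mulr_natl; exact: addcJ.
    rewrite -rmorphM /=; congr (_%:C%C); rewrite /z -mulrA; congr (_ * _).
    by case: (h k x) => ? ? /=; rewrite mul0r subr0.
  by rewrite rmorph_nat; ring.
apply: spectrum_inD; first exact: spectrum_inZ.
by apply: spectrum_inD; apply: spectrum_inZ; apply: spectrum_monomial => //; exact: Q_span_mem.
Qed.

Let F_cont k : continuous (F k).
Proof.
have [c1 c2] : ccont (P k).
  apply: (cint_sum cptG (m := m) (h := fun (i : 'I_M.+1) x => z k x ^+ i) _).1 => i.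
  have -> : (fun x => z k x ^+ i) = fun x => ((eps k)%:C%C) ^+ i * h k x ^+ i.
    by apply/funext => x; rewrite /z exprMn.
  apply: ccontM; first exact: ccont_cst.
  by apply: character_ccont; apply: characterX; exact: (hE k).1.
have c11 := continuousM c1 c1; have c22 := continuousM c2 c2.
move=> x; apply: cvgM; first exact: cvg_cst.
by apply: cvgD; [exact: c11|exact: c22].
Qed.

(* Riesz product of the Fejér kernels of [z k], k < N: by independence of the
   frequencies, multiplying by [F N] does not change integrals of functions with
   spectrum in the span of the first N frequencies. *)
Let kernel N : exists Q : G -> R, [/\ continuous Q, forall x, 0 <= Q x, I Q = 1,
  spectrum_in N (fun x => (Q x)%:C%C) &
  forall k, (k < N)%N -> I (fun x => Q x * d k x) <= 4 / M.+1%:R].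
Proof.
elim: N => [|N [Q [cQ Q0 IQ sQ dQ]]].
  exists (fun=> 1); split => //; [exact: cst_continuous|exact: haar_int_cst|exact: spectrum_in1].
have IF u : spectrum_in N (fun x => (u x)%:C%C) -> I (fun x => u x * F N x) = I u.
  move=> su; apply/(@complexI R); rewrite -!cint_real -[RHS](cint_F su); congr cint.
  by apply/funext => x; rewrite rmorphM.
exists (fun x => Q x * F N x); split.
- by apply: continuousM.
- by move=> x; rewrite mulr_ge0.
- by rewrite IF.
- under eq_fun do rewrite rmorphM /=.
  by apply: spectrum_F; [exact: spectrum_inS|exact: Q_span_mem].
(* For k = N the pointwise bound [dF_le] is averaged against the density Q. For k < N the function Q
   * d k has its spectrum in the span of the first N frequencies, so the new factor F N leaves its
   integral unchanged. *)
move=> k; rewrite ltnS leq_eqVlt => /orP[/eqP ->|kN].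
  rewrite -[leRHS]mulr1 -[X in _ <= _ * X]IQ -haar_intZ //; apply: haar_int_le => //.
  - by apply: continuousM => //; apply: continuousM.
  - by apply: continuousM => //; exact: cst_continuous.
  - move=> x; rewrite (_ : Q x * F N x * d N x = d N x * F N x * Q x); last by ring.
    by apply: ler_wpM2r.
rewrite (_ : (fun x => _) = fun x => (Q x * d k x) * F N x); last first.
  by apply/funext => x; rewrite mulrAC.
rewrite IF ?dQ //; under eq_fun do rewrite rmorphM /=.
exact: spectrum_d.
Qed.

(** The average of the sum against the probability density given by [kernel] is at most 4 N / (M +
    1), so the sum cannot be at least c everywhere. *)
Let d_small N c : 4 * N%:R / M.+1%:R < c -> exists a, \sum_(k < N) d k a < c.
Proof.
move=> Hc; apply: contrapT => nex.
have ge x : c <= \sum_(k < N) d k x by rewrite leNgt; apply/negP => H; apply: nex; exists x.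
have [Q [cQ Q0 IQ sQ dQ]] := kernel N.
have [cS ES] := functional_sum (enum 'I_N) (fun=> 1) (haar_int_functional cptG (m := m))
  (F := fun k x => Q x * d k x) (fun k => continuousM cQ (d_cont (k := k))).
have : c <= I (fun x => \sum_(k <- enum 'I_N) Q x * d k x * 1).
  rewrite -[leLHS]mulr1 -[X in _ * X <= _]IQ -haar_intZ //; apply: haar_int_le => //.
    by apply: continuousM => //; exact: cst_continuous.
  move=> x; rewrite mulrC big_enum /=.
  under eq_bigr do rewrite mulr1.
  by rewrite -mulr_sumr ler_wpM2l.
rewrite ES leNgt => /negP; apply; apply: le_lt_trans Hc.
rewrite big_enum /=; under eq_bigr do rewrite mulr1.
have H : \sum_(k < N) I (fun x => Q x * d k x) <= \sum_(k < N) 4 / M.+1%:R.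
  by apply: ler_sum => k _; exact: dQ.
by rewrite (le_trans H) // sumr_const card_ord -[_ *+ N]mulr_natr mulrAC.
Qed.

Lemma Fejer_small N c : 4 * N%:R / M.+1%:R < c ->
  exists a, \sum_(k < N) (2 - 2 * eps k * complex.Re (h k a)) < c.
Proof. exact: d_small. Qed.

Lemma sign_distance k x : 0 <= 2 - 2 * eps k * complex.Re (h k x) /\
  (2 - 2 * eps k * complex.Re (h k x) = 0 -> h k x = (eps k)%:C%C).
Proof.
split; first exact: d_ge0.
move=> d0; have := dE k x; rewrite /d d0 => /esym/eqP.
rewrite sqrf_eq0 normr_eq0 subr_eq0 => /eqP E.
have -> : h k x = (eps k)%:C%C * z k x by rewrite /z mulrA -rmorphM /= -expr2 eps2 mul1r.
by rewrite -E mulr1.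
Qed.

End Kronecker.

Section KroneckerExact.
Context {R : realType} {lambda : nat -> R} {G : topologicalZmodType} {beta : R -> G}
  {m : probability (borel G) R}.
Hypothesis cptG : compact [set: G].
Hypothesis haarm : haar_measure m.
Hypothesis indep : Q_linearly_independent lambda.
Variable h : nat -> G -> R[i].
Hypothesis hE : forall n, frequency_char beta (h n) (lambda n).

(** Points that are good for the first N signs up to 1 / (N + 1) have a cluster point in G;
    continuity makes every sign exact there. *)
Lemma Kronecker_signs (eps : nat -> R) : (forall k, eps k ^+ 2 = 1) ->
  exists a, forall k, h k a = (eps k)%:C%C.
Proof.
move=> eps2.
pose d k x : R := 2 - 2 * eps k * complex.Re (h k x).
have d_ge0 k x : 0 <= d k x := (sign_distance hE eps2 k x).1.
have step N : exists a, \sum_(k < N) d k a < N.+1%:R^-1.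
  (* This degree M makes 4 N / (M + 1) smaller than 1 / (N + 1). *)
  apply: (Fejer_small cptG haarm indep hE eps2 (M := 4 * N * N.+1)).
  rewrite -natrM ltr_pdivrMr // mulrC ltr_pdivlMr // -natrM ltr_nat.
  by [].
have [a Ha] := choice step.
have small N k : (k < N)%N -> d k (a N) < N.+1%:R^-1.
  move=> kN; apply: le_lt_trans (Ha N).
  rewrite (bigD1 (Ordinal kN)) //= lerDl; exact: sumr_ge0.
have [x [_ Hx]] : [set: G] `&` cluster (a n @[n --> \oo]) !=set0.
  by apply: cptG; exact: filterT.
exists x => k; apply: (sign_distance hE eps2 k x).2.
apply/eqP; rewrite eq_le d_ge0 andbT leNgt; apply/negP => dx.
have cd : continuous (d k).
  have [cr _] := character_ccont (hE k).1.
  move=> y; apply: cvgB; first exact: cvg_cst.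
  by apply: cvgM; [exact: cvg_cst|exact: cr].
have d2 : 0 < d k x / 2 by rewrite divr_gt0.
have n1 : nbhs x [set y | d k x / 2 < d k y].
  have := cd x; move/cvgrPdist_lt => /(_ _ d2); apply: filterS => y /=.
  by rewrite ltr_norml => /andP[_]; lra.
have n2 : (a n @[n --> \oo]) [set y | d k y < d k x / 2].
  have /cvgrPdist_lt /(_ _ d2) [N _ HN] := @cvg_harmonic R.
  exists (maxn N k.+1) => // n /=; rewrite geq_max => /andP[Nn kn].
  apply: lt_trans (small _ _ kn) _.
  by have := HN n Nn; rewrite /= sub0r normrN ger0_norm.
have [y [/= y1 y2]] := Hx _ _ n2 n1.
by have := lt_trans y1 y2; rewrite ltxx.
Qed.

End KroneckerExact.

(** * Bochner integral *)

Section ComplexNorm.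
Context {R : realType} {V : normedModType R[i]}.
Implicit Types x y : V.

Lemma rnormE x : `|x| = (rnorm x)%:C%C.
Proof. by rewrite /rnorm RRe_real // ger0_real. Qed.

Lemma rnorm_ge0 x : 0 <= rnorm x.
Proof. by rewrite -ler0c -rnormE. Qed.

Lemma rnormD x y : rnorm (x + y) <= rnorm x + rnorm y.
Proof. by rewrite -lecR rmorphD /= -!rnormE ler_normD. Qed.

Lemma rnormN x : rnorm (- x) = rnorm x.
Proof. by rewrite /rnorm normrN. Qed.

Lemma rnormBC x y : rnorm (x - y) = rnorm (y - x).
Proof. by rewrite -rnormN opprB. Qed.

Lemma rnorm_triangle z x y : rnorm (x - y) <= rnorm (x - z) + rnorm (z - y).
Proof. by rewrite (le_trans _ (rnormD _ _)) // addrA subrK. Qed.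

Lemma rnorm0 : rnorm (0 : V) = 0.
Proof. by rewrite /rnorm normr0. Qed.

Lemma rnorm_eq0 x : rnorm x = 0 -> x = 0.
Proof. by move=> x0; apply/normr0_eq0; rewrite rnormE x0. Qed.

Lemma rnormZ z x : rnorm (z *: x) = complex.Re `|z| * rnorm x.
Proof.
by apply/(@complexI R); rewrite rmorphM /= -!rnormE normrZ.
Qed.

Lemma rnormZr (a : R) x : rnorm (a%:C%C *: x) = `|a| * rnorm x.
Proof. by rewrite rnormZ normc_def /= expr0n addr0 sqrtr_sqr. Qed.

Lemma rnormZ1 z x : `|z| = 1 -> rnorm (z *: x) = rnorm x.
Proof. by move=> z1; rewrite rnormZ z1 mul1r. Qed.

Lemma rnorm_dist x y : `|rnorm x - rnorm y| <= rnorm (x - y).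
Proof.
have h1 := rnormD (x - y) y; have h2 := rnormD (y - x) x.
rewrite subrK in h1; rewrite subrK in h2; rewrite rnormBC in h2.
by rewrite ler_norml; apply/andP; split; lra.
Qed.

Lemma rnorm_sum (T : Type) (l : seq T) (F : T -> V) :
  rnorm (\sum_(i <- l) F i) <= \sum_(i <- l) rnorm (F i).
Proof.
elim: l => [|a l IH]; first by rewrite !big_nil rnorm0.
by rewrite !big_cons (le_trans (rnormD _ _)) // lerD2l.
Qed.

Lemma cvg_rnorm (T : Type) (F : set_system T) (FF : Filter F) (f : T -> V) l :
  (f x @[x --> F] --> l) <-> (rnorm (f x - l) @[x --> F] --> (0 : R)).
Proof.
split.
  move=> /cvgrPdist_lt H; apply/cvgrPdist_lt => e e0.
  have e0' : 0 < e%:C%C by rewrite ltcR.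
  apply: filterS (H _ e0') => x; rewrite rnormE ltcR sub0r normrN rnormBC ger0_norm //.
  exact: rnorm_ge0.
move=> /cvgrPdist_lt H; apply/cvgrPdist_lt => e /complex_gt0[d d0 ->].
apply: filterS (H _ d0) => x; rewrite rnormE ltcR sub0r normrN rnormBC ger0_norm //.
exact: rnorm_ge0.
Qed.

End ComplexNorm.

Section NonmeasurableIntegrand.
Import HBNNSimple.
Context {d} {T : measurableType d} {R : realType} {mu : {measure set T -> \bar R}}.
Implicit Types f g : T -> \bar R.
Local Open Scope ereal_scope.

(* The integral of a nonnegative function is a supremum over simple functions, so
   it is monotone without measurability; this matters because the measure need
   not be complete and the a.e. strongly measurable f need not be measurable. *)
Lemma ge0_le_integral_nonmeasurable f g : (forall x, 0 <= f x) -> (forall x, f x <= g x) ->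
  \int[mu]_x f x <= \int[mu]_x g x.
Proof.
move=> f0 fg; have g0 x : 0 <= g x by exact: le_trans (f0 x) (fg x).
rewrite !ge0_integralTE //; apply: le_ereal_sup => _ [h /= hf <-].
by exists h => //= x; exact: le_trans (hf x) (fg x).
Qed.

(** Only simple functions below f are compared with g, and those are measurable. *)
Lemma ae_ge0_le_integral_nonmeasurable_l f g : (forall x, 0 <= f x) -> (forall x, 0 <= g x) ->
  measurable_fun setT g -> {ae mu, forall x, f x <= g x} ->
  \int[mu]_x f x <= \int[mu]_x g x.
Proof.
move=> f0 g0 mg fg; rewrite (ge0_integralTE mu f0); apply: ge_ereal_sup => _ [h /= hf <-].
rewrite -integralT_nnsfun; apply: ae_ge0_le_integral => //.
- by move=> x _; rewrite lee_fin; exact: fun_ge0.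
- by apply/measurable_EFinP.
- apply: filterS fg => x fgx _; exact: le_trans (hf x) fgx.
Qed.

(** Setting f to 0 on a measurable null set that contains the exceptional points does not change its
    integral and makes the inequality hold everywhere. *)
Lemma ae_ge0_le_integral_nonmeasurable_r f g : (forall x, 0 <= f x) -> (forall x, 0 <= g x) ->
  measurable_fun setT f -> {ae mu, forall x, f x <= g x} ->
  \int[mu]_x f x <= \int[mu]_x g x.
Proof.
move=> f0 g0 mf [N [mN N0 HN]].
pose f' x := if x \in N then 0 else f x.
have mf' : measurable_fun setT f'.
  apply: measurable_fun_ifT => //; first exact: (finite_range_measurable_fun id (finite_range_indic mN)).
rewrite (le_trans (y := \int[mu]_x f' x)) //.
  apply: ae_ge0_le_integral => //.
    by move=> x _; rewrite /f'; case: ifP.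
  exists N; split => // x /= H; apply: contrapT => nN; apply: H => _.
  by rewrite /f' memNset.
apply: ge0_le_integral_nonmeasurable => x; rewrite /f'; case: ifPn => //.
rewrite notin_setE => nN; apply: contrapT => H; apply: nN; exact: HN.
Qed.

Lemma ae_ge0_eq_integral_nonmeasurable f g : (forall x, 0 <= f x) -> (forall x, 0 <= g x) ->
  measurable_fun setT g -> {ae mu, forall x, f x = g x} ->
  \int[mu]_x f x = \int[mu]_x g x.
Proof.
move=> f0 g0 mg fg; apply/eqP; rewrite eq_le; apply/andP; split.
  by apply: ae_ge0_le_integral_nonmeasurable_l => //; apply: filterS fg => x ->.
by apply: ae_ge0_le_integral_nonmeasurable_r => //; apply: filterS fg => x ->.
Qed.

End NonmeasurableIntegrand.

Section BochnerTheory.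
Context {d} {T : measurableType d} {R : realType} {P : probability T R}.
Context {X : completeNormedModType R[i]}.
Implicit Types f g s : T -> X.

Lemma cvg0D (u v : nat -> R) : u n @[n --> \oo] --> 0 -> v n @[n --> \oo] --> 0 ->
  u n + v n @[n --> \oo] --> 0.
Proof. by move=> hu hv; rewrite -(addr0 0); apply: cvgD. Qed.

Lemma cvg0Z a (u : nat -> R) : u n @[n --> \oo] --> 0 -> a * u n @[n --> \oo] --> 0.
Proof. by move=> hu; rewrite -(mulr0 a); apply: cvgM => //; exact: cvg_cst. Qed.

Lemma cvge0D (u v : nat -> \bar R) : u n @[n --> \oo] --> 0%E -> v n @[n --> \oo] --> 0%E ->
  (u n + v n)%E @[n --> \oo] --> 0%E.
Proof. by move=> hu hv; rewrite -[X in _ --> X]adde0; apply: cvgeD. Qed.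

Lemma cvge0Z (a : R) (u : nat -> \bar R) : u n @[n --> \oo] --> 0%E ->
  (a%:E * u n)%E @[n --> \oo] --> 0%E.
Proof. by move=> hu; rewrite -(mule0 a%:E); apply: cvgeZl. Qed.

Lemma cvg0_le (u v : nat -> R) : (forall n, 0 <= u n <= v n) ->
  v n @[n --> \oo] --> 0 -> u n @[n --> \oo] --> 0.
Proof.
move=> uv; apply: (squeeze_cvgr (f := fun=> 0)); first exact: nearW.
exact: cvg_cst.
Qed.

Lemma cvge0_le (u v : nat -> \bar R) : (forall n, (0 <= u n <= v n)%E) ->
  v n @[n --> \oo] --> 0%E -> u n @[n --> \oo] --> 0%E.
Proof.
move=> uv; apply: (squeeze_cvge (f := fun=> 0%E)); first exact: nearW.
exact: cvg_cst.
Qed.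

(* Limits everywhere, and not a.e., of simple functions: these are stable under
   composition with translations and have measurable norm. *)
Definition simple_limit f := exists s_ : nat -> T -> X,
  (forall n, finite_range (s_ n)) /\ forall x, rnorm (s_ n x - f x) @[n --> \oo] --> (0 : R).

Lemma simple_limit_finite_range s : finite_range s -> simple_limit s.
Proof.
move=> fs; exists (fun=> s); split => // x.
rewrite subrr rnorm0; exact: cvg_cst.
Qed.

Lemma simple_limitD f g : simple_limit f -> simple_limit g -> simple_limit (fun x => f x + g x).
Proof.
move=> [s_ [fs Hs]] [t_ [ft Ht]]; exists (fun n x => s_ n x + t_ n x); split.
  move=> n; exact: (finite_range_comp (fun z : X * X => z.1 + z.2) (finite_range_pair (fs n) (ft n))).
move=> x; apply: (cvg0_le _ (cvg0D (Hs x) (Ht x))) => n.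
by rewrite rnorm_ge0 /= opprD addrACA rnormD.
Qed.

Lemma simple_limitZ z f : simple_limit f -> simple_limit (fun x => z *: f x).
Proof.
move=> [s_ [fs Hs]]; exists (fun n x => z *: s_ n x); split.
  by move=> n; exact: (finite_range_comp (fun v : X => z *: v) (fs n)).
move=> x; under eq_fun do rewrite -scalerBr rnormZ.
by apply: cvg0Z; exact: Hs.
Qed.

Lemma simple_limitB f g : simple_limit f -> simple_limit g -> simple_limit (fun x => f x - g x).
Proof.
move=> sf sg; under eq_fun do rewrite -scaleN1r.
by apply: simple_limitD => //; exact: simple_limitZ.
Qed.

Lemma simple_limit_cst v : simple_limit (fun=> v).
Proof. by apply: simple_limit_finite_range; exact: finite_range_cst. Qed.

Lemma simple_limit_comp d' (T' : measurableType d') (a : T' -> T) f :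
  measurable_fun setT a -> simple_limit f ->
  exists s_ : nat -> T' -> X, (forall n, finite_range (s_ n)) /\
    forall x, rnorm (s_ n x - f (a x)) @[n --> \oo] --> (0 : R).
Proof.
move=> ma [s_ [fs Hs]]; exists (fun n => s_ n \o a); split; last by move=> x; exact: Hs.
move=> n; split.
  by apply: sub_finite_set (fs n).1 => _ [x _ <-]; exists (a x).
move=> v; rewrite comp_preimage -[X in measurable X]setTI; apply: ma => //.
exact: (fs n).2.
Qed.

Lemma simple_limit_rnorm f : simple_limit f -> measurable_fun setT (fun x => rnorm (f x)).
Proof.
move=> [s_ [fs Hs]]; apply: (measurable_fun_cvg (h := fun n x => rnorm (s_ n x))).
  by move=> n; exact: (finite_range_measurable_fun (@rnorm R X) (fs n)).
move=> x _; apply/cvgrPdist_lt => e e0; have /cvgrPdist_lt /(_ _ e0) := Hs x.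
apply: filterS => n; rewrite sub0r normrN ger0_norm ?rnorm_ge0 // => H.
by rewrite (le_lt_trans (rnorm_dist _ _)) // rnormBC.
Qed.

Lemma simple_limit_rnormE f : simple_limit f -> measurable_fun setT (fun x => (rnorm (f x))%:E).
Proof. by move=> sf; apply/measurable_EFinP; exact: simple_limit_rnorm. Qed.

Definition L1norm f : \bar R := (\int[P]_x (rnorm (f x))%:E)%E.

Lemma L1norm_ge0 f : (0 <= L1norm f)%E.
Proof. by apply: integral_ge0 => x _; rewrite lee_fin rnorm_ge0. Qed.

Lemma L1norm_le f (g : T -> R) : simple_limit f -> measurable_fun setT g ->
  (forall x, rnorm (f x) <= g x) -> (L1norm f <= \int[P]_x (g x)%:E)%E.
Proof.
move=> sf mg fg; apply: ge0_le_integral => //.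
- by move=> x _; rewrite lee_fin rnorm_ge0.
- exact: simple_limit_rnormE.
- by apply/measurable_EFinP.
- by move=> x _; rewrite lee_fin.
Qed.

Lemma L1norm_sup f (M : R) : simple_limit f -> (forall x, rnorm (f x) <= M) ->
  (L1norm f <= M%:E)%E.
Proof.
move=> sf fM; apply: le_trans (L1norm_le sf (measurable_cst M) fM) _.
by rewrite (integral_cst P measurableT M%:E) /= probability_setT mule1.
Qed.

Lemma L1normD f g : simple_limit f -> simple_limit g ->
  (L1norm (fun x => f x + g x)%R <= L1norm f + L1norm g)%E.
Proof.
move=> sf sg; have mf := simple_limit_rnormE sf; have mg := simple_limit_rnormE sg.
rewrite /L1norm -ge0_integralD //; try by move=> x _; rewrite lee_fin rnorm_ge0.
apply: ge0_le_integral => //.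
- by move=> x _; rewrite lee_fin rnorm_ge0.
- by apply: simple_limit_rnormE; exact: simple_limitD.
- exact: emeasurable_funD.
- by move=> x _; rewrite -EFinD lee_fin rnormD.
Qed.

Lemma L1normBC f g : L1norm (fun x => f x - g x) = L1norm (fun x => g x - f x).
Proof. by apply: eq_integral => x _; rewrite rnormBC. Qed.

Lemma L1norm_triangle f g h : simple_limit f -> simple_limit g -> simple_limit h ->
  (L1norm (fun x => f x - h x)%R <=
   L1norm (fun x => f x - g x)%R + L1norm (fun x => g x - h x)%R)%E.
Proof.
move=> sf sg sh.
have := L1normD (simple_limitB sf sg) (simple_limitB sg sh).
by under [in X in (X <= _)%E]eq_fun do rewrite addrA subrK.
Qed.

Lemma L1normZ z f : simple_limit f ->
  L1norm (fun x => z *: f x) = ((complex.Re `|z|)%:E * L1norm f)%E.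
Proof.
move=> sf; rewrite /L1norm -ge0_integralZl //.
- by apply: eq_integral => x _; rewrite rnormZ EFinM.
- exact: simple_limit_rnormE.
- by move=> x _; rewrite lee_fin rnorm_ge0.
- by rewrite lee_fin; have := rnorm_ge0 (z : R[i]^o).
Qed.

Lemma simple_integralD s t : finite_range s -> finite_range t ->
  simple_integral P (fun x => s x + t x) = simple_integral P s + simple_integral P t.
Proof.
move=> fs ft; have fst := finite_range_pair fs ft.
rewrite (simple_integral_comp (fun z : X * X => z.1 + z.2) fst).
rewrite (simple_integral_comp (fun z : X * X => z.1) fst).
rewrite (simple_integral_comp (fun z : X * X => z.2) fst).
by rewrite -big_split /=; apply: eq_bigr => z _; rewrite scalerDr.
Qed.

Lemma simple_integralZ a s : finite_range s ->
  simple_integral P (fun x => a *: s x) = a *: simple_integral P s.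
Proof.
move=> fs; rewrite (simple_integral_comp (fun z => a *: z) fs) (simple_integral_comp id fs).
by rewrite scaler_sumr; apply: eq_bigr => v _; rewrite !scalerA mulrC.
Qed.

Lemma simple_integral_bound s : finite_range s ->
  ((rnorm (simple_integral P s))%:E <= L1norm s)%E.
Proof.
move=> fs; have [i1 E] := finite_range_Rintegral (P := P) (@rnorm R X) fs.
have -> : L1norm s = (\int[P]_x rnorm (s x))%:E.
  by rewrite /L1norm /Rintegral fineK //; exact: integrable_fin_num i1.
rewrite lee_fin E (simple_integral_comp id fs) (le_trans (rnorm_sum _ _)) //.
by apply: ler_sum => v _; rewrite rnormZr mulrC ger0_norm // fine_ge0.
Qed.

(** Counterpart of [is_bochner_integral] for everywhere limits, where all norms are measurable;
    [bochner_integralE] links the two. *)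
Definition has_bochner_integral f v := simple_limit f /\ exists s_ : nat -> T -> X,
  [/\ forall n, finite_range (s_ n),
      L1norm (fun x => f x - s_ n x) @[n --> \oo] --> 0%E &
      rnorm (simple_integral P (s_ n) - v) @[n --> \oo] --> (0 : R)].

Lemma has_bochner_integralD f g v w : has_bochner_integral f v -> has_bochner_integral g w ->
  has_bochner_integral (fun x => f x + g x) (v + w).
Proof.
move=> [sf [s_ [fs sf0 sv]]] [sg [t_ [ft tg0 tw]]]; split; first exact: simple_limitD.
exists (fun n x => s_ n x + t_ n x); split.
- move=> n; exact: (finite_range_comp (fun z : X * X => z.1 + z.2) (finite_range_pair (fs n) (ft n))).
- apply: (cvge0_le _ (cvge0D sf0 tg0)) => n; rewrite L1norm_ge0 /=.
  have := L1normD (simple_limitB sf (simple_limit_finite_range (fs n)))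
    (simple_limitB sg (simple_limit_finite_range (ft n))).
  by under [in X in (X <= _)%E -> _]eq_fun do rewrite addrACA -opprD.
- apply: (cvg0_le _ (cvg0D sv tw)) => n.
  by rewrite rnorm_ge0 /= simple_integralD // opprD addrACA rnormD.
Qed.

Lemma has_bochner_integralZ z f v : has_bochner_integral f v ->
  has_bochner_integral (fun x => z *: f x) (z *: v).
Proof.
move=> [sf [s_ [fs sf0 sv]]]; split; first exact: simple_limitZ.
exists (fun n x => z *: s_ n x); split.
- by move=> n; exact: (finite_range_comp (fun v : X => z *: v) (fs n)).
- have -> : (fun n => L1norm (fun x => z *: f x - z *: s_ n x)) =
      (fun n => (complex.Re `|z|)%:E * L1norm (fun x => f x - s_ n x)%R)%E.
    apply/funext => n; under eq_fun do rewrite -scalerBr.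
    by rewrite L1normZ //; apply: simple_limitB => //; exact: simple_limit_finite_range.
  exact: cvge0Z.
- under eq_fun do rewrite simple_integralZ // -scalerBr rnormZ.
  exact: cvg0Z.
Qed.

Lemma has_bochner_integral_bound f v : has_bochner_integral f v ->
  ((rnorm v)%:E <= L1norm f)%E.
Proof.
move=> [sf [s_ [fs sf0 sv]]].
have H : (L1norm f + L1norm (fun x => f x - s_ n x)%R + (rnorm (simple_integral P (s_ n) - v))%:E)%E
    @[n --> \oo] --> (L1norm f + 0 + 0)%E.
  apply: cvgeD; first by rewrite adde0 fin_num_adde_defl.
    apply: cvgeD; [by rewrite fin_num_adde_defl|exact: cvg_cst|exact: sf0].
  by apply: cvg_EFin => //; exact: nearW.
have := H; rewrite !adde0 => {}H.
apply: (cvge_to_ge H); apply: nearW => n.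
have h1 : (rnorm v <= rnorm (simple_integral P (s_ n)) + rnorm (simple_integral P (s_ n) - v))%R.
  by rewrite rnormBC (le_trans _ (rnormD _ _)) // addrC subrK.
rewrite (le_trans (y := ((rnorm (simple_integral P (s_ n)))%:E + (rnorm (simple_integral P (s_ n) - v))%:E)%E)) //.
rewrite leeD2r // (le_trans (simple_integral_bound (fs n))) //.
have := L1normD sf (simple_limitB (simple_limit_finite_range (fs n)) sf).
rewrite (L1normBC f).
by under [in X in (X <= _)%E -> _]eq_fun do rewrite addrC subrK.
Qed.

Lemma has_bochner_integral_unique f v w :
  has_bochner_integral f v -> has_bochner_integral f w -> v = w.
Proof.
move=> fv fw; apply/eqP; rewrite -subr_eq0; apply/eqP/rnorm_eq0/eqP.
rewrite eq_le rnorm_ge0 andbT -lee_fin.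
have := has_bochner_integralD fv (has_bochner_integralZ (-1) fw).
rewrite scaleN1r => /has_bochner_integral_bound /le_trans; apply.
rewrite /L1norm integral0_eq // => x _; by rewrite scaleN1r subrr rnorm0.
Qed.

Lemma has_bochner_integral_sub f g v w : has_bochner_integral f v -> has_bochner_integral g w ->
  ((rnorm (v - w))%:E <= L1norm (fun x => f x - g x)%R)%E.
Proof.
move=> fv gw; have := has_bochner_integralD fv (has_bochner_integralZ (-1) gw).
rewrite scaleN1r => /has_bochner_integral_bound.
by under [in X in (_ <= X)%E -> _]eq_fun do rewrite scaleN1r.
Qed.

Lemma has_bochner_integral_ex f : simple_limit f -> (L1norm f < +oo)%E ->
  exists v, has_bochner_integral f v.
Proof.
move=> sf Lf; have [t_ [ft tf]] := sf.
(* Truncating t_ n to B n gives the dominating function 3 |f|. The factor 2 leaves room for t_ n x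
   to qualify eventually where f x is nonzero; where f x = 0 the truncated values are 0. *)
pose B n := [set x | rnorm (t_ n x) <= 2 * rnorm (f x)].
have mB n : measurable (B n).
  rewrite [X in measurable X](_ : _ = (fun x => 2 * rnorm (f x) - rnorm (t_ n x)) @^-1` `[0, +oo[%classic).
    rewrite -[X in measurable X]setTI; apply: measurable_funB => //; last first.
      exact: (finite_range_measurable_fun (@rnorm R X) (ft n)).
    apply: measurable_funM; first exact: measurable_cst.
    exact: simple_limit_rnorm.
  by apply/seteqP; split => x /=; rewrite in_itv /= andbT subr_ge0.
pose s_ n x := if x \in B n then t_ n x else 0.
have fs n : finite_range (s_ n).
  exact: (finite_range_comp (fun z : bool * X => if z.1 then z.2 else 0)
    (finite_range_pair (finite_range_indic (mB n)) (ft n))).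
have s_le n x : rnorm (s_ n x) <= 2 * rnorm (f x).
  rewrite /s_; case: ifPn => [/set_mem //|_].
  by rewrite rnorm0 mulr_ge0 // rnorm_ge0.
have s_cvg x : rnorm (f x - s_ n x) @[n --> \oo] --> 0.
  apply/cvgrPdist_lt => e e0.
  have [f0|f0] := eqVneq (rnorm (f x)) 0.
    apply: nearW => n; rewrite sub0r normrN ger0_norm ?rnorm_ge0 //.
    have /rnorm_eq0 -> : rnorm (s_ n x) = 0.
      by apply/eqP; rewrite eq_le rnorm_ge0 (le_trans (s_le n x)) // f0 mulr0.
    by rewrite subr0 f0.
  have fp : 0 < rnorm (f x) by rewrite lt_def f0 rnorm_ge0.
  have /cvgrPdist_lt H := tf x.
  near=> n; rewrite sub0r normrN ger0_norm ?rnorm_ge0 //.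
  have h1 : rnorm (t_ n x - f x) < rnorm (f x).
    rewrite -[ltLHS]ger0_norm ?rnorm_ge0 // -normrN -sub0r.
    by near: n; exact: H.
  have h2 : rnorm (t_ n x - f x) < e.
    rewrite -[ltLHS]ger0_norm ?rnorm_ge0 // -normrN -sub0r.
    by near: n; exact: H.
  rewrite /s_ mem_set; first by rewrite rnormBC.
  by rewrite /B /=; have := rnormD (t_ n x - f x) (f x); rewrite subrK; lra.
have L1s : L1norm (fun x => f x - s_ n x) @[n --> \oo] --> 0%E.
  have -> : 0%E = (\int[P]_x (cst 0%E x))%E :> \bar R by rewrite integral0.
  apply: (@dominated_cvg _ _ _ P setT measurableT _ _ (fun x => (3 * rnorm (f x))%:E)) => //.
  - move=> n; apply: simple_limit_rnormE; apply: simple_limitB => //.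
    exact: simple_limit_finite_range.
  - by move=> x _; apply: cvg_EFin; [exact: nearW|exact: s_cvg].
  - apply/integrableP; split.
      by apply/measurable_EFinP; apply: measurable_funM => //; exact: simple_limit_rnorm.
    under eq_integral do rewrite abse_EFin ger0_norm ?mulr_ge0 ?rnorm_ge0 // EFinM.
    rewrite ge0_integralZl //; first exact: lte_mul_pinfty.
    + exact: simple_limit_rnormE.
    + by move=> x _; rewrite lee_fin rnorm_ge0.
  - move=> n x _; rewrite abse_EFin lee_fin ger0_norm ?rnorm_ge0 //.
    rewrite (le_trans (rnormD _ _)) // rnormN.
    have := s_le n x; lra.
have [v Hv] : exists v, rnorm (simple_integral P (s_ n) - v) @[n --> \oo] --> 0.
  have : cvg (simple_integral P (s_ n) @[n --> \oo]).
    apply/cauchy_cvgP/cauchy_exP => e /complex_gt0[c c0 ->].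
    have c2 : 0 < c / 2 by rewrite divr_gt0.
    have c2E : (0 < (c / 2)%:E)%E by rewrite lte_fin.
    have := L1s; move/fine_cvgP => [fin_s /cvgrPdist_lt /(_ _ c2) Hs].
    have [N _ HN] := filterI fin_s Hs.
    exists (simple_integral P (s_ N)); exists N => // n /= Nn.
    rewrite -ball_normE /= rnormE ltcR -lte_fin.
    have -> : simple_integral P (s_ N) - simple_integral P (s_ n) = simple_integral P (fun x => s_ N x + -1 *: s_ n x).
      rewrite simple_integralD // ?simple_integralZ ?scaleN1r //.
      exact: (finite_range_comp (fun v : X => -1 *: v) (fs n)).
    apply: (@le_lt_trans _ _ (L1norm (fun x => s_ N x - s_ n x))).
      under [X in _ (L1norm X)]eq_fun do rewrite -scaleN1r.
      apply: simple_integral_bound.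
      exact: (finite_range_comp (fun z : X * X => z.1 + -1 *: z.2) (finite_range_pair (fs N) (fs n))).
    have ss k := simple_limit_finite_range (fs k).
    apply: le_lt_trans (L1norm_triangle (ss N) sf (ss n)) _.
    rewrite (L1normBC (s_ N)) (splitr c) EFinD.
    have small k : (N <= k)%N -> (L1norm (fun x => f x - s_ k x)%R < (c / 2)%:E)%E.
      move=> /HN[/= h1 h2]; rewrite -(fineK h1) lte_fin.
      by move: h2; rewrite sub0r normrN; apply: le_lt_trans; exact: ler_norm.
    by apply: lteD; exact: small.
  move=> /(cvgP _); set v := lim _ => Hv; exists v.
  by apply/(cvg_rnorm _ _ _).
by exists v; split => //; exists s_; split.
Unshelve. all: by end_near. Qed.

(** [xget] may select any admissible value for g, so that value is carried back to the everywhere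
    limit f, where the integral is unique. As g may be nonmeasurable, the norms are compared by the
    lemmas for nonmeasurable integrands. *)
Lemma bochner_integralE f g v : has_bochner_integral f v -> {ae P, forall x, g x = f x} ->
  bochner_integral P g = v.
Proof.
move=> fv gf.
have fg : {ae P, forall x, f x = g x} by apply: filterS gf => x ->.
have Bv : is_bochner_integral P g v.
  have [[t_ [ft tf]] [s_ [fs Ls sv]]] := fv; split.
    exists t_; split; first exact: ft.
    by apply: filterS gf => x ->; apply/(cvg_rnorm _ _ _).
  exists s_; split; [exact: fs| |by apply/(cvg_rnorm _ _ _)].
  have -> // : (fun n => \int[P]_x (rnorm (g x - s_ n x))%:E)%E = fun n => L1norm (fun x => f x - s_ n x).
  apply/funext => n; apply: ae_ge0_eq_integral_nonmeasurable.
  - by move=> x; rewrite lee_fin rnorm_ge0.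
  - by move=> x; rewrite lee_fin rnorm_ge0.
  - apply: simple_limit_rnormE; apply: simple_limitB; first exact: fv.1.
    exact: simple_limit_finite_range.
  - by apply: filterS gf => x ->.
rewrite /bochner_integral; case: xgetP => [w _ [_ [s_ [fs Ls sw]]]|/(_ v)]; last by move/(_ Bv).
apply: (has_bochner_integral_unique _ fv); split; first exact: fv.1.
exists s_; split => //; last by apply/(cvg_rnorm _ _ _).
apply: cvge0_le Ls => n; rewrite L1norm_ge0 /=.
apply: ae_ge0_le_integral_nonmeasurable_r.
- by move=> x; rewrite lee_fin rnorm_ge0.
- by move=> x; rewrite lee_fin rnorm_ge0.
- apply: simple_limit_rnormE; apply: simple_limitB; first exact: fv.1.
  exact: simple_limit_finite_range (fs n).
- by apply: filterS gf => x ->.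
Qed.

Lemma strongly_measurable_simple_limit f : strongly_measurable P f ->
  exists2 g, simple_limit g & {ae P, forall x, f x = g x}.
Proof.
move=> [s_ [fs [N [mN N0 HN]]]].
pose g x := if x \in N then 0 else f x.
exists g; last first.
  exists N; split => // x /= H; apply: contrapT => nN; apply: H.
  by rewrite /g memNset.
exists (fun n x => if x \in N then 0 else s_ n x); split.
  move=> n; exact: (finite_range_comp (fun z : bool * X => if z.1 then 0 else z.2)
    (finite_range_pair (finite_range_indic mN) (fs n))).
move=> x; rewrite /g; case: ifPn => [_|].
  under eq_fun do rewrite subrr rnorm0; exact: cvg_cst.
rewrite notin_setE => nN; apply/cvg_rnorm.
by apply: contrapT => H; apply: nN; exact: HN.
Qed.

End BochnerTheory.

(** * Density of polynomials in the Dirichlet characters *)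

Section HaarBochner.
Context {R : realType} {G : topologicalZmodType} {m : probability (borel G) R}.
Context {X : completeNormedModType R[i]}.
Hypothesis cptG : compact [set: G].
Hypothesis hausG : hausdorff_space G.
Hypothesis haarm : haar_measure m.
Local Notation I := (haar_int (m := m)).
Implicit Types (f g : G -> X) (u : G -> R) (h : G -> R[i]).

Lemma normed_uniform (V : normedModType R[i]) (g : G -> V) : continuous g ->
  forall e : R, 0 < e -> \forall t \near (0 : G), forall x, rnorm (g (x + t) - g x) < e.
Proof.
move=> cg e e0; apply: near_uniform => // x.
have c2 : (fun z : G * G => g (z.1 + z.2) - g z.1) @ (x, 0) --> g (x + 0) - g x.
  apply: cvgB.
    apply: (@cvg_comp _ _ _ (fun z : G * G => z.1 + z.2) g _ (nbhs (x + 0))).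
      exact: (@add_continuous G (x, 0)).
    exact: cg.
  apply: (@cvg_comp _ _ _ (fun z : G * G => z.1) g _ (nbhs x)); last exact: cg.
  exact: cvg_fst.
have e0' : 0 < e%:C%C by rewrite ltcR.
move/cvgrPdist_lt : c2 => /(_ _ e0').
apply: filterS => -[x' t] /=.
by rewrite addr0 subrr sub0r normrN rnormE ltcR.
Qed.

Lemma normed_approx (V : normedModType R[i]) (g : G -> V) : continuous g ->
  exists r_ : nat -> borel G -> G, (forall n, finite_range (r_ n)) /\
    forall n x, rnorm (g (r_ n x) - g x) < n.+1%:R^-1.
Proof.
move=> cg.
have step n : exists r : borel G -> G, finite_range r /\ forall x, rnorm (g (r x) - g x) < n.+1%:R^-1.
  have n0 : 0 < n.+1%:R^-1 :> R by rewrite invr_gt0.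
  have [r fr Hr] := finite_range_approx cptG (normed_uniform cg n0).
  by exists r; split => // x; have := Hr x x; rewrite addrCA subrr addr0.
have [r_ Hr] := choice step; exists r_; split => [n|n x].
  by have [] := Hr n.
by have [_] := Hr n; exact.
Qed.

Lemma cvg_inv_succ (a : R) : a * n.+1%:R^-1 @[n --> \oo] --> 0.
Proof. by apply: cvg0Z; exact: cvg_harmonic. Qed.

Lemma simple_limit_scale h f : continuous (h : G -> R[i]^o) -> simple_limit (f : borel G -> X) ->
  simple_limit ((fun x => h x *: f x) : borel G -> X).
Proof.
move=> ch [s_ [fs Hs]]; have [r_ [fr Hr]] := normed_approx ch.
exists (fun n x => h (r_ n x) *: s_ n x); split.
  move=> n; exact: (finite_range_comp (fun z : G * X => h z.1 *: z.2) (finite_range_pair (fr n) (fs n))).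
move=> x; pose a := rnorm (h x : R[i]^o) + 1.
apply: (cvg0_le _ (cvg0D (cvg0Z a (Hs x)) (cvg_inv_succ (rnorm (f x))))) => n.
rewrite rnorm_ge0 /=.
have -> : h (r_ n x) *: s_ n x - h x *: f x =
    h (r_ n x) *: (s_ n x - f x) + (h (r_ n x) - h x) *: f x.
  by rewrite scalerBr scalerBl addrA subrK.
rewrite (le_trans (rnormD _ _)) // lerD // rnormZ.
  rewrite ler_wpM2r ?rnorm_ge0 // /a -lerBlDl.
  apply: (le_trans (le_trans (ler_norm _) (rnorm_dist (h (r_ n x) : R[i]^o) (h x)))).
  by rewrite (le_trans (ltW (Hr n x))) // invf_le1 // ler1n.
rewrite mulrC ler_wpM2l ?rnorm_ge0 //; exact: ltW (Hr n x).
Qed.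

Lemma continuous_simple_limit g : continuous g -> simple_limit (g : borel G -> X).
Proof.
move=> cg; have [r_ [fr Hr]] := normed_approx cg.
exists (fun n x => g (r_ n x)); split => [n|x].
  exact: (finite_range_comp g (fr n)).
apply: cvg0_le (cvg_inv_succ 1) => n; rewrite rnorm_ge0 mul1r /=; exact: ltW (Hr n x).
Qed.

Lemma simple_limit_translate f a : simple_limit (f : borel G -> X) ->
  simple_limit ((fun x => f (x + a)) : borel G -> X).
Proof.
move=> sf; have [s_ [fs Hs]] := simple_limit_comp (translate_measurable a) sf.
by exists s_; split => // x; rewrite addrC; exact: Hs.
Qed.

Lemma L1norm_translate f a : simple_limit (f : borel G -> X) ->
  L1norm (P := m) (fun x => f (x + a)) = L1norm (P := m) f.
Proof.
move=> sf; apply: (ge0_integral_translate haarm (u := fun x => (rnorm (f x))%:E)).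
  exact: simple_limit_rnormE.
by move=> x; rewrite lee_fin rnorm_ge0.
Qed.

Lemma rnorm_continuous (V : normedModType R[i]) (g : G -> V) : continuous g ->
  continuous (fun x => rnorm (g x)).
Proof.
move=> cg x; apply/cvgrPdist_lt => e e0; have := cg x.
move=> /(cvg_rnorm _ _ _)/cvgrPdist_lt /(_ _ e0); apply: filterS => y.
rewrite sub0r normrN ger0_norm ?rnorm_ge0 //; apply: le_lt_trans.
by rewrite distrC rnorm_dist.
Qed.

Lemma continuous_scale h (v : X) : ccont h -> continuous (fun x => h x *: v).
Proof.
move=> ch x; apply/cvg_rnorm.
have H0 : continuous (h : G -> R[i]^o) by exact: ccont_continuous.
have H : rnorm ((h y : R[i]^o) - h x) @[y --> x] --> (0 : R) by apply/(@cvg_rnorm R R[i]^o); exact: H0.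
have -> : (fun y => rnorm (h y *: v - h x *: v)) = (fun y => rnorm (h y - h x : R[i]^o) * rnorm v).
  by apply/funext => y; rewrite -scalerBl rnormZ.
by rewrite -[X in _ --> X](mul0r (rnorm v)); apply: cvgM; [exact: H|exact: cvg_cst].
Qed.

Lemma has_bochner_integral_real u (v : X) : continuous u ->
  has_bochner_integral (P := m) ((fun y => (u y)%:C%C *: v) : borel G -> X) ((I u)%:C%C *: v).
Proof.
move=> cu; have cc := ccont_real cu.
have [r_ [fr Hr]] := normed_approx (ccont_continuous cc).
have ur n x : `|u (r_ n x) - u x| <= n.+1%:R^-1.
  apply: le_trans (ltW (Hr n x)).
  by rewrite -rmorphB /= /rnorm normc_def /= expr0n addr0 sqrtr_sqr.
have cg : continuous (fun y => (u y)%:C%C *: v) by exact: continuous_scale.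
have sg := continuous_simple_limit cg.
split; first exact: sg.
exists (fun n y => (u (r_ n y))%:C%C *: v); split.
- by move=> n; exact: (finite_range_comp (fun a => (u a)%:C%C *: v) (fr n)).
- have H := cvg_inv_succ (rnorm v).
  have {}H : (rnorm v * n.+1%:R^-1)%:E @[n --> \oo] --> 0%E.
    by apply: cvg_EFin => //; exact: nearW.
  apply: cvge0_le H => n; rewrite L1norm_ge0 /=; apply: L1norm_sup.
    apply: simple_limitB; first exact: sg.
    apply: simple_limit_finite_range.
    exact: (finite_range_comp (fun a => (u a)%:C%C *: v) (fr n)).
  by move=> x; rewrite -scalerBl -rmorphB /= rnormZr mulrC ler_wpM2l ?rnorm_ge0 // distrC.
- apply: cvg0_le (cvg_inv_succ (rnorm v)) => n; rewrite rnorm_ge0 /=.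
  have -> : simple_integral m (fun y => (u (r_ n y))%:C%C *: v) = (\int[m]_x u (r_ n x))%:C%C *: v.
    rewrite (simple_integral_comp (fun a => (u a)%:C%C *: v) (fr n)).
    have [_ ->] := finite_range_Rintegral (P := m) u (fr n).
    rewrite rmorph_sum /= scaler_suml; apply: eq_bigr => a _.
    by rewrite scalerA mulrC rmorphM.
  rewrite -scalerBl -rmorphB /= rnormZr mulrC ler_wpM2l ?rnorm_ge0 //.
  have [i1 _] := finite_range_Rintegral (P := m) u (fr n).
  have i2 := continuous_integrable (m := m) cptG cu.
  rewrite /haar_int -RintegralB //.
  have i3 : m.-integrable setT (EFin \o (fun x : borel G => u (r_ n x) - u x)).
    by have := integrableB measurableT i1 i2; apply: eq_integrable.
  rewrite (le_trans (le_normr_Rintegral _ _)) //.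
  rewrite (@le_trans _ _ (\int[m]_x (cst n.+1%:R^-1 x))) //; last by rewrite Rintegral_cst1.
  apply: le_Rintegral => //.
    by have := integrable_norm i3; apply: eq_integrable.
  exact: (bounded_integrable (M := `|n.+1%:R^-1|)).
Qed.

Lemma has_bochner_integral_complex h (v : X) : ccont h ->
  has_bochner_integral (P := m) ((fun y => h y *: v) : borel G -> X) (cint (m := m) h *: v).
Proof.
move=> [c1 c2].
have := has_bochner_integralD (has_bochner_integral_real v c1)
  (has_bochner_integral_real ('i%C *: v) c2).
rewrite !scalerA -!scalerDl.
have E (z : R[i]) : (complex.Re z)%:C%C + (complex.Im z)%:C%C * 'i%C = z.
  by rewrite [RHS]complexE mulrC.
under eq_fun do rewrite scalerA -scalerDl E.
by have := E (cint (m := m) h) => /= ->.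
Qed.

Lemma measure_diff_lt (A B : set (borel G)) (e : R) : measurable A -> measurable B ->
  A `<=` B -> (m B < m A + e%:E)%E -> (m (B `\` A) < e%:E)%E.
Proof.
move=> mA mB AB H; rewrite measureD //; last first.
  by rewrite (le_lt_trans (probability_le1 m mB)) // ltry.
rewrite (setIidr AB) lteBlDl ?fin_num_measure //.
Qed.

(** Take U open around A, then K compact inside U, not inside A, since inner regularity is given for
    open sets. A Urysohn function u equal to 1 on K and 0 off U differs from the indicator of A by
    at most the indicators of U minus A and of U minus K. *)
Lemma continuous_approx_indic (A : set (borel G)) (e : R) : measurable A -> 0 < e ->
  exists2 u : G -> R, continuous u & (\int[m]_x `|\1_A x - u x|%:E <= e%:E)%E.
Proof.
move=> mA e0; have d0 : 0 < e / 2 by rewrite divr_gt0.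
have [U [oU AU] HU] : exists2 U : set G, open U /\ A `<=` U & (m U < m A + (e / 2)%:E)%E.
  have E := haar_outer_regular haarm mA.
  have [|_ [U [oU AU] <-] H] := @lb_ereal_inf_adherent R
      [set m U | U in [set U : set G | open U /\ A `<=` U]] (e / 2) d0.
    by rewrite -E fin_num_measure.
  by exists U => //; rewrite E.
have mU : measurable (U : set (borel G)) by exact: open_borel.
have [K [cK KU] HK] : exists2 K : set G, compact K /\ K `<=` U & (m U < m K + (e / 2)%:E)%E.
  have E := haar_inner_regular haarm oU.
  have [|_ [K [cK KU] <-] H] := @ub_ereal_sup_adherent R
      [set m K | K in [set K : set G | compact K /\ K `<=` U]] (e / 2) d0.
    by rewrite -E fin_num_measure.
  exists K => //; move: H; rewrite -E lteBlDr //.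
have clK : closed K by exact: compact_closed.
have mK : measurable (K : set (borel G)).
  by rewrite -[K]setCK; apply: measurableC; apply: open_borel; exact: closed_openC.
have /(@uniform_separatorP G R) [u [cu u01 u0 u1]] : uniform_separator (~` U) K.
  apply: (@normal_separatorP R G).1 => //.
  - exact: compact_normal.
  - exact: open_closedC.
  - by apply/seteqP; split => // x /= [nU Kx]; apply: nU; exact: KU.
have ur x : 0 <= u x <= 1 by have := u01 (u x); rewrite /= in_itv /=; apply; exists x.
exists u => //.
have mu := continuous_measurable cu.
have mI (B : set (borel G)) : measurable B -> measurable_fun setT (fun x => (\1_B x)%:E : \bar R).
  by move=> mB; apply/measurable_EFinP; exact: measurable_indic.
rewrite (@le_trans _ _ (\int[m]_x ((\1_(U `\` A) x)%:E + (\1_(U `\` K) x)%:E))%E) //.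
  apply: ge0_le_integral => //.
  - apply/measurable_EFinP; apply: measurableT_comp => //; apply: measurable_funB => //.
  - by apply: emeasurable_funD; apply: mI; exact: measurableD.
  move=> x _; rewrite -EFinD lee_fin.
  have [Ux|nUx] := pselect (U x); last first.
    have -> : u x = 0 by apply: u0; exists x.
    have nA : ~ A x by move=> /AU.
    have -> : \1_A x = 0 :> R by rewrite indicE memNset.
    by rewrite subrr normr0 addr_ge0.
  have [Kx|nKx] := pselect (K x).
    have -> : u x = 1 by apply: u1; exists x.
    have [Ax|nAx] := pselect (A x).
      have -> : \1_A x = 1 :> R by rewrite indicE mem_set.
      by rewrite subrr normr0 addr_ge0.
    have -> : \1_A x = 0 :> R by rewrite indicE memNset.
    have -> : \1_(U `\` A) x = 1 :> R by rewrite indicE mem_set.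
    by rewrite sub0r normrN normr1 lerDl.
  have h : (\1_(U `\` K) x : R) = 1 by rewrite indicE mem_set.
  rewrite h (le_trans (y := 1)) ?lerDr //.
  have /andP[h1 h2] := ur x; rewrite indicE; case: (x \in A) => /=.
    by rewrite ger0_norm; lra.
  by rewrite sub0r normrN ger0_norm.
rewrite ge0_integralD //; try by apply: mI; exact: measurableD.
rewrite !integral_indic ?setIT //; try exact: measurableD.
rewrite (splitr e) EFinD; apply: ltW; apply: lteD; exact: measure_diff_lt.
Qed.

Lemma continuous_dense_L1 f (e : R) : simple_limit (f : borel G -> X) ->
  (L1norm (P := m) f < +oo)%E -> 0 < e ->
  exists2 g : G -> X, continuous g & (L1norm (P := m) (fun x => f x - g x)%R <= e%:E)%E.
Proof.
move=> sf Lf e0; have [_ [_ [s_ [fs Ls _]]]] := has_bochner_integral_ex sf Lf.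
have d0 : 0 < e / 2 by rewrite divr_gt0.
have [n Hn] : exists n, (L1norm (P := m) (fun x => f x - s_ n x)%R <= (e / 2)%:E)%E.
  move: Ls => /fine_cvgP[fin_s /cvgrPdist_le /(_ _ d0) Hs].
  have [N _ HN] := filterI fin_s Hs; exists N.
  have [/= h1 h2] := HN N (leqnn N); rewrite -(fineK h1) lee_fin.
  by move: h2; rewrite sub0r normrN; apply: le_trans; exact: ler_norm.
have [fr mr] := fs n.
(* Induction on the list of values of the simple function, half of the error budget being spent on
   the indicator of the first one. *)
have main (l : seq X) (d : R) : 0 < d -> exists2 g : G -> X, continuous g &
   simple_limit ((fun x => \sum_(v <- l) (\1_(s_ n @^-1` [set v]) x)%:C%C *: v) : borel G -> X) /\
   (L1norm (P := m) (fun x => \sum_(v <- l) (\1_(s_ n @^-1` [set v]) x)%:C%C *: v - g x)%R <= d%:E)%E.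
  elim: l d => [|v l IH] d dp.
    exists (fun=> 0); first exact: cst_continuous.
    under eq_fun do rewrite big_nil; split; first exact: simple_limit_cst.
    under eq_fun do rewrite big_nil subrr.
    by rewrite /L1norm integral0_eq ?lee_fin ?ltW // => x _; rewrite rnorm0.
  have d2 : 0 < d / 2 by rewrite divr_gt0.
  have [g cg [sg Lg]] := IH _ d2.
  have c0 : 0 < d / 2 / (rnorm v + 1) by rewrite divr_gt0 // ltr_wpDl // rnorm_ge0.
  have [u cu Lu] := continuous_approx_indic (mr v) c0.
  have cuv : continuous (fun x => (u x)%:C%C *: v) by apply: continuous_scale; exact: ccont_real.
  have sv : simple_limit ((fun x => (\1_(s_ n @^-1` [set v]) x : R)%:C%C *: v) : borel G -> X).
    apply: simple_limit_finite_range.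
    exact: (finite_range_comp (fun b : bool => (b%:R : R)%:C%C *: v) (finite_range_indic (mr v))).
  exists (fun x => (u x)%:C%C *: v + g x).
    by move=> x; apply: cvgD; [exact: cuv|exact: cg].
  split; first by under eq_fun do rewrite big_cons; exact: simple_limitD.
  under eq_fun do rewrite big_cons opprD addrACA.
  have suv := continuous_simple_limit cuv.
  apply: le_trans (L1normD (simple_limitB sv suv) (simple_limitB sg (continuous_simple_limit cg))) _.
  rewrite (splitr d) EFinD; apply: leeD => //.
  have mu' : measurable_fun setT (fun x : borel G => `|\1_(s_ n @^-1` [set v]) x - u x|).
    apply: measurableT_comp => //; apply: measurable_funB; first exact: measurable_indic.
    exact: continuous_measurable.
  have -> : L1norm (P := m) (fun x => (\1_(s_ n @^-1` [set v]) x)%:C%C *: v - (u x)%:C%C *: v) =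
      ((rnorm v)%:E * \int[m]_x `|\1_(s_ n @^-1` [set v]) x - u x|%:E)%E.
    rewrite -ge0_integralZl //; last 2 first.
    - exact/measurable_EFinP.
    - by rewrite lee_fin rnorm_ge0.
    by apply: eq_integral => x _; rewrite -scalerBl -rmorphB /= rnormZr mulrC EFinM.
  apply: (@le_trans _ _ ((rnorm v)%:E * (d / 2 / (rnorm v + 1))%:E)%E).
    by apply: lee_wpmul2l => //; rewrite lee_fin rnorm_ge0.
  rewrite -EFinM lee_fin mulrA ler_pdivrMr ?ltr_wpDl ?rnorm_ge0 // mulrC ler_pM2l //.
  by rewrite lerDl.
have [g cg [_ Lg]] := main (fset_set (range (s_ n))) _ d0.
exists g => //; have ss := simple_limit_finite_range (fs n).
apply: le_trans (L1norm_triangle sf ss (continuous_simple_limit cg)) _.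
rewrite (splitr e) EFinD; apply: leeD => //.
have E x : \sum_(v <- fset_set (range (s_ n))) (\1_(s_ n @^-1` [set v]) x : R)%:C%C *: v = s_ n x.
  rewrite (bigD1_seq (s_ n x)) /=; last 2 first.
  - by rewrite in_fset_set // mem_set //; exists x.
  - exact: fset_uniq.
  rewrite indicE mem_set // rmorph1 scale1r big1 ?addr0 // => v /eqP vx.
  by rewrite indicE memNset ?scale0r //= => H; apply: vx.
by move: Lg; under eq_fun do rewrite E.
Qed.

End HaarBochner.

(** * Approximate identities *)

Section ApproximateIdentity.
Context {R : realType} {G : topologicalZmodType} {m : probability (borel G) R}.
Hypothesis cptG : compact [set: G].
Hypothesis hausG : hausdorff_space G.
Hypothesis haarm : haar_measure m.
Local Notation I := (haar_int (m := m)).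
Local Notation ev := (evfun R G).
Local Notation "u ** v" := (evconv cptG haarm u v) (at level 40, left associativity).

Lemma nbhs0_half (U : set G) : nbhs (0 : G) U ->
  exists2 V : set G, nbhs (0 : G) V & forall a b, V a -> V b -> U (a + b).
Proof.
move=> U0; have := @add_continuous G (0, 0); rewrite /continuous_at /= addr0.
move=> /(_ _ U0) [[A B] /= [A0 B0] AB].
by exists (A `&` B); [exact: filterI|move=> a b [Aa _] [_ Bb]; exact: (AB (a, b))].
Qed.

Lemma evconv_supp (u v : ev) (A B : set G) :
  (forall x, u x != 0 -> A x) -> (forall x, v x != 0 -> B x) ->
  forall x, (u ** v) x != 0 -> exists a b, [/\ A a, B b & x = a + b].
Proof.
move=> uA vB x; apply: contraNP => nex; rewrite evconvE.
apply/eqP; rewrite -[RHS](haar_int_cst (m := m) 0); congr (haar_int _); apply/funext => y.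
apply/eqP; rewrite mulf_eq0; apply/negPn/negP; rewrite negb_or => /andP[uy vy].
by apply: nex; exists y, (x - y); split; [exact: uA|exact: vB|rewrite addrCA subrr addr0].
Qed.

Lemma evconv_ge0 (u v : ev) : (forall x, 0 <= u x) -> (forall x, 0 <= v x) ->
  forall x, 0 <= (u ** v) x.
Proof. by move=> u0 v0 x; rewrite evconvE; apply: haar_int_ge0 => y; rewrite mulr_ge0. Qed.

Lemma evconv_int (u v : ev) : I (u ** v) = I u * I v.
Proof.
have [Mu _ bu] := continuous_bounded cptG (evf_cont u).
have [Mv _ bv] := continuous_bounded cptG (evf_cont v).
have H := haar_Fubini cptG (haar_int_functional cptG (m := m))
  (F := fun x y => u y * v (x - y)).
rewrite [LHS](_ : _ = I (fun x => I (fun y => u y * v (x - y)))) // -H; last 2 first.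
- apply: (modulus_mul (M := Mu) (M' := Mv)) => //; first exact: modulus_cst.
  exact: (modulus_addr cptG (fun y => - y) (evf_cont v)).
- apply: (modulus_mul (M := Mu) (M' := Mv)) => //; last exact: (modulus_subr cptG id (evf_cont v)).
  have := modulus_addr cptG (fun=> 0) (evf_cont u).
  by under eq_fun do under eq_fun do rewrite addr0.
have cv y : continuous (fun x => v (x - y)) by apply: continuous_translate; exact: evf_cont.
have -> : (fun y => I (fun x => u y * v (x - y))) = (fun y => I v * u y).
  apply/funext => y; rewrite haar_intZ // (haar_int_translate cptG haarm) 1?mulrC //.
  exact: evf_cont.
by rewrite haar_intZ 1?mulrC //; exact: evf_cont.
Qed.

(** Finitely many reflected translates of u, all with integral I u, have a sum that is at least u a
    / 2 everywhere. *)
Lemma haar_int_gt0 (u : G -> R) a : continuous u -> (forall x, 0 <= u x) -> 0 < u a -> 0 < I u.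
Proof.
move=> cu u0 ua.
have cua : continuous (fun x => u (x + a)) by exact: continuous_translate.
pose V := [set x | u a / 2 < u (x + a)].
have oV : open V.
  have -> : V = (fun x => u (x + a)) @^-1` [set y | u a / 2 < y] by [].
  by move/continuousP: cua; apply; exact: open_gt.
have V0 : V 0 by rewrite /V /= add0r ltr_pdivrMr // ltr_pMr // ltr1n.
have [s Hs] := finite_cover cptG oV V0.
have cF b : continuous (fun x => u (b - x + a)).
  exact: (continuous_reflect (u := fun x => u (x + a))).
have [cS ES] := functional_sum s (fun=> 1) (haar_int_functional cptG (m := m))
  (F := fun b x => u (b - x + a)) cF.
have le x : u a / 2 <= \sum_(b <- s) u (b - x + a) * 1.
  have [b bs Vb] := Hs x; rewrite (big_rem b) //= mulr1 (le_trans (ltW Vb)) // lerDl.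
  by apply: sumr_ge0 => c _; rewrite mulr1.
have : u a / 2 <= \sum_(b <- s) I u.
  have -> : \sum_(b <- s) I u = I (fun y => \sum_(b <- s) u (b - y + a) * 1).
    rewrite ES; apply: eq_bigr => b _; rewrite mulr1.
    rewrite (haar_int_reflect cptG haarm (u := fun x => u (x + a))) //.
    by rewrite (haar_int_translate cptG haarm).
  rewrite -[leLHS](haar_int_cst (m := m)); apply: haar_int_le => //.
  exact: cst_continuous.
have a2 : 0 < u a / 2 by rewrite divr_gt0.
have I0 : 0 <= I u by exact: haar_int_ge0.
rewrite lt_def I0 andbT => H; apply: contraTneq a2 => I00.
by move: H; rewrite I00 big1 // -leNgt.
Qed.

Lemma bump (U : set G) : nbhs (0 : G) U ->
  exists theta : ev, [/\ forall x, 0 <= theta x, I theta = 1 & forall x, theta x != 0 -> U x].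
Proof.
rewrite nbhsE => -[V [oV V0] VU].
have /(@uniform_separatorP G R) [u [cu u01 u0 u1]] : uniform_separator (~` V) [set 0 : G].
  apply: (@normal_separatorP R G).1 => //.
  - exact: compact_normal.
  - exact: open_closedC.
  - by apply: compact_closed => //; exact: compact_set1.
  - by apply/seteqP; split => // x /= [nV x0]; apply: nV; rewrite x0.
have ur x : 0 <= u x by have := u01 (u x); rewrite /= in_itv /= => H; have /andP[] := H (ex_intro2 _ _ x Logic.I erefl).
have cun : continuous (fun x => u (- x)).
  by have := @continuous_reflect G R u 0 cu; under eq_fun do rewrite sub0r.
(* The product is even, and it keeps the positivity, the support in V and the value 1 at 0. *)
have ct : continuous (fun x => u x * u (- x)) by exact: continuousM.
have I0 : 0 < I (fun x => u x * u (- x)).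
  apply: (@haar_int_gt0 _ 0 ct); first by move=> x; rewrite mulr_ge0.
  by rewrite oppr0 (u1 (u 0)) ?mulr1 //; exists 0.
pose c := (I (fun x => u x * u (- x)))^-1.
have ct' : continuous (fun x => c * (u x * u (- x))).
  by apply: continuousM => //; exact: cst_continuous.
have et x : c * (u (- x) * u (- - x)) = c * (u x * u (- x)) by rewrite opprK [u x * _]mulrC.
exists (EvFun ct' et); split => /=.
- by move=> x; rewrite mulr_ge0 ?invr_ge0 ?(ltW I0) // mulr_ge0.
- by rewrite haar_intZ // mulVf // gt_eqF.
move=> x; apply: contraNP => nU; rewrite (u0 (u x)) ?mul0r ?mulr0 //.
by exists x => // /VU.
Qed.

(** The kernel is a sixth convolution power because [trig_dense] approximates such powers uniformly.
    Its support consists of sixfold sums, which three successive halvings of U keep inside U. *)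
Lemma approximate_identity (U : set G) : nbhs (0 : G) U ->
  exists theta : ev, let psi := evpow6 cptG haarm theta in
    [/\ forall x, 0 <= psi x, I psi = 1 & forall x, psi x != 0 -> U x].
Proof.
move=> /nbhs0_half[V V0 HV]; have [V2 V20 HV2] := nbhs0_half V0.
have [V3 V30 HV3] := nbhs0_half V20.
have [theta [t0 It tV]] := bump V30.
exists theta => psi.
have s2 x : (theta ** theta) x != 0 -> V2 x.
  by move=> /(evconv_supp tV tV) [a [b [Va Vb ->]]]; exact: HV3.
have s4 x : ((theta ** theta) ** (theta ** theta)) x != 0 -> V x.
  by move=> /(evconv_supp s2 s2) [a [b [Va Vb ->]]]; exact: HV2.
have sV x : V2 x -> V x.
  by move=> Vx; rewrite -[x]addr0; apply: HV2 => //; exact: nbhs_singleton.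
split.
- have p2 := evconv_ge0 t0 t0.
  exact: (evconv_ge0 p2 (evconv_ge0 p2 p2)).
- by rewrite /psi /evpow6 !evconv_int It !mulr1.
by move=> x /(evconv_supp s2 s4) [a [b [Va Vb ->]]]; apply: HV => //; exact: sV.
Qed.

End ApproximateIdentity.

Section PolynomialDensity.
Context {R : realType} {G : topologicalZmodType} {m : probability (borel G) R}.
Context {X : completeNormedModType R[i]}.
Hypothesis cptG : compact [set: G].
Hypothesis hausG : hausdorff_space G.
Hypothesis haarm : haar_measure m.
Local Notation I := (haar_int (m := m)).
Local Notation ev := (evfun R G).
Variable h : nat -> G -> R[i].
Hypothesis hchar : forall n, character (h n).
Implicit Types (f g : G -> X).

Inductive hpoly : (G -> X) -> Prop :=
| hpoly0 : hpoly (fun=> 0)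
| hpolyD p k v : hpoly p -> hpoly (fun x => p x + h k x *: v).

Lemma hpoly_add p q : hpoly p -> hpoly q -> hpoly (fun x => p x + q x).
Proof.
move=> hp; elim=> [|r k v hr IH]; first by under eq_fun do rewrite addr0.
by under eq_fun do rewrite addrA; exact: hpolyD.
Qed.

Lemma hpoly_monomial k v : hpoly (fun x => h k x *: v).
Proof.
have -> : (fun x => h k x *: v) = (fun x => (fun=> 0 : X) x + h k x *: v).
  by apply/funext => x; rewrite add0r.
by apply: hpolyD; exact: hpoly0.
Qed.

Lemma hpoly_continuous p : hpoly p -> continuous p.
Proof.
elim=> [|q k v hq IH]; first exact: cst_continuous.
have c : continuous (fun x => h k x *: v).
  by apply: continuous_scale; exact: character_ccont.
by move=> x; apply: cvgD; [exact: IH|exact: c].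
Qed.

Lemma simple_limit_character (c : G -> R[i]) f : character c -> simple_limit (f : borel G -> X) ->
  simple_limit ((fun x => c x *: f x) : borel G -> X).
Proof. by move=> cc sf; apply: simple_limit_scale => //; exact: char_continuous. Qed.

Lemma L1norm_character (c : G -> R[i]) f : character c ->
  L1norm (P := m) (fun x => c x *: f x) = L1norm (P := m) f.
Proof. by move=> cc; apply: eq_integral => x _; rewrite rnormZ1 // char_norm1. Qed.

Lemma has_fourier_coef f (c : G -> R[i]) : simple_limit (f : borel G -> X) ->
  (L1norm (P := m) f < +oo)%E -> character c ->
  has_bochner_integral (P := m) (fun x => (c x)^* *: f x) (fourier_coef m f c).
Proof.
move=> sf Lf cc; have cJ := character_conj cc.
have [|v Hv] := has_bochner_integral_ex (P := m) (simple_limit_character cJ sf).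
  by rewrite (L1norm_character f cJ).
have -> : fourier_coef m f c = v; last exact: Hv.
by apply: bochner_integralE Hv _; exact: aeW.
Qed.

Variable f : G -> X.
Hypothesis sf : simple_limit (f : borel G -> X).
Hypothesis Lf : (L1norm (P := m) f < +oo)%E.
Hypothesis spec : forall c, character c -> (forall n, c <> h n) -> fourier_coef m f c = 0.

(** Here the spectral hypothesis on f enters: a character other than the [h n] contributes 0. *)
Lemma hpoly_fourier (c : G -> R[i]) (a : R[i]) : character c ->
  hpoly (fun x => c x *: (a *: fourier_coef m f c)).
Proof.
move=> cc; have [[n ->]|nex] := pselect (exists n, c = h n); first exact: hpoly_monomial.
rewrite spec //; last by move=> n cn; apply: nex; exists n.
by under eq_fun do rewrite !scaler0; exact: hpoly0.
Qed.

(** c is the half-sum of a character and its conjugate, and convolving f with a character multiplies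
    that character by the corresponding Fourier coefficient of f. *)
Lemma dalembert_convolution (c : G -> R) : dalembert c ->
  exists2 p, hpoly p & forall x,
    has_bochner_integral (P := m) (fun y => (c (x - y))%:C%C *: f y) (p x).
Proof.
move=> /dalembert_character[chi cchi Re_chi].
have cJ := character_conj cchi.
have b1 := has_fourier_coef sf Lf cchi; have b2 := has_fourier_coef sf Lf cJ.
pose a : R[i] := (2^-1)%:C%C.
exists (fun x => chi x *: (a *: fourier_coef m f chi) +
    (chi x)^* *: (a *: fourier_coef m f (fun x => (chi x)^*))).
  by apply: hpoly_add; exact: hpoly_fourier.
move=> x; rewrite !scalerA.
have := has_bochner_integralD (has_bochner_integralZ (chi x * a) b1)
  (has_bochner_integralZ ((chi x)^* * a) b2).
congr has_bochner_integral; apply/funext => y.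
rewrite !scalerA -scalerDl /= conjCK; congr (_ *: _).
have chiN : chi (- y) = (chi y)^*.
  have n0 : chi y != 0 by rewrite -normr_gt0 char_norm1.
  apply: (mulfI n0); rewrite character_mulJ // -(charD cchi) subrr character0 //.
rewrite -Re_chi (charD cchi) chiN /a.
case: (chi x) => p q; case: (chi y) => r s.
by apply/eqP; rewrite eq_complex /=; apply/andP; split; apply/eqP; field.
Qed.

Lemma trig_convolution (t : ev) : trig t ->
  exists2 p, hpoly p & forall x,
    has_bochner_integral (P := m) (fun y => (t (x - y))%:C%C *: f y) (p x).
Proof.
elim=> [|u a c tu [p hp Hp] dc].
  exists (fun=> 0); first exact: hpoly0.
  move=> x; have := has_bochner_integralZ 0 (has_fourier_coef sf Lf character1).
  rewrite scale0r; congr has_bochner_integral; apply/funext => y.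
  by rewrite !scale0r.
have [q hq Hq] := dalembert_convolution dc.
exists (fun x => p x + a%:C%C *: q x).
  apply: hpoly_add => //; elim: hq => [|r k v hr IH].
    by under eq_fun do rewrite scaler0; exact: hpoly0.
  have -> : (fun x => a%:C%C *: (r x + h k x *: v)) =
      (fun x => a%:C%C *: r x + h k x *: (a%:C%C *: v)).
    by apply/funext => x; rewrite scalerDr !scalerA mulrC.
  exact: hpolyD.
move=> x; have := has_bochner_integralD (Hp x) (has_bochner_integralZ (a%:C%C) (Hq x)).
congr has_bochner_integral; apply/funext => y.
by rewrite scalerA -scalerDl evD evZ rmorphD rmorphM.
Qed.

(** Makes [haar_Fubini] available for the weight |f - g|, which is integrable but need not be
    continuous. *)
Lemma weighted_functional (w : borel G -> R) : (forall y, 0 <= w y) ->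
  m.-integrable setT (EFin \o w) ->
  bounded_functional (fun u : G -> R => \int[m]_y (u y * w y)).
Proof.
move=> w0 iw.
have mw : measurable_fun setT w by apply/measurable_EFinP; exact: measurable_int iw.
have iuw (u : G -> R) : continuous u -> m.-integrable setT (EFin \o (fun y : borel G => u y * w y)).
  move=> cu; have [M M0 HM] := continuous_bounded cptG cu.
  have iM : m.-integrable setT (EFin \o (fun y : borel G => M * w y)).
    by have := integrableZl measurableT M iw; apply: eq_integrable.
  apply: (le_integrable measurableT _ _ iM).
    apply/measurable_EFinP; apply: measurable_funM => //.
    exact: continuous_measurable.
  move=> y _ /=; rewrite lee_fin !normrM ler_wpM2r //.
  by rewrite [leRHS]ger0_norm ?(ltW M0) // HM.
split.
  move=> u v a cu cv.
  have iav : m.-integrable setT (EFin \o (fun y : borel G => a * (v y * w y))).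
    by have := integrableZl measurableT a (iuw _ cv); apply: eq_integrable.
  rewrite -RintegralZl //; last exact: iuw.
  rewrite -RintegralD //; last exact: iuw.
  by apply: eq_Rintegral => y _; rewrite mulrDl mulrA.
exists (\int[m]_y w y); first exact: Rintegral_ge0.
move=> u e cu ue; rewrite (le_trans (le_normr_Rintegral measurableT (iuw _ cu))) //.
rewrite mulrC -RintegralZl //; apply: le_Rintegral => //.
- by have := integrable_norm (iuw _ cu); apply: eq_integrable.
- by have := integrableZl measurableT e iw; apply: eq_integrable.
by move=> y _; rewrite normrM (ger0_norm (w0 y)) ler_wpM2r.
Qed.

Lemma L1norm_Rintegral g : simple_limit (g : borel G -> X) -> (L1norm (P := m) g < +oo)%E ->
  m.-integrable setT (EFin \o (fun y : borel G => rnorm (g y))) /\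
  L1norm (P := m) g = (\int[m]_y (rnorm (g y)))%:E.
Proof.
move=> sg Lg; have ig : m.-integrable setT (EFin \o (fun y : borel G => rnorm (g y))).
  apply/integrableP; split; first exact: simple_limit_rnormE.
  rewrite (_ : (\int[m]_x `|(EFin \o (fun y : borel G => rnorm (g y))) x|)%E = L1norm (P := m) g) //.
  by apply: eq_integral => y _ /=; rewrite ger0_norm // rnorm_ge0.
by split => //; rewrite /L1norm /Rintegral fineK //; exact: integrable_fin_num ig.
Qed.

(* The polynomial is f * t, where the trigonometric polynomial t is uniformly close
   to an approximate identity. *)
Lemma hpoly_dense (e : R) : 0 < e ->
  exists2 p, hpoly p & (L1norm (P := m) (fun x => f x - p x)%R <= e%:E)%E.
Proof.
move=> e0; have e4 : 0 < e / 4 by rewrite divr_gt0.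
have [g cg Lg] := continuous_dense_L1 cptG hausG haarm sf Lf e4.
have sg := continuous_simple_limit cptG cg.
have sfg := simple_limitB sf sg.
have [if1 Lf1] := L1norm_Rintegral sf Lf.
have [iN LN] := L1norm_Rintegral sfg (le_lt_trans Lg (ltry _)).
pose N (y : borel G) := rnorm (f y - g y).
have N0 y : 0 <= N y by exact: rnorm_ge0.
pose L := \int[m]_y (rnorm (f y)).
have L0 : 0 <= L by apply: Rintegral_ge0 => y _; exact: rnorm_ge0.
have := normed_uniform cptG cg e4.
move=> /(approximate_identity cptG hausG haarm)[theta]; set psi := evpow6 _ _ _.
move=> [psi0 Ipsi psiU].
have d0 : 0 < e / 4 / (L + 1) by rewrite divr_gt0 // ltr_wpDl.
have [t tt Ht] := trig_dense cptG haarm theta d0.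
have [p hp Hp] := trig_convolution tt.
exists p => //; have cp := hpoly_continuous hp.
have sp := continuous_simple_limit cptG cp.
have bJ := weighted_functional N0 iN.
pose J (u : G -> R) := \int[m]_y (u y * N y).
have cpsi := evf_cont psi.
have mod1 : translation_modulus (fun x y : G => psi (x - y)).
  exact: (modulus_addr cptG (fun y => - y) cpsi).
have mod2 : translation_modulus (fun y x : G => psi (x - y)).
  exact: (modulus_subr cptG id cpsi).
have cpsix (x : G) : continuous (fun y => psi (x - y)) by exact: continuous_reflect.
(* One e / 4 pays for replacing psi by t against f, the other for the oscillation of g on the
   support of psi, and J is the convolution of psi with |f - g|. By Fubini the integral of B is at
   most 3 e / 4, which leaves e / 4 for the distance from f to g. *)
pose B x := e / 4 + e / 4 + J (fun y => psi (x - y)).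
have cJ : continuous (fun x => J (fun y => psi (x - y))).
  exact: (haar_int_param_continuous bJ mod1).
have cB : continuous B by move=> x; apply: cvgD; [exact: cvg_cst|exact: cJ].
have IB : I B = e / 4 + e / 4 + \int[m]_y (N y).
  rewrite haar_intD //; [|exact: cst_continuous]; rewrite haar_int_cst; congr (_ + _).
  have := haar_Fubini cptG bJ mod1 mod2 => <-.
  apply: eq_Rintegral => y _; rewrite (haar_int_translate cptG haarm) //.
  by rewrite Ipsi mul1r.
have pB x : rnorm (g x - p x) <= B x.
  have b1 := has_bochner_integral_real cptG (g x) (cpsix x) (m := m).
  have Ix : I (fun y => psi (x - y)) = 1 by rewrite (haar_int_reflect cptG haarm).
  rewrite Ix scale1r in b1.
  rewrite rnormBC -lee_fin (le_trans (has_bochner_integral_sub (Hp x) b1)) //.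
  pose W (y : borel G) := e / 4 / (L + 1) * rnorm (f y) + psi (x - y) * N y + e / 4 * psi (x - y).
  have i1 : m.-integrable setT (EFin \o (fun y : borel G => e / 4 / (L + 1) * rnorm (f y))).
    by have := integrableZl measurableT (e / 4 / (L + 1)) if1; apply: eq_integrable.
  have [M M0 HM] := continuous_bounded cptG (cpsix x).
  have i2 : m.-integrable setT (EFin \o (fun y : borel G => psi (x - y) * N y)).
    have iM : m.-integrable setT (EFin \o (fun y : borel G => M * N y)).
      by have := integrableZl measurableT M iN; apply: eq_integrable.
    apply: (le_integrable measurableT _ _ iM).
      apply/measurable_EFinP; apply: measurable_funM; last exact: simple_limit_rnorm.
      exact: (continuous_measurable (cpsix x)).
    move=> y _ /=; rewrite lee_fin !normrM ler_wpM2r //.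
    by rewrite [leRHS]ger0_norm ?(ltW M0) // HM.
  have i3 : m.-integrable setT (EFin \o (fun y : borel G => e / 4 * psi (x - y))).
    have := integrableZl measurableT (e / 4) (continuous_integrable (m := m) cptG (cpsix x)).
    by apply: eq_integrable.
  have i12 : m.-integrable setT (EFin \o (fun y : borel G => e / 4 / (L + 1) * rnorm (f y) + psi (x - y) * N y)).
    by have := integrableD measurableT i1 i2; apply: eq_integrable.
  have iW : m.-integrable setT (EFin \o W).
    by have := integrableD measurableT i12 i3; apply: eq_integrable.
  have mW : measurable_fun setT W by apply/measurable_EFinP; exact: measurable_int iW.
  have sdiff : simple_limit ((fun y => (t (x - y))%:C%C *: f y - (psi (x - y))%:C%C *: g x) : borel G -> X).
    by apply: simple_limitB; [exact: (Hp x).1|exact: b1.1].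
  rewrite (le_trans (L1norm_le (P := m) sdiff mW _)) //; last first.
    have -> : (\int[m]_y (W y)%:E)%E = (\int[m]_y W y)%:E.
      by rewrite /Rintegral fineK //; exact: integrable_fin_num iW.
    rewrite lee_fin /W RintegralD // RintegralD //.
    have E1 : \int[m]_y (e / 4 / (L + 1) * rnorm (f y)) = e / 4 / (L + 1) * L.
      exact: (RintegralZl (e / 4 / (L + 1)) measurableT if1).
    have E2 : \int[m]_y (e / 4 * psi (x - y)) = e / 4.
      by rewrite -[RHS]mulr1 -[X in _ = _ * X]Ix; exact: (haar_intZ cptG (e / 4) (cpsix x)).
    rewrite E1 E2.
    rewrite /B addrAC lerD2r lerD2r -/L mulrAC ler_pdivrMr ?ltr_wpDl //.
    by rewrite ler_pM2l // lerDl.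
  move=> y; rewrite (_ : _ - _ = (t (x - y) - psi (x - y))%:C%C *: f y +
     (psi (x - y))%:C%C *: (f y - g y) + (psi (x - y))%:C%C *: (g y - g x)); last first.
    by rewrite rmorphB /= scalerBl !scalerBr !addrA !subrK.
  rewrite (le_trans (rnormD _ _)) // lerD //.
    rewrite (le_trans (rnormD _ _)) // lerD // rnormZr.
      by rewrite ler_wpM2r ?rnorm_ge0 // distrC Ht.
    by rewrite ger0_norm.
  rewrite rnormZr ger0_norm // mulrC.
  have [->|pn0] := eqVneq (psi (x - y)) 0; first by rewrite !mulr0.
  rewrite ler_wpM2r //; have := psiU _ pn0 y.
  by rewrite rnormBC addrCA subrr addr0 rnormBC => /ltW.
have Lgp : (L1norm (P := m) (fun x => g x - p x)%R <= (I B)%:E)%E.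
  rewrite (le_trans (L1norm_le (P := m) (simple_limitB sg sp) (continuous_measurable cB) pB)) //.
  by rewrite /haar_int /Rintegral fineK //; apply: integrable_fin_num (continuous_integrable cptG cB).
rewrite (le_trans (L1norm_triangle sf sg sp)) // (le_trans (leeD Lg Lgp)) //.
rewrite -EFinD lee_fin IB.
have : \int[m]_y N y <= e / 4 by rewrite -lee_fin -LN.
lra.
Qed.

End PolynomialDensity.

Lemma ae_imply d (T : semiRingOfSetsType d) (R : realFieldType) (mu : set T -> \bar R)
  (A B : T -> Prop) : (forall x, A x -> B x) ->
  {ae mu, forall x, A x} -> {ae mu, forall x, B x}.
Proof.
move=> AB [N [mN N0 HN]]; exists N; split => // x /= nB.
by apply: HN => Ax; apply: nB; exact: AB.
Qed.

Lemma ae_and d (T : measurableType d) (R : realType) (mu : {measure set T -> \bar R})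
  (A B : T -> Prop) : {ae mu, forall x, A x} -> {ae mu, forall x, B x} ->
  {ae mu, forall x, A x /\ B x}.
Proof. exact: filterI. Qed.

Section TailComparison.
Context {d} {T : measurableType d} {R : realType} {P : probability T R}.

Lemma ge0_integral_tail (u : T -> R) : measurable_fun setT u -> (forall x, 0 <= u x) ->
  (\int[P]_x (u x)%:E = \int[lebesgue_measure]_(r in `[0%R, +oo[) P [set x | (r < u x)%R])%E /\
  measurable_fun (`[0%R, +oo[%classic : set R) (fun r : R => P [set x | (r < u x)%R]).
Proof.
move=> mu u0; pose X : {RV P >-> R} := mfun_Sub (mem_set mu).
have E : (fun r : R => P [set x | (r < u x)%R]) = ccdf X.
  apply/funext => r; rewrite /ccdf /distribution /pushforward; congr (P _).
  by apply/seteqP; split => x /=; rewrite in_itv /= andbT.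
split; last by rewrite E; apply: measurable_funTS; exact: ccdf_measurable.
have := @ge0_expectation_ccdf _ _ _ P X u0; rewrite unlock /= => ->.
by apply: eq_integral => r _; rewrite -E.
Qed.

Lemma ge0_integral_le_tail (u v : T -> R) (c : R) : 0 <= c ->
  measurable_fun setT u -> measurable_fun setT v ->
  (forall x, 0 <= u x) -> (forall x, 0 <= v x) ->
  (forall r, 0 <= r -> (P [set x | (r < u x)%R] <= c%:E * P [set x | (r < v x)%R])%E) ->
  (\int[P]_x (u x)%:E <= c%:E * \int[P]_x (v x)%:E)%E.
Proof.
move=> c0 mu mv u0 v0 H.
have [-> mPu] := ge0_integral_tail mu u0; have [-> mPv] := ge0_integral_tail mv v0.
rewrite -ge0_integralZl //.
apply: ge0_le_integral => //.
- by apply: measurable_funeM.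
by move=> r /=; rewrite in_itv /= andbT => r0; exact: H.
Qed.

Lemma Markov_tail (u : T -> R) (t : R) : measurable_fun setT u -> (forall x, 0 <= u x) ->
  0 < t -> (P [set x | (t < u x)%R] <= (t^-1)%:E * \int[P]_x (u x)%:E)%E.
Proof.
move=> mu u0 t0.
have mE : measurable [set x | t < u x].
  rewrite -[X in measurable X]setTI [X in setT `&` X](_ : _ = u @^-1` `]t, +oo[%classic).
    exact: mu.
  by apply/seteqP; split => x /=; rewrite in_itv /= andbT.
rewrite -(@lee_pmul2l _ t%:E) ?lte_fin // muleA -EFinM divff ?gt_eqF // mul1e.
have -> : (P [set x | (t < u x)%R] = \int[P]_x (\1_[set x | (t < u x)%R] x)%:E)%E.
  by rewrite integral_indic // setIT.
rewrite -ge0_integralZl //; last 2 first.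
- exact/measurable_EFinP/measurable_indic.
- by rewrite lee_fin ltW.
apply: ge0_le_integral => //.
- by move=> x _; rewrite mule_ge0 // lee_fin ?ltW.
- by apply: measurable_funeM; exact/measurable_EFinP/measurable_indic.
- exact/measurable_EFinP.
move=> x _; rewrite -EFinM lee_fin indicE; have [tx|tx] := boolP (t < u x).
  by rewrite mem_set // mulr1 ltW.
by rewrite memNset ?mulr0 // => H; rewrite H in tx.
Qed.

End TailComparison.

(** * Reflection inequalities *)

Section LevyInequality.
Context {R : realType} {G : topologicalZmodType} {m : probability (borel G) R}.
Context {X : completeNormedModType R[i]}.
Hypothesis cptG : compact [set: G].
Hypothesis haarm : haar_measure m.

(** What Lévy's argument needs of the partial sums, isolated so that it applies both to f and to the
    remainders f - S n. *)
Definition reflection_system (f : G -> X) (S : nat -> G -> X) (a : nat -> G) :=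
  [/\ forall j, continuous (S j),
      forall j n x, (j <= n)%N -> S j (x + a n) = S j x &
      forall n, {ae m, forall x, f x + f (x + a n) = 2 *: S n x}].

Variables (f : G -> X) (S : nat -> G -> X) (a : nat -> G).
Hypothesis sf : simple_limit (f : borel G -> X).
Hypothesis refl : reflection_system f S a.

Lemma super_level_measurable (u : borel G -> R) (t : R) : measurable_fun setT u ->
  measurable [set x | t < u x].
Proof.
move=> mu; rewrite -[X in measurable X]setTI [X in setT `&` X](_ : _ = u @^-1` `]t, +oo[%classic).
  exact: mu.
by apply/seteqP; split => x /=; rewrite in_itv /= andbT.
Qed.

Let mS j : measurable_fun setT ((fun x => rnorm (S j x)) : borel G -> R).
Proof. by apply: continuous_measurable; apply: rnorm_continuous; case: refl. Qed.

(* On the event that S_n is the first partial sum of norm > t, which is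
   invariant under the translation by a_n, one of f(x) and f(x + a_n) has norm > t. *)
Lemma Levy_tail (t : R) :
  (m [set x : borel G | exists j, (t < rnorm (S j x))%R] <= 2%:E * m [set x : borel G | (t < rnorm (f x))%R])%E.
Proof.
have [cS invS reflS] := refl.
pose E : set (borel G) := [set x | t < rnorm (f x)].
have mE : measurable E by apply: super_level_measurable; exact: simple_limit_rnorm.
pose A n : set (borel G) := [set x | t < rnorm (S n x) /\ forall j, (j < n)%N -> rnorm (S j x) <= t].
have mA n : measurable (A n).
  have -> : A n = [set x | t < rnorm (S n x)] `&` \bigcap_(j in [set j | (j < n)%N]) ~` [set x : borel G | t < rnorm (S j x)].
    apply/seteqP; split => x /=.
      by move=> [h1 h2]; split => // j /= jn; apply/negP; rewrite -leNgt h2.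
    by move=> [h1 h2]; split => // j jn; rewrite leNgt; apply/negP; exact: (h2 j jn).
  apply: measurableI; first exact: super_level_measurable.
  apply: bigcap_measurableType.
  by move=> j _; apply: measurableC; exact: super_level_measurable.
have tA : trivIset setT A.
  move=> i j _ _ [x [[xi1 xi2] [xj1 xj2]]].
  have [ij|ij|//] := ltngtP i j.
    by have := xj2 _ ij; rewrite leNgt xi1.
  by have := xi2 _ ij; rewrite leNgt xj1.
have UA : [set x : borel G | exists j, t < rnorm (S j x)] = \bigcup_n A n.
  apply/seteqP; split => x /=; last by move=> [n _ [h _]]; exists n.
  move=> ex; have := ex_minnP ex => -[n hn nmin]; exists n => //; split => // j jn.
  by rewrite leNgt; apply/negP => /nmin; rewrite leqNgt jn.
have mAn n : (m (A n) <= 2%:E * m (A n `&` E))%E.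
  pose tA' : set (borel G) := (fun x : G => a n + x) @^-1` (A n `&` E).
  have mtA : measurable tA'.
    by rewrite -[tA']setTI; apply: (translate_measurable (a n)) => //; exact: measurableI.
  have [N [mN N0 HN]] := reflS n.
  have sub : A n `<=` (A n `&` E) `|` tA' `|` N.
    move=> x Ax; have [Nx|nNx] := pselect (N x); first by right.
    left; have Ex : f x + f (x + a n) = 2 *: S n x.
      by apply: contrapT => H; apply: nNx; exact: HN.
    have [xE|xE] := ltP t (rnorm (f x)); first by left.
    right; rewrite /tA' /= addrC; have Ax' : A n (x + a n).
      case: Ax => h1 h2; split; first by rewrite invS.
      by move=> j jn; rewrite invS ?h2 // ltnW.
    split => //; rewrite /E /= ltNge; apply/negP => xE'.
    case: Ax => h1 _.
    have : rnorm (2 *: S n x) <= 2 * t.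
      by rewrite -Ex (le_trans (rnormD _ _)) // mulr_natl mulr2n lerD.
    have -> : (2 : R[i]) = (2 : R)%:C%C by rewrite rmorph_nat.
    by rewrite rnormZr ger0_norm // leNgt ltr_pM2l // h1.
  have mAE : measurable (A n `&` E) by exact: measurableI.
  have mU : measurable (A n `&` E `|` tA') by exact: measurableU.
  apply: (le_trans (le_measure m _ _ sub)); rewrite ?inE //; first exact: measurableU.
  rewrite (le_trans (measureU2 m mU mN)) // [X in (_ + X)%E](_ : _ = 0%E) // adde0.
  rewrite (le_trans (measureU2 m mAE mtA)) //.
  have E1 : m tA' = m (A n `&` E) by exact: (haar_invariant haarm).
  by rewrite /= E1 muleC mule_natr mule2n.
rewrite UA measure_bigcup //.
have mAE n : measurable (A n `&` E) by exact: measurableI.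
apply: (le_trans (lee_nneseries _ (fun n _ => mAn n))) => //.
rewrite nneseriesZl // lee_pmul2l // ?lte_fin //.
rewrite (_ : (\sum_(i <oo | i \in setT) m (A i `&` E))%E = m (\bigcup_n (A n `&` E))); last first.
  rewrite measure_bigcup //; last exact: trivIset_setIr.
apply: le_measure; rewrite ?inE //; first exact: bigcup_measurable.
by move=> x [n _ []].
Qed.

(** Covers 0 and the indices j < n. Finite maxima are measurable, and monotone convergence leads
    from them to the supremum. *)
Fixpoint running_max (u : nat -> R) n : R :=
  if n is n'.+1 then Num.max (running_max u n') (u n') else 0.

Lemma running_max_ge0 u n : 0 <= running_max u n.
Proof. by elim: n => //= n IH; rewrite le_max IH. Qed.

Lemma running_max_nd u : nondecreasing_seq (running_max u).
Proof. by apply/nondecreasing_seqP => n /=; rewrite le_max lexx. Qed.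

Lemma running_max_lt u n r : 0 <= r -> r < running_max u n -> exists j, r < u j.
Proof.
move=> r0; elim: n => /= [|n IH]; first by rewrite ltNge r0.
by rewrite lt_max => /orP[/IH //|]; exists n.
Qed.

(** [Levy_tail] at level r^(1/p) compares the tails of the p-th powers with the same factor 2.
    Integrating in r gives the bound for finite maxima, and monotone convergence passes to the
    limit. *)
Lemma Levy_moment (p : R) : 1 <= p ->
  (\int[m]_x (ereal_sup (range (fun j => (rnorm (S j x))%:E)) `^ p) <=
   2%:E * \int[m]_x ((rnorm (f x))%:E `^ p))%E.
Proof.
move=> p1; have p0 : 0 < p by exact: lt_le_trans ltr01 p1.
have pn0 : p != 0 by rewrite gt_eqF.
pose M n (x : borel G) := running_max (fun j => rnorm (S j x)) n.
have M0 n x : 0 <= M n x by exact: running_max_ge0.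
have mM n : measurable_fun setT (M n).
  elim: n => [|n IH]; first exact: measurable_cst.
  by rewrite /M /=; apply: measurable_maxr.
have mpow (u : borel G -> R) : measurable_fun setT u -> measurable_fun setT (fun x => u x `^ p).
  by move=> mu; apply: (measurableT_comp (measurable_powR p) mu).
have powK (y : R) : 0 <= y -> (y `^ p) `^ p^-1 = y.
  by move=> y0; rewrite -powRrM divff // powRr1.
have powK' (y : R) : 0 <= y -> (y `^ p^-1) `^ p = y.
  by move=> y0; rewrite -powRrM mulVf // powRr1.
have lt_pow (r y : R) : 0 <= r -> 0 <= y -> (r < y `^ p) = (r `^ p^-1 < y).
  move=> r0 y0; apply/idP/idP => H.
    by rewrite -(powK y y0) gt0_ltr_powR ?invr_gt0 ?nnegrE ?powR_ge0.
  by rewrite -(powK' r r0) gt0_ltr_powR ?nnegrE ?powR_ge0.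
have Mle n : (\int[m]_x ((M n x) `^ p)%:E <= 2%:E * \int[m]_x ((rnorm (f x)) `^ p)%:E)%E.
  apply: ge0_integral_le_tail => //.
  - exact: mpow.
  - by apply: mpow; exact: simple_limit_rnorm.
  - by move=> x; exact: powR_ge0.
  - by move=> x; exact: powR_ge0.
  move=> r r0.
  have -> : [set x | r < M n x `^ p] = [set x | r `^ p^-1 < M n x].
    by apply/seteqP; split => x /=; rewrite lt_pow.
  have -> : [set x : borel G | r < rnorm (f x) `^ p] = [set x | r `^ p^-1 < rnorm (f x)].
    by apply/seteqP; split => x /=; rewrite lt_pow // rnorm_ge0.
  apply: le_trans (Levy_tail (r `^ p^-1)).
  apply: le_measure; rewrite ?inE.
  - exact: super_level_measurable.
  - have -> : [set x : borel G | exists j, r `^ p^-1 < rnorm (S j x)] =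
        \bigcup_j [set x | r `^ p^-1 < rnorm (S j x)].
      by apply/seteqP; split => x /= [j]; exists j.
    by apply: bigcup_measurable => j _; exact: super_level_measurable.
  by move=> x /=; apply: running_max_lt; exact: powR_ge0.
pose g n (x : borel G) := ((M n x) `^ p)%:E.
have g_nd x : nondecreasing_seq (g^~ x).
  move=> i j ij; rewrite lee_fin ge0_ler_powR ?nnegrE ?(ltW p0) //.
  exact: running_max_nd.
have cv : (\int[m]_x g n x)%E @[n --> \oo] --> (\int[m]_x (limn (g^~ x)))%E.
  have mg n : measurable_fun setT (g n) by apply/measurable_EFinP; exact: mpow.
  have g0 n x : setT x -> (0 <= g n x)%E by move=> _; rewrite lee_fin powR_ge0.
  exact: (cvg_monotone_convergence measurableT mg g0 (fun x _ => g_nd x)).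
have le_lim : (\int[m]_x (limn (g^~ x)) <= 2%:E * \int[m]_x ((rnorm (f x))%:E `^ p))%E.
  apply: (cvge_to_le cv); apply: nearW => n; rewrite (le_trans (Mle n)) //.
(* A pointwise bound by the limit of the finite maxima is enough; measurability of the supremum is
   not established. *)
apply: le_trans le_lim; apply: ge0_le_integral_nonmeasurable => x; first exact: poweR_ge0.
have g_le n : (g n x <= limn (g^~ x))%E.
  rewrite (cvg_lim _ (ereal_nondecreasing_cvgn (g_nd x))) //.
  by apply: ereal_sup_ubound; exists n.
have lim0 : (0 <= limn (g^~ x))%E by rewrite (le_trans _ (g_le 0%N)) // lee_fin powR_ge0.
have S_le : (ereal_sup (range (fun j => (rnorm (S j x))%:E)) <= (limn (g^~ x)) `^ p^-1)%E.
  apply: ge_ereal_sup => _ [j _ <-].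
  rewrite -(powK _ (rnorm_ge0 (S j x))) -poweR_EFin.
  apply: gt0_ler_poweR; rewrite ?invr_ge0 ?(ltW p0) ?in_itv /= ?leey ?lee_fin ?powR_ge0 ?lim0 //.
  rewrite (le_trans _ (g_le j.+1)) // lee_fin ge0_ler_powR ?nnegrE ?(ltW p0) ?rnorm_ge0 //.
  by rewrite /M /= le_max lexx orbT.
have S0 : (0 <= ereal_sup (range (fun j => (rnorm (S j x))%:E)))%E.
  apply: (@le_trans _ _ (rnorm (S 0%N x))%:E); first by rewrite lee_fin rnorm_ge0.
  by apply: ereal_sup_ubound; exists 0%N.
have -> : limn (g^~ x) = ((limn (g^~ x)) `^ p^-1 `^ p)%E.
  by rewrite -poweRrM mulVf // poweRe1.
apply: gt0_ler_poweR; rewrite ?(ltW p0) ?in_itv /= ?leey ?S0 ?poweR_ge0 //.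
Qed.

End LevyInequality.

(** * Almost everywhere convergence *)

Section ReflectionConvergence.
Context {R : realType} {G : topologicalZmodType} {m : probability (borel G) R}.
Context {X : completeNormedModType R[i]}.
Hypothesis cptG : compact [set: G].
Hypothesis haarm : haar_measure m.
Variables (f : G -> X) (S : nat -> G -> X) (a : nat -> G).
Hypothesis sf : simple_limit (f : borel G -> X).
Hypothesis refl : reflection_system (m := m) f S a.
Hypothesis L1S : forall e : R, 0 < e ->
  exists n, (L1norm (P := m) (fun x => f x - S n x)%R <= e%:E)%E.

(** S n is invariant under every a (n + j), so subtracting it from f subtracts 2 S n from the
    reflected sum. *)
Lemma reflection_system_tail n :
  reflection_system (m := m) (fun x => f x - S n x) (fun j x => S (n + j)%N x - S n x)
    (fun j => a (n + j)%N).
Proof.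
have [cS invS reflS] := refl; split.
- by move=> j x; apply: cvgB; exact: cS.
- by move=> j k x jk; rewrite !invS // ?leq_add2l // leq_addr.
move=> j; move: (reflS (n + j)%N); apply: ae_imply => x E.
by rewrite (invS n) ?leq_addr // addrACA E -opprD -[S n x + S n x]mulr2n -[S n x *+ 2]scaler_nat scalerBr.
Qed.

Lemma reflection_ae_cvg : {ae m, forall x, S n x @[n --> \oo] --> f x}.
Proof.
have [cS _ _] := refl.
have sS n : simple_limit (S n : borel G -> X) by exact: continuous_simple_limit.
pose D n (t : R) : set (borel G) := [set x | exists j, t < rnorm (S (n + j)%N x - S n x)].
pose E n (t : R) : set (borel G) := [set x | t < rnorm (f x - S n x)].
have mE n t : measurable (E n t).
  by apply: super_level_measurable; apply: simple_limit_rnorm; exact: simple_limitB.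
have mD n t : measurable (D n t).
  have -> : D n t = \bigcup_j [set x : borel G | t < rnorm (S (n + j)%N x - S n x)].
    by apply/seteqP; split => x /= [j]; exists j.
  apply: bigcup_measurable => j _; apply: super_level_measurable.
  by apply: simple_limit_rnorm; exact: simple_limitB.
(* The constant 3 is 2 from Lévy's inequality for the remainder, after Markov, plus 1 from Markov's
   inequality for f - S n itself. *)
have mDE n t : 0 < t -> (m (D n t `|` E n t) <=
    (3 / t)%:E * L1norm (P := m) (fun x => f x - S n x)%R)%E.
  move=> t0; have h1 := Levy_tail haarm (simple_limitB sf (sS n)) (reflection_system_tail n) t.
  have h2 : (m (E n t) <= (t^-1)%:E * L1norm (P := m) (fun x => f x - S n x)%R)%E.
    apply: Markov_tail => //; last by move=> x; exact: rnorm_ge0.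
    by apply: simple_limit_rnorm; exact: simple_limitB.
  apply: le_trans (measureU2 m (mD n t) (mE n t)) _.
  have h3 : (m (D n t) <= 2%:E * ((t^-1)%:E * L1norm (P := m) (fun x => f x - S n x)%R))%E.
    by apply: le_trans h1 _; apply: lee_wpmul2l.
  apply: le_trans (leeD h3 h2) _.
  rewrite muleA -EFinM -ge0_muleDl ?lee_fin ?mulr_ge0 ?invr_ge0 ?(ltW t0) //.
  by rewrite -EFinD (_ : 2 * t^-1 + t^-1 = 3 / t) //; ring.
(* Outside B t, some n has f and all later partial sums within t of S n. A single n with f - S n
   small in L_1 bounds the measure of B t, so no limit along n is required. *)
pose B (t : R) := \bigcap_n (D n t `|` E n t).
have negB t : 0 < t -> m.-negligible (B t).
  move=> t0; have mB : measurable (B t).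
    by apply: bigcap_measurableType => n _; exact: measurableU.
  exists (B t); split => //; apply/eqP; rewrite eq_le measure_ge0 andbT.
  apply/lee_addgt0Pr => e e0; rewrite add0e.
  have e3 : 0 < e / (3 / t) by rewrite !divr_gt0.
  have [n Hn] := L1S e3.
  have sub : B t `<=` D n t `|` E n t by move=> x /(_ n Logic.I).
  apply: (le_trans (le_measure m _ _ sub)); rewrite ?inE //; first exact: measurableU.
  apply: le_trans (mDE n t t0) _.
  apply: (@le_trans _ _ ((3 / t)%:E * (e / (3 / t))%:E)%E).
    by apply: lee_wpmul2l => //; rewrite lee_fin divr_ge0 // ltW.
  by rewrite -EFinM lee_fin mulrC divfK // gt_eqF // divr_gt0.
have neg : m.-negligible (\bigcup_k B (k.+1%:R^-1)).
  by apply: negligible_bigcup => k; apply: negB; rewrite invr_gt0.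
apply: negligibleS neg => x; rewrite /= => ncv; apply: contrapT => nB; apply: ncv.
apply/cvg_rnorm/cvgrPdist_lt => e e0.
have e2 : 0 < e / 2 by rewrite divr_gt0.
have /cvgrPdist_lt /(_ _ e2) [k _ /(_ k (leqnn k))] := @cvg_harmonic R.
rewrite /= sub0r normrN ger0_norm // => ke.
have [n Hn] : exists n, ~ (D n k.+1%:R^-1 `|` E n k.+1%:R^-1) x.
  apply: contrapT => nex; apply: nB; exists k => // n _.
  by apply: contrapT => H; apply: nex; exists n.
exists n => // j /= nj; rewrite sub0r normrN ger0_norm ?rnorm_ge0 //.
have h1 : rnorm (f x - S n x) <= k.+1%:R^-1.
  by rewrite leNgt; apply/negP => H; apply: Hn; right.
have h2 : rnorm (S j x - S n x) <= k.+1%:R^-1.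
  rewrite leNgt; apply/negP => H; apply: Hn; left; exists (j - n)%N.
  by rewrite subnKC.
rewrite (le_lt_trans (rnorm_triangle (S n x) _ _)) // [rnorm (S n x - f x)]rnormBC.
rewrite (le_lt_trans (lerD h2 h1)) // (splitr e); exact: ltrD.
Qed.

End ReflectionConvergence.

(** * Dirichlet series *)

Section DirichletSeries.
Context {R : realType} {G : topologicalZmodType} {m : probability (borel G) R}.
Context {X : completeNormedModType R[i]}.
Hypothesis cptG : compact [set: G].
Hypothesis hausG : hausdorff_space G.
Hypothesis haarm : haar_measure m.
Variable h : nat -> G -> R[i].
Hypothesis hchar : forall n, character (h n).
Hypothesis horth : forall k l, k != l -> cint (m := m) (fun x => (h k x)^* * h l x) = 0.

(** Everything is linear in p, so one monomial is added at a time: under translation by a its two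
    copies double when l < n and cancel otherwise. N exceeds all indices occurring in p, so beyond
    it the translation fixes p. *)
Lemma hpoly_coef (p : G -> X) : hpoly h p -> exists c : nat -> X,
  (forall k, has_bochner_integral (P := m) (fun x => (h k x)^* *: p x) (c k)) /\
  (exists N, forall n a, (forall k, h k a = if (k < n)%N then 1 else -1) ->
    (forall x, p x + p (x + a) = 2 *: \sum_(k < n) h k x *: c k) /\
    ((N <= n)%N -> forall x, p (x + a) = p x)).
Proof.
have cJ k : ccont (fun x => (h k x)^*) by apply: character_ccont; exact: character_conj.
elim=> [|q l v hq [c [Hc [N HN]]]].
  exists (fun=> 0); split.
    move=> k; have := has_bochner_integral_complex cptG (0 : X) (cJ k) (m := m).
    by rewrite scaler0.
  exists 0%N => n a _; split=> // x.
  by rewrite addr0 big1 ?scaler0 // => k _; rewrite scaler0.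
exists (fun k => c k + (k == l)%:R *: v); split.
  move=> k; have -> : (fun x => (h k x)^* *: (q x + h l x *: v)) =
      (fun x => (h k x)^* *: q x + ((h k x)^* * h l x) *: v).
    by apply/funext => x; rewrite scalerDr scalerA.
  apply: has_bochner_integralD; first exact: Hc.
  have -> : ((k == l)%:R : R[i]) = cint (m := m) (fun x => (h k x)^* * h l x).
    have [->|kl] := eqVneq k l; last by rewrite horth.
    have -> : (fun x => (h l x)^* * h l x) = fun=> 1.
      by apply/funext => x; rewrite mulrC character_mulJ.
    by rewrite cint_cst.
  by apply: has_bochner_integral_complex => //; apply: ccontM => //; exact: character_ccont.
exists (maxn N l.+1) => n a Ha; have [h1 h2] := HN n a Ha; split.
  move=> x; rewrite addrACA h1 charD // Ha.
  under [in RHS]eq_bigr do rewrite scalerDr.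
  rewrite big_split /= scalerDr; congr (_ + _).
  case: ltnP => ln.
    rewrite (bigD1 (Ordinal ln)) //= eqxx scale1r big1 ?addr0; last first.
      by move=> k; rewrite -val_eqE /= => /negPf ->; rewrite scale0r scaler0.
    by rewrite mulr1 scaler_nat mulr2n.
  rewrite big1 ?scaler0; last first.
    move=> k _; rewrite (_ : (k : nat) == l = false) ?scale0r ?scaler0 //.
    by apply/negbTE; rewrite neq_ltn (leq_trans (ltn_ord k) ln).
  by rewrite mulrN1 scaleNr subrr.
rewrite geq_max => /andP[Nn ln] x; rewrite h2 // charD // Ha ln mulr1 //.
Qed.

Variable f : G -> X.
Hypothesis sf : simple_limit (f : borel G -> X).
Hypothesis Lf : (L1norm (P := m) f < +oo)%E.
Hypothesis spec : forall c, character c -> (forall n, c <> h n) -> fourier_coef m f c = 0.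
Variable a : nat -> G.
Hypothesis aE : forall n k, h k (a n) = if (k < n)%N then 1 else -1.

Let S n x := \sum_(k < n) h k x *: fourier_coef m f (h k).

Let cS n : continuous (S n).
Proof.
rewrite /S; elim: n => [|n IH].
  by under eq_fun do rewrite big_ord0; exact: cst_continuous.
under eq_fun do rewrite big_ord_recr /=.
have c : continuous (fun x => h n x *: fourier_coef m f (h n)).
  by apply: continuous_scale; exact: character_ccont.
by move=> x; apply: cvgD; [exact: IH|exact: c].
Qed.

Lemma L1norm_eq0 (g : G -> X) : simple_limit (g : borel G -> X) ->
  L1norm (P := m) g = 0%E -> {ae m, forall x, g x = 0}.
Proof.
move=> sg g0; have mg := simple_limit_rnormE sg.
have [H _] := ae_eq_integral_abs m measurableT mg.
have : ae_eq m setT (fun x => (rnorm (g x))%:E) (cst 0%E).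
  apply: H; rewrite -g0; apply: eq_integral => x _.
  by rewrite gee0_abs // lee_fin rnorm_ge0.
apply: ae_imply => x /(_ Logic.I) [] gx0; exact: rnorm_eq0.
Qed.

Let sS n : simple_limit (S n : borel G -> X).
Proof. exact: continuous_simple_limit (cS (n := n)). Qed.

Let stf n : simple_limit ((fun x => f (x + a n)) : borel G -> X).
Proof. exact: simple_limit_translate. Qed.

(* Translation by [a n] fixes [h k] for k < n and changes its sign for k >= n. *)
Let reflS n : {ae m, forall x, f x + f (x + a n) = 2 *: S n x}.
Proof.
have sg : simple_limit ((fun x => f x + f (x + a n) - 2 *: S n x) : borel G -> X).
  by apply: simple_limitB; [exact: simple_limitD|exact: simple_limitZ].
suff L0 : L1norm (P := m) (fun x => f x + f (x + a n) - 2 *: S n x) = 0%E.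
  by move: (L1norm_eq0 sg L0); apply: ae_imply => x /eqP; rewrite subr_eq0 => /eqP.
apply/eqP; rewrite eq_le L1norm_ge0 andbT; apply/lee_addgt0Pr => e e0; rewrite add0e.
(* Two copies of f - p, one of them translated, and twice the n coefficient errors, each at most e /
   C. *)
pose C : R := 2 + 2 * n%:R; have C0 : 0 < C by rewrite ltr_wpDr // mulr_ge0.
have d0 : 0 < e / C by rewrite divr_gt0.
have [p hp Lp] := hpoly_dense cptG hausG haarm hchar sf Lf spec d0.
have [c [Hc [N HN]]] := hpoly_coef hp; have [h1 _] := HN n (a n) (aE n).
have cp := hpoly_continuous hchar hp; have sp := continuous_simple_limit cptG cp.
have sfp := simple_limitB sf sp.
have stfp : simple_limit ((fun x => f (x + a n) - p (x + a n)) : borel G -> X).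
  exact: (simple_limit_translate (f := fun x => f x - p x) (a n) sfp).
have dk k : rnorm (fourier_coef m f (h k) - c k) <= e / C.
  rewrite -lee_fin.
  have H := has_bochner_integral_sub (has_fourier_coef cptG sf Lf (hchar k)) (Hc k).
  apply: (le_trans H).
  under eq_fun do rewrite -scalerBr.
  by rewrite (L1norm_character (fun x => f x - p x) (character_conj (hchar k))).
pose q x := 2 *: \sum_(k < n) h k x *: (fourier_coef m f (h k) - c k).
have qE x : f x + f (x + a n) - 2 *: S n x = (f x - p x) + (f (x + a n) - p (x + a n)) - q x.
  have -> : 2 *: S n x = (p x + p (x + a n)) + q x.
    rewrite h1 /q -scalerDr -big_split /=; congr (2 *: _).
    by apply: eq_bigr => k _; rewrite -scalerDr addrC subrK.
  by rewrite (opprD (p x + _)) addrA (opprD (p x)) (addrACA (f x)).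
have hq : hpoly h q.
  have hsum l : hpoly h (fun x => \sum_(k < l) h k x *: (2 *: (fourier_coef m f (h k) - c k))).
    elim: l => [|l IH]; first by under eq_fun do rewrite big_ord0; exact: hpoly0.
    by under eq_fun do rewrite big_ord_recr /=; exact: hpolyD.
  have -> : q = fun x => \sum_(k < n) h k x *: (2 *: (fourier_coef m f (h k) - c k)).
    apply/funext => x; rewrite /q scaler_sumr; apply: eq_bigr => k _.
    by rewrite !scalerA mulrC.
  exact: hsum.
have sq := continuous_simple_limit cptG (hpoly_continuous hchar hq).
have Lq : (L1norm (P := m) q <= (2 * (n%:R * (e / C)))%:E)%E.
  apply: L1norm_sup => // x; rewrite /q.
  have -> : (2 : R[i]) = (2 : R)%:C%C by rewrite rmorph_nat.
  rewrite rnormZr ger0_norm // ler_wpM2l //.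
  rewrite (le_trans (rnorm_sum _ _)) //.
  rewrite (le_trans (y := \sum_(k < n) e / C)) //.
    by apply: ler_sum => k _; rewrite rnormZ1 ?char_norm1.
  by rewrite sumr_const card_ord mulr_natl.
have -> : L1norm (P := m) (fun x => f x + f (x + a n) - 2 *: S n x) =
    L1norm (P := m) (fun x => (f x - p x) + (f (x + a n) - p (x + a n)) - q x).
  by apply: eq_integral => x _; rewrite qE.
have sNq : simple_limit ((fun x => - q x) : borel G -> X).
  by under eq_fun do rewrite -scaleN1r; exact: simple_limitZ.
apply: le_trans (L1normD (simple_limitD sfp stfp) sNq) _.
apply: le_trans (leeD (L1normD sfp stfp) (lexx _)) _.
rewrite (L1norm_translate haarm (f := fun x => f x - p x)) //.
have -> : L1norm (P := m) (fun x => - q x) = L1norm (P := m) q.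
  by apply: eq_integral => x _; rewrite rnormN.
apply: le_trans (leeD (leeD Lp Lp) Lq) _.
rewrite -!EFinD lee_fin le_eqVlt; apply/orP; left; apply/eqP.
by rewrite /C; field; rewrite gt_eqF.
Qed.

Lemma Dirichlet_reflection : reflection_system (m := m) f S a.
Proof.
split; [by move=> n; exact: cS| |exact: reflS].
move=> j n x jn; apply: eq_bigr => k _.
by rewrite charD // aE (leq_trans (ltn_ord k) jn) mulr1.
Qed.

(** By reflection f - S n is a.e. half of f minus its translate by a n. For n large a nearby
    polynomial p is fixed by that translation, so f may be replaced by f - p in the difference, and
    the norm is at most that of f - p. *)
Lemma Dirichlet_L1_cvg (e : R) : 0 < e ->
  exists n, (L1norm (P := m) (fun x => f x - S n x)%R <= e%:E)%E.
Proof.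
move=> e0; have [p hp Lp] := hpoly_dense cptG hausG haarm hchar sf Lf spec e0.
have [c [Hc [n HN]]] := hpoly_coef hp; exists n.
have [_ /(_ (leqnn n)) pa] := HN n (a n) (aE n).
have cp := hpoly_continuous hchar hp; have sp := continuous_simple_limit cptG cp.
have sfp := simple_limitB sf sp.
have stfp : simple_limit ((fun x => f (x + a n) - p (x + a n)) : borel G -> X).
  exact: (simple_limit_translate (f := fun x => f x - p x) (a n) sfp).
have sd := simple_limitB sfp stfp.
have -> : L1norm (P := m) (fun x => f x - S n x) =
    L1norm (P := m) (fun x => (2^-1)%:C%C *: ((f x - p x) - (f (x + a n) - p (x + a n)))).
  apply: ae_ge0_eq_integral_nonmeasurable.
  - by move=> x; rewrite lee_fin rnorm_ge0.
  - by move=> x; rewrite lee_fin rnorm_ge0.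
  - by apply: simple_limit_rnormE; exact: simple_limitZ.
  move: (reflS n); apply: ae_imply => x E; congr (rnorm _)%:E.
  rewrite pa opprB subrKA.
  have -> : - f (x + a n) = f x - 2 *: S n x.
    by rewrite -E opprD addrA subrr sub0r.
  rewrite addrA -[f x + f x]mulr2n -[f x *+ 2]scaler_nat -scalerBr scalerA.
  have -> : (2^-1)%:C%C * 2 = (1 : R[i]).
    have -> : (2 : R[i]) = (2 : R)%:C%C by rewrite rmorph_nat.
    by rewrite -rmorphM /= mulVf.
  by rewrite scale1r.
rewrite L1normZ //.
have -> : complex.Re `|(2^-1 : R)%:C%C| = 2^-1.
  by rewrite normc_def /= expr0n addr0 sqrtr_sqr ger0_norm.
have : (L1norm (P := m) (fun x => (f x - p x) - (f (x + a n) - p (x + a n)))%R <= (2 * e)%:E)%E.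
  have -> : (fun x => (f x - p x) - (f (x + a n) - p (x + a n))) =
      (fun x => (f x - p x) + (-1) *: (f (x + a n) - p (x + a n))).
    by apply/funext => x; rewrite scaleN1r.
  apply: le_trans (L1normD sfp (simple_limitZ (-1) stfp)) _.
  rewrite L1normZ // normrN1 mul1e (L1norm_translate haarm (f := fun x => f x - p x)) //.
  by rewrite mulr_natl mulr2n EFinD leeD.
move=> H; apply: (@le_trans _ _ ((2^-1)%:E * (2 * e)%:E)%E); first exact: lee_wpmul2l.
by rewrite -EFinM mulrA mulVf // mul1r.
Qed.

End DirichletSeries.

Section BochnerNorm.
Context {d} {T : measurableType d} {R : realType} {P : probability T R}.
Context {X : completeNormedModType R[i]}.
Implicit Types (f g : T -> X) (p : R).

Lemma bochner_normE p f :
  bochner_norm P p f = ((\int[P]_x ((rnorm (f x))%:E `^ p)) `^ p^-1)%E.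
Proof.
rewrite /bochner_norm unlock; congr (_ `^ _)%E; apply: eq_integral => x _.
by rewrite gee0_abs // lee_fin rnorm_ge0.
Qed.

Lemma simple_limit_poweR p f : simple_limit f ->
  measurable_fun setT (fun x => ((rnorm (f x))%:E `^ p)%E).
Proof.
move=> sf; have -> : (fun x => ((rnorm (f x))%:E `^ p)%E) = fun x => (rnorm (f x) `^ p)%:E.
  by apply/funext => x; rewrite poweR_EFin.
apply/measurable_EFinP.
exact: (measurableT_comp (measurable_powR p) (simple_limit_rnorm sf)).
Qed.

Lemma ae_eq_bochner_norm p f g : simple_limit g -> {ae P, forall x, f x = g x} ->
  bochner_norm P p f = bochner_norm P p g.
Proof.
move=> sg fg; rewrite !bochner_normE; congr (_ `^ _)%E.
apply: ae_ge0_eq_integral_nonmeasurable.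
- by move=> x; exact: poweR_ge0.
- by move=> x; exact: poweR_ge0.
- exact: simple_limit_poweR.
- by apply: ae_imply fg => x ->.
Qed.

(** Pointwise |f| <= 1 + |f|^p, and the constant 1 is integrable for a probability measure. *)
Lemma bochner_norm_L1norm p f : simple_limit f -> 1 <= p ->
  (bochner_norm P p f < +oo)%E -> (L1norm (P := P) f < +oo)%E.
Proof.
move=> sf p1; have p0 : 0 < p by exact: lt_le_trans p1.
rewrite bochner_normE => /lty_poweRy Lp; rewrite /L1norm.
have {}Lp : (\int[P]_x ((rnorm (f x))%:E `^ p) < +oo)%E.
  by apply: Lp; rewrite invr_neq0 // gt_eqF.
apply: (@le_lt_trans _ _ (\int[P]_x (1 + (rnorm (f x))%:E `^ p))%E).
  apply: ge0_le_integral_nonmeasurable => x; first by rewrite lee_fin rnorm_ge0.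
  rewrite poweR_EFin -EFinD lee_fin.
  have [u1|u1] := leP (rnorm (f x)) 1; first by rewrite (le_trans u1) // lerDl powR_ge0.
  rewrite (le_trans (y := rnorm (f x) `^ p)) ?lerDr //.
  by rewrite -{1}[rnorm (f x)]powRr1 ?rnorm_ge0 // ler_powR // ltW.
rewrite ge0_integralD //.
- rewrite integral_cst // mul1e; apply: lte_add_pinfty => //; exact: (le_lt_trans (probability_le1 P measurableT) (ltry 1)).
- by move=> x _; exact: poweR_ge0.
- exact: simple_limit_poweR.
Qed.

End BochnerNorm.

Section DirichletGroup.
Context {R : realType} {G : topologicalZmodType} {lambda : nat -> R} {beta : R -> G}.
Context {m : probability (borel G) R}.
Hypothesis freq : frequency lambda.
Hypothesis indep : Q_linearly_independent lambda.
Hypothesis dg : dirichlet_group lambda beta.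
Hypothesis haarm : haar_measure m.
Let h n := dirichlet_char beta (lambda n).

Lemma dirichlet_charP n : frequency_char beta (h n) (lambda n).
Proof.
rewrite /h /dirichlet_char; case: xgetP => [g _ //|].
by have [g gP] := dirichlet_char_ex dg n; move=> /(_ g).
Qed.

Lemma dirichlet_char_orth k l : k != l -> cint (m := m) (fun x => (h k x)^* * h l x) = 0.
Proof.
move=> kl; apply: (cint_frequency_char (dirichlet_compact dg) haarm (beta := beta)
  (mu := - lambda k + lambda l)).
  apply: frequency_charM; last exact: dirichlet_charP.
  by apply: frequency_char_conj; exact: dirichlet_charP.
rewrite addrC subr_eq0; move: kl; rewrite neq_ltn => /orP[] /(frequency_mono freq) H.
  by rewrite gt_eqF.
by rewrite lt_eqF.
Qed.

Lemma dirichlet_char_signs : exists a : nat -> G,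
  forall n k, h k (a n) = if (k < n)%N then 1 else -1.
Proof.
suff /choice [a aE] : forall n, exists a, forall k, h k a = if (k < n)%N then 1 else -1.
  by exists a.
move=> n; have [|a aE] := Kronecker_signs (dirichlet_compact dg) haarm indep dirichlet_charP
  (eps := fun k => if (k < n)%N then 1 else -1).
  by move=> k; case: ifP; rewrite ?sqrrN expr1n.
by exists a => k; rewrite aE; case: ifP => // _; rewrite rmorphN1.
Qed.

Context {X : completeNormedModType R[i]}.
Variables (p : R) (f : G -> X).
Hypothesis p1 : 1 <= p.
Hypothesis Hf : hardy_space m lambda beta p f.

Lemma hardy_space_representative : exists g : G -> X,
  [/\ simple_limit (g : borel G -> X), {ae m, forall x, f x = g x},
      (L1norm (P := m) g < +oo)%E, bochner_norm m p f = bochner_norm m p g &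
      forall c, character c -> fourier_coef m f c = fourier_coef m g c].
Proof.
have [[mf Lf] _] := Hf; have [g sg fg] := strongly_measurable_simple_limit mf.
have E := ae_eq_bochner_norm p sg fg.
have Lg : (L1norm (P := m) g < +oo)%E.
  by apply: (bochner_norm_L1norm sg p1); rewrite -E.
exists g; split => // c cc.
apply: bochner_integralE (has_fourier_coef (dirichlet_compact dg) sg Lg cc) _.
by apply: ae_imply fg => x ->.
Qed.

Lemma hardy_space_reflection : exists g : G -> X, exists a : nat -> G,
  [/\ simple_limit (g : borel G -> X), {ae m, forall x, f x = g x},
      bochner_norm m p f = bochner_norm m p g,
      reflection_system (m := m) g (fourier_sum m lambda beta f) a &
      forall e : R, 0 < e -> exists n,
        (L1norm (P := m) (fun x => g x - fourier_sum m lambda beta f n x)%R <= e%:E)%E].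
Proof.
have [g [sg fg Lg E cE]] := hardy_space_representative.
have [a aE] := dirichlet_char_signs.
have hchar n : character (h n) by have [] := dirichlet_charP n.
have spec c : character c -> (forall n, c <> h n) -> fourier_coef m g c = 0.
  by move=> cc ch; rewrite -cE //; case: Hf => _; apply.
have SE : fourier_sum m lambda beta f =
    fun n x => \sum_(k < n) h k x *: fourier_coef m g (h k).
  by apply/funext => n; apply/funext => x; apply: eq_bigr => k _; rewrite -cE.
have [cG hG] := (dirichlet_compact dg, dirichlet_hausdorff dg).
exists g, a; rewrite SE; split => //.
  exact: (Dirichlet_reflection cG hG haarm hchar dirichlet_char_orth sg Lg spec aE).
exact: (Dirichlet_L1_cvg cG hG haarm hchar dirichlet_char_orth sg Lg spec aE).
Qed.

End DirichletGroup.

Unset Implicit Arguments.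
Set Strict Implicit.
Set Printing Implicit Defensive.

Theorem theorem5p2 (R : realType) (lambda : nat -> R)
    (G : topologicalZmodType) (beta : R -> G) (m : probability (borel G) R)
    (X : completeNormedModType R[i]) :
  frequency lambda -> Q_linearly_independent lambda ->
  dirichlet_group lambda beta -> haar_measure m ->
  forall p : R, 1 <= p ->
  forall f : G -> X, hardy_space m lambda beta p f ->
  (Lnorm m p%:E (fun x => ereal_sup
      [set (rnorm (fourier_sum m lambda beta f N x))%:E | N in [set N | (1 <= N)%N]])
    <= 2%:E * bochner_norm m p f)%E
  /\ {ae m, forall x, fourier_sum m lambda beta f N x @[N --> \oo] --> f x}.
Proof.
move=> freq indep dg haarm p p1 f Hf.
have [g [a [sg fg E refl L1]]] := hardy_space_reflection freq indep dg haarm p1 Hf.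
have cG := dirichlet_compact dg; split; last first.
  have H := reflection_ae_cvg cG haarm sg refl L1.
  have fgH : {ae m, forall x, f x = g x /\ fourier_sum m lambda beta f N x @[N --> \oo] --> g x}.
    exact: ae_and fg H.
  by apply: ae_imply fgH => x [->].
have p0 : 0 < p by exact: lt_le_trans p1.
rewrite E bochner_normE unlock.
set I := (\int[m]_x ((rnorm (g x))%:E `^ p))%E.
have I0 : (0 <= I)%E by apply: integral_ge0 => x _; exact: poweR_ge0.
have le1 : (\int[m]_x (`|ereal_sup [set (rnorm (fourier_sum m lambda beta f N x))%:E
    | N in [set N | (1 <= N)%N]]| `^ p) <= 2%:E * I)%E.
  apply: le_trans (Levy_moment haarm sg refl p1).
  apply: ge0_le_integral_nonmeasurable => x; first exact: poweR_ge0.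
  have s0 : (0 <= ereal_sup [set (rnorm (fourier_sum m lambda beta f N x))%:E
      | N in [set N | (1 <= N)%N]])%E.
    apply: (@le_trans _ _ (rnorm (fourier_sum m lambda beta f 1 x))%:E).
      by rewrite lee_fin rnorm_ge0.
    by apply: ereal_sup_ubound; exists 1%N.
  rewrite gee0_abs //.
  (* [Levy_moment] also admits the index 0, the empty sum, which only enlarges the supremum. *)
  have ss : (ereal_sup [set (rnorm (fourier_sum m lambda beta f N x))%:E
      | N in [set N | (1 <= N)%N]] <=
      ereal_sup (range (fun j => (rnorm (fourier_sum m lambda beta f j x))%:E)))%E.
    by apply: ereal_sup_le => _ [N _ <-]; exists N.
  apply: gt0_ler_poweR => //; first exact: ltW.
    by rewrite in_itv /= s0 leey.
  by rewrite in_itv /= (le_trans s0 ss) leey.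
apply: (@le_trans _ _ ((2%:E * I) `^ p^-1)%E).
  apply: gt0_ler_poweR le1.
  - by rewrite invr_ge0 ltW.
  - by rewrite in_itv /= leey andbT; apply: integral_ge0 => x _; exact: poweR_ge0.
  - by rewrite in_itv /= leey andbT mule_ge0.
rewrite poweRM // lee_wpmul2r ?poweR_ge0 // poweR_EFin lee_fin.
(* The proof yields 2^(1/p), which is at most 2 as p >= 1. *)
rewrite -{2}[2]powRr1 // ler_powR ?ler1n // invf_le1 //.
Qed.
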